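(* Let $f \in L^1(\mathbb{R}^2)$. If the set $\{w \in \mathbb{R}^2 : f(w) \ne 0\}$ has finite Lebesgue measure and the Weyl transform $W(f)$ is a finite rank operator on $L^2(\mathbb{R})$, then $f \equiv 0$ (i.e. $f = 0$ as an element of $L^1(\mathbb{R}^2)$).
   Context: Let $\mathcal{H}=L^2(\mathbb{R})$ (complex-valued functions) and let $\mathcal{B}(\mathcal{H})$ be the set of bounded operators on $\mathcal{H}$. For $f \in L^1(\mathbb{R}^2)$ (complex-valued), the Weyl transform of $f$ is the operator $W(f)\in\mathcal{B}(\mathcal{H})$ defined by $$(W(f)\phi)(t) = \iint f(x,y)\, e^{\pi i (xy+2yt)}\, \phi(t+x) \, dx\, dy .$$ Equivalently, $W(f)=\iint f(x,y)\rho(x,y)\,dx\,dy$, where $\rho(x,y)$ is the unitary operator on $\mathcal{H}$ given by $(\rho(x,y)\phi)(t)=e^{\pi i(xy+2yt)}\phi(t+x)$. *)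

(* Defs.v *)
From mathcomp Require Import all_boot all_order all_algebra.
From mathcomp Require Import all_classical all_reals all_analysis.
From mathcomp Require Import complex.

Set Implicit Arguments.
Unset Strict Implicit.
Unset Printing Implicit Defensive.

Import Order.TTheory GRing.Theory Num.Theory.
Import numFieldNormedType.Exports.

Local Open Scope classical_set_scope.
Local Open Scope ring_scope.

Section ComplexValued.
Context d (T : measurableType d) (R : realType).
Implicit Types (mu : {measure set T -> \bar R}) (f : T -> R[i]).

Definition cmeasurable f : Prop :=
  measurable_fun setT (fun x => complex.Re (f x)) /\
  measurable_fun setT (fun x => complex.Im (f x)).

(* Representatives of elements of the complex space L^p(mu); the norms live on
   real-valued functions, hence the detour through the real modulus [normc]. *)
Definition cLfun mu (p : \bar R) f : Prop :=
  cmeasurable f /\ finite_norm mu p (fun x => ComplexField.Normc.normc (f x)).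

Definition cintegral mu f : R[i] :=
  Complex (Rintegral mu setT (fun x => complex.Re (f x)))
          (Rintegral mu setT (fun x => complex.Im (f x))).

End ComplexValued.

Section Weyl.
Context (R : realType).
Implicit Types (f : R * R -> R[i]) (phi : R -> R[i]).

Definition leb1 : {measure set (measurableTypeR R) -> \bar R} :=
  @lebesgue_measure R.

Definition leb2 :
    {measure set (measurableTypeR R * measurableTypeR R) -> \bar R} :=
  (@lebesgue_measure R \x @lebesgue_measure R)%E.

Definition cexpi (a : R) : R[i] := Complex (cos a) (sin a).

Definition rho (x y : R) phi : R -> R[i] :=
  fun t => cexpi (pi * (x * y + 2 * y * t)) * phi (t + x).

(* For f in L^1 and phi in L^2 the integrand is integrable for almost every t;
   at the exceptional t the value is unspecified, so [weyl f phi] represents an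
   element of L^2, determined up to a null set. *)
Definition weyl f phi : R -> R[i] :=
  fun t => cintegral leb2 (fun w => f w * rho w.1 w.2 phi t).

(* An operator on L^2(R) is given by its action on representatives; equality in
   L^2 is almost everywhere equality. Finite rank: the range lies in the linear
   span of finitely many elements of L^2. *)
Definition finite_rank (A : (R -> R[i]) -> (R -> R[i])) : Prop :=
  exists (n : nat) (g : 'I_n -> R -> R[i]),
    (forall i, cLfun leb1 2%:E (g i)) /\
    forall phi, cLfun leb1 2%:E phi ->
      exists c : 'I_n -> R[i],
        {ae leb1, forall t, A phi t = \sum_(i < n) c i * g i t}.

End Weyl.

(* Main.v *)
Require Import Defs.
From mathcomp Require Import all_boot all_order all_algebra.
From mathcomp Require Import all_classical all_reals all_analysis.
From mathcomp Require Import complex measurable_realfun ring lra.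

(** W(f) is the integral operator with kernel K(t, t + x) = k(t, x), where k(t, x) is, up to a
    phase, the Fourier transform of the slice f(x, -) at t.  Finite rank means
    K(t, s) = sum_(k < m) e_k(t) h_k(s) with the e_k orthonormal; put w = sum_k |h_k|^2.  If w = 0
    a.e. then k = 0 and f = 0 by Fourier uniqueness.  Otherwise take N trigonometric polynomials
    p_j in the characters exp(2 pi i l d s), l < N, with the functions p_j sqrt(w) orthonormal.
    Multiplying k(t, x) by p_j(t + x) amounts to replacing f by a combination of its twisted
    translates by (0, l d), which lives on the union E' of the translates of E = {f <> 0}, and by
    Plancherel the total energy of these N combinations is sum_j ||p_j sqrt(w)||^2 = N.  On the
    other hand Fourier inversion writes their values at a point (x, y) as inner products of the
    p_j sqrt(w) with a single function of squared norm at most m, so Bessel's inequality bounds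
    the sum of their squared moduli at that point by m.  Hence N <= m |E'|, and |E'| <= |E| + 1 for
    d small, which is absurd when N is large. *)

Set Implicit Arguments.
Unset Strict Implicit.
Unset Printing Implicit Defensive.

Import Order.TTheory GRing.Theory Num.Theory.
Import numFieldNormedType.Exports.
Import ComplexField.Normc.

Local Open Scope classical_set_scope.
Local Open Scope ring_scope.

(** * Complex arithmetic: squared moduli and unimodular exponentials *)

Section ComplexNumbers.
Variable R : realType.
Implicit Types z w : R[i].

(** Multiplying the kernel by [p(s)] composes [W(f)] with a multiplication operator, so the rank
    stays at most [m], while a character of [s] acts on [f] as a twisted translation. The support
    grows as little as desired because the spacing [d] is chosen after [N]. The root of [w] is
    forced: the [e_k] being orthonormal, the integral of [|K(t, s)|^2] over [t] is [w(s)], so the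
    [p_j] must be orthonormal in [L^2(w ds)]. Such [p_j] exist because a nonzero trigonometric
    polynomial vanishes only on a null set, whereas [w] does not vanish almost everywhere. The
    constant [m] comes from Cauchy-Schwarz in [k]: the factor [w] it produces cancels and leaves the
    sum of the [|e_k|^2], whose integral is [m]. The obstacle is that [f] is only in [L^1], so its
    slices have no [L^2] Fourier theory at the outset. The factorization makes [k(-, x)] a finite
    sum of products of two [L^2] functions, hence integrable for almost every [x]; inversion and
    Plancherel are therefore proved for integrable functions with integrable transform. *)

Definition nsq z : R := complex.Re z ^+ 2 + complex.Im z ^+ 2.

Lemma cReD z w : complex.Re (z + w) = complex.Re z + complex.Re w.
Proof. by case: z; case: w. Qed.
Lemma cImD z w : complex.Im (z + w) = complex.Im z + complex.Im w.
Proof. by case: z; case: w. Qed.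
Lemma cReM z w : complex.Re (z * w) =
  complex.Re z * complex.Re w - complex.Im z * complex.Im w.
Proof. by case: z; case: w. Qed.
Lemma cImM z w : complex.Im (z * w) =
  complex.Re z * complex.Im w + complex.Im z * complex.Re w.
Proof. by case: z => a b; case: w => c d /=. Qed.
Lemma cRe_conj z : complex.Re (z^*)%C = complex.Re z.
Proof. by case: z. Qed.
Lemma cIm_conj z : complex.Im (z^*)%C = - complex.Im z.
Proof. by case: z. Qed.
Lemma conjcM z w : ((z * w)^*)%C = (z^*)%C * (w^*)%C.
Proof. by rewrite rmorphM. Qed.
Lemma conjcD z w : ((z + w)^*)%C = (z^*)%C + (w^*)%C.
Proof. by rewrite rmorphD. Qed.
Lemma conjcN z : ((- z)^*)%C = - (z^*)%C.
Proof. by rewrite rmorphN. Qed.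
Lemma cRe_realM (r : R) z : complex.Re (r%:C%C * z) = r * complex.Re z.
Proof. by rewrite cReM /= mul0r subr0. Qed.
Lemma cIm_realM (r : R) z : complex.Im (r%:C%C * z) = r * complex.Im z.
Proof. by rewrite cImM /= mul0r addr0. Qed.
Lemma cext z w : complex.Re z = complex.Re w -> complex.Im z = complex.Im w -> z = w.
Proof. by case: z => a b; case: w => c d /= -> ->. Qed.

Lemma normcE z : normc z = Num.sqrt (nsq z).
Proof. by case: z. Qed.

Lemma nsq_ge0 z : 0 <= nsq z.
Proof. by rewrite addr_ge0// sqr_ge0. Qed.

Lemma normc_ge0 z : 0 <= normc z.
Proof. by rewrite normcE sqrtr_ge0. Qed.

Lemma sqr_normcE z : normc z ^+ 2 = nsq z.
Proof. by rewrite normcE sqr_sqrtr// nsq_ge0. Qed.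

Lemma nsqM z w : nsq (z * w) = nsq z * nsq w.
Proof. by rewrite /nsq cReM cImM; ring. Qed.

Lemma nsq_conj z : nsq (z^*)%C = nsq z.
Proof. by rewrite /nsq cRe_conj cIm_conj sqrrN. Qed.

Lemma nsq0 : nsq 0 = 0.
Proof. by rewrite /nsq /= expr0n addr0. Qed.

Lemma nsq_eq0 z : nsq z = 0 -> z = 0.
Proof.
move=> h; apply: eq0_normc; rewrite normcE h; exact: sqrtr0.
Qed.

Lemma nsqE z : ((nsq z)%:C)%C = (z * z^*)%C.
Proof.
apply: cext; rewrite ?cReM ?cImM ?cRe_conj ?cIm_conj /nsq /=; ring.
Qed.

Lemma nsqD_le z w : nsq (z + w) <= 2 * nsq z + 2 * nsq w.
Proof.
rewrite /nsq cReD cImD; set a := complex.Re z; set b := complex.Im z.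
set c := complex.Re w; set e := complex.Im w.
have := sqr_ge0 (a - c); have := sqr_ge0 (b - e); nra.
Qed.

Lemma normc_le_nsqD z w : normc (z * w) <= nsq z + nsq w.
Proof.
rewrite normcM -!sqr_normcE.
have := sqr_ge0 (normc z - normc w); have := sqr_ge0 (normc z + normc w).
nra.
Qed.

Lemma Re_le_normc z : `|complex.Re z| <= normc z.
Proof.
rewrite normcE -sqrtr_sqr ler_wsqrtr// /nsq lerDl sqr_ge0//.
Qed.

Lemma Im_le_normc z : `|complex.Im z| <= normc z.
Proof.
rewrite normcE -sqrtr_sqr ler_wsqrtr// /nsq lerDr sqr_ge0//.
Qed.

Lemma normc_leD z : normc z <= `|complex.Re z| + `|complex.Im z|.
Proof.
rewrite -(@ler_pXn2r _ 2) ?nnegrE ?normc_ge0 ?addr_ge0//.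
rewrite sqr_normcE /nsq -[complex.Re z ^+ 2]real_normK ?num_real// -[complex.Im z ^+ 2]real_normK ?num_real//.
have := normr_ge0 (complex.Re z); have := normr_ge0 (complex.Im z); nra.
Qed.

Lemma normc_cexpi (a : R) : normc (cexpi a) = 1.
Proof. by rewrite normcE /nsq /= cos2Dsin2 sqrtr1. Qed.

Lemma nsq_cexpi (a : R) : nsq (cexpi a) = 1.
Proof. by rewrite /nsq /= cos2Dsin2. Qed.

Lemma cexpiD (a b : R) : cexpi (a + b) = cexpi a * cexpi b.
Proof. by apply: cext; rewrite ?cReM ?cImM /= ?cosD ?sinD//; ring. Qed.

Lemma cexpi0 : cexpi (0 : R) = 1.
Proof. by apply: cext; rewrite /= ?cos0 ?sin0. Qed.

Lemma cexpiN (a : R) : cexpi (- a) = ((cexpi a)^*)%C.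
Proof. by apply: cext; rewrite /= ?cosN ?sinN. Qed.

Lemma cexpi_neq0 (a : R) : cexpi a != 0.
Proof.
apply/eqP => h; have := normc_cexpi a; rewrite h normc0 => /eqP.
by rewrite eq_sym oner_eq0.
Qed.

Lemma cexpiX (a : R) n : cexpi a ^+ n = cexpi (a *+ n).
Proof.
elim: n => [|n IH]; first by rewrite expr0 mulr0n cexpi0.
by rewrite exprS mulrS cexpiD IH.
Qed.

Lemma conjc_sum I (r : seq I) (P : pred I) (F : I -> R[i]) :
  ((\sum_(i <- r | P i) F i)^*)%C = \sum_(i <- r | P i) ((F i)^*)%C.
Proof. by rewrite rmorph_sum. Qed.

Lemma conjCE z : Num.conj z = (z^*)%C.
Proof. by []. Qed.

(** Cauchy-Schwarz for finite sums, by induction on both sums at once; the nonnegativity of the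
    partial sums is carried along because the cross term is bounded through them. *)
Lemma nsq_sum_mul n (a b : 'I_n -> R[i]) :
  nsq (\sum_(k < n) a k * b k) <= (\sum_(k < n) nsq (a k)) * \sum_(k < n) nsq (b k).
Proof.
suff : nsq (\sum_(k < n) a k * b k) <= (\sum_(k < n) nsq (a k)) * (\sum_(k < n) nsq (b k)) /\
    (0 <= \sum_(k < n) nsq (a k)) && (0 <= \sum_(k < n) nsq (b k)) by case.
elim/big_rec3 : _ => [|k B A S _ [IH /andP[A0 B0]]].
  by rewrite nsq0 mulr0 lexx.
split; last by apply/andP; split; rewrite addr_ge0//; exact: nsq_ge0.
have := le_normcD (a k * b k) S; rewrite normcM.
move: IH; rewrite -!sqr_normcE.
have := normc_ge0 S; have := normc_ge0 (a k); have := normc_ge0 (b k).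
have := normc_ge0 (a k * b k + S).
move: (normc (a k * b k + S)) (normc (a k)) (normc (b k)) (normc S) => n0 x y z.
move=> n00 y0 x0 z0 zAB tri.
(* The cross term: after squaring and using [z ^+ 2 <= A * B], the difference of the two sides is
   the square of [A * y ^+ 2 - B * x ^+ 2]. *)
have xyz : 2 * (x * y) * z <= A * y ^+ 2 + B * x ^+ 2.
  rewrite -ler_sqr ?nnegrE; last 2 first.
  - by rewrite !mulr_ge0.
  - by rewrite addr_ge0// mulr_ge0// sqr_ge0.
  apply: (@le_trans _ _ (4 * (x * y) ^+ 2 * (A * B))).
    have -> : (2 * (x * y) * z) ^+ 2 = 4 * (x * y) ^+ 2 * z ^+ 2 by ring.
    by rewrite ler_wpM2l// mulr_ge0// sqr_ge0.
  rewrite -subr_ge0.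
  have -> : (A * y ^+ 2 + B * x ^+ 2) ^+ 2 - 4 * (x * y) ^+ 2 * (A * B) =
    (A * y ^+ 2 - B * x ^+ 2) ^+ 2 by ring.
  exact: sqr_ge0.
apply: (@le_trans _ _ ((x * y + z) ^+ 2)); first by rewrite ler_pXn2r ?nnegrE// addr_ge0// mulr_ge0.
have -> : (x * y + z) ^+ 2 = x ^+ 2 * y ^+ 2 + 2 * (x * y) * z + z ^+ 2 by ring.
have -> : (x ^+ 2 + A) * (y ^+ 2 + B) = x ^+ 2 * y ^+ 2 + (A * y ^+ 2 + B * x ^+ 2) + A * B by ring.
by rewrite lerD// lerD.
Qed.

End ComplexNumbers.

(** * Integration of complex-valued functions *)

Section AlmostEverywhere.
Context d (T : measurableType d) (R : realType) (mu : {measure set T -> \bar R}).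
Implicit Types P Q : T -> Prop.

Lemma ae_imp P Q : {ae mu, forall x, P x} -> (forall x, P x -> Q x) -> {ae mu, forall x, Q x}.
Proof. by move=> aP PQ; apply: filterS aP. Qed.

Lemma ae_imp2 P1 P2 Q : {ae mu, forall x, P1 x} -> {ae mu, forall x, P2 x} ->
  (forall x, P1 x -> P2 x -> Q x) -> {ae mu, forall x, Q x}.
Proof. by move=> a1 a2 PQ; apply: filterS2 a1 a2. Qed.

Lemma ae_forall_fin (I : finType) (P : I -> T -> Prop) :
  (forall i, {ae mu, forall x, P i x}) -> {ae mu, forall x, forall i, P i x}.
Proof. exact: filter_forall. Qed.

Lemma ae_forall_count (I : countType) (P : I -> T -> Prop) :
  (forall i, {ae mu, forall x, P i x}) -> {ae mu, forall x, forall i, P i x}.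
Proof.
move=> h.
have : {ae mu, forall x, forall n : nat, if unpickle n is Some i then P i x else True}.
  apply: ae_foralln => n; case: (unpickle n) => [i|]; first exact: h.
  exact: aeW.
by move=> h'; apply: (ae_imp h') => x hx i; have := hx (pickle i); rewrite pickleK.
Qed.

End AlmostEverywhere.

Section ComplexMeasurable.
Context d (T : measurableType d) (R : realType).
Implicit Types (f g : T -> R[i]) (r : T -> R).

Lemma cmeasurable_cst (z : R[i]) : cmeasurable (fun _ : T => z).
Proof. by split; exact: measurable_cst. Qed.

Lemma cmeasurableD f g : cmeasurable f -> cmeasurable g -> cmeasurable (fun x => f x + g x).
Proof.
move=> [f1 f2] [g1 g2]; split.
- by under eq_fun do rewrite cReD; exact: measurable_funD.
- by under eq_fun do rewrite cImD; exact: measurable_funD.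
Qed.

Lemma cmeasurableM f g : cmeasurable f -> cmeasurable g -> cmeasurable (fun x => f x * g x).
Proof.
move=> [f1 f2] [g1 g2]; split.
- by under eq_fun do rewrite cReM; apply: measurable_funB; exact: measurable_funM.
- by under eq_fun do rewrite cImM; apply: measurable_funD; exact: measurable_funM.
Qed.

Lemma cmeasurableZ (z : R[i]) g : cmeasurable g -> cmeasurable (fun x => z * g x).
Proof. by apply: cmeasurableM; exact: cmeasurable_cst. Qed.

Lemma cmeasurable_conj f : cmeasurable f -> cmeasurable (fun x => ((f x)^*)%C).
Proof.
move=> [f1 f2]; split.
- by under eq_fun do rewrite cRe_conj.
- by under eq_fun do rewrite cIm_conj; exact: measurable_funN.
Qed.

Lemma cmeasurable_sum I (s : seq I) (P : pred I) (F : I -> T -> R[i]) :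
  (forall i, P i -> cmeasurable (F i)) ->
  cmeasurable (fun x => \sum_(i <- s | P i) F i x).
Proof.
move=> mF; elim: s => [|i s IH].
  by under eq_fun do rewrite big_nil; exact: cmeasurable_cst.
have [Pi|Pi] := boolP (P i); under eq_fun do [rewrite big_cons ?Pi ?(negbTE Pi)]; last by [].
by apply: cmeasurableD => //; exact: mF.
Qed.

Lemma cmeasurable_real r : measurable_fun setT r -> cmeasurable (fun x => (r x)%:C%C).
Proof. by move=> mr; split => //=. Qed.

Lemma measurable_cos_comp r : measurable_fun setT r -> measurable_fun setT (fun x => cos (r x)).
Proof.
by move=> mr; apply: measurableT_comp mr; apply: continuous_measurable_fun; exact: continuous_cos.
Qed.

Lemma measurable_sin_comp r : measurable_fun setT r -> measurable_fun setT (fun x => sin (r x)).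
Proof.
by move=> mr; apply: measurableT_comp mr; apply: continuous_measurable_fun; exact: continuous_sin.
Qed.

Lemma cmeasurable_cexpi r : measurable_fun setT r -> cmeasurable (fun x => cexpi (r x)).
Proof. by move=> mr; split; [exact: measurable_cos_comp | exact: measurable_sin_comp]. Qed.

Lemma measurable_nsq f : cmeasurable f -> measurable_fun setT (fun x => nsq (f x)).
Proof. by move=> [f1 f2]; apply: measurable_funD; exact: measurable_funX. Qed.

Lemma measurable_normc f : cmeasurable f -> measurable_fun setT (fun x => normc (f x)).
Proof.
move=> mf; under eq_fun do rewrite normcE.
apply: (measurableT_comp (f := @Num.sqrt R)) (measurable_nsq mf).
by apply: continuous_measurable_fun; exact: sqrt_continuous.
Qed.

Lemma cmeasurable_eq0 f : cmeasurable f -> measurable [set x | f x = 0].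
Proof.
move=> mf; rewrite (_ : [set _ | _] = (fun x => nsq (f x)) @^-1` [set 0]); last first.
  apply/seteqP; split => x /=; first by move=> ->; rewrite nsq0.
  exact: nsq_eq0.
rewrite -[_ @^-1` _]setTI; apply: measurable_nsq => //.
Qed.

End ComplexMeasurable.

Lemma cmeasurable_comp d1 d2 (T1 : measurableType d1) (T2 : measurableType d2)
    (R : realType) (f : T2 -> R[i]) (u : T1 -> T2) :
  cmeasurable f -> measurable_fun setT u -> cmeasurable (fun x => f (u x)).
Proof. by move=> [f1 f2] mu; split; [exact: (measurableT_comp f1 mu)|exact: (measurableT_comp f2 mu)]. Qed.

Section ComplexIntegral.
Context d (T : measurableType d) (R : realType) (mu : {measure set T -> \bar R}).
Implicit Types (f g : T -> R[i]) (r : T -> R).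

Definition cintegrable f : Prop :=
  mu.-integrable setT (fun x => (complex.Re (f x))%:E) /\
  mu.-integrable setT (fun x => (complex.Im (f x))%:E).

Lemma cintegrable_measurable f : cintegrable f -> cmeasurable f.
Proof. by move=> [/measurable_int/measurable_EFinP f1 /measurable_int/measurable_EFinP f2]. Qed.

Lemma integrable_ge0P r : measurable_fun setT r -> (forall x, 0 <= r x) ->
  (\int[mu]_x (r x)%:E < +oo)%E -> mu.-integrable setT (fun x => (r x)%:E).
Proof.
move=> mr r0 h; apply/integrableP; split; first exact/measurable_EFinP.
by under eq_integral do rewrite gee0_abs ?lee_fin//.
Qed.

Lemma le_cintegrable f r : cmeasurable f -> (forall x, normc (f x) <= r x) ->
  mu.-integrable setT (fun x => (r x)%:E) -> cintegrable f.
Proof.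
move=> [f1 f2] fr ir; split.
- apply: le_integrable ir => //; first exact/measurable_EFinP.
  move=> x _; rewrite !abse_EFin lee_fin (le_trans (Re_le_normc _))//.
  by rewrite (le_trans (fr _))// ler_norm.
- apply: le_integrable ir => //; first exact/measurable_EFinP.
  move=> x _; rewrite !abse_EFin lee_fin (le_trans (Im_le_normc _))//.
  by rewrite (le_trans (fr _))// ler_norm.
Qed.

Lemma cintegrable_normc f : cintegrable f -> mu.-integrable setT (fun x => (normc (f x))%:E).
Proof.
move=> cf; have mf := cintegrable_measurable cf; case: cf => f1 f2.
have := integrableD measurableT (integrable_abse f1) (integrable_abse f2).
apply: le_integrable => //; first exact/measurable_EFinP/measurable_normc.
move=> x _; rewrite (_ : (_ \+ _)%E x = (`|complex.Re (f x)| + `|complex.Im (f x)|)%:E)//.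
rewrite !abse_EFin lee_fin ger0_norm ?normc_ge0// (le_trans (normc_leD _))// ler_norm//.
Qed.

Lemma cintegrableP f : cintegrable f <->
  cmeasurable f /\ (\int[mu]_x (normc (f x))%:E < +oo)%E.
Proof.
split=> [cf|[mf h]].
  split; first exact: cintegrable_measurable.
  exact/integrable_lty/cintegrable_normc.
apply: (le_cintegrable (r := fun x => normc (f x))) => //.
apply: integrable_ge0P => //; first exact: measurable_normc.
by move=> x; exact: normc_ge0.
Qed.

Lemma cintegrableD f g : cintegrable f -> cintegrable g -> cintegrable (fun x => f x + g x).
Proof.
move=> [f1 f2] [g1 g2]; split.
- under eq_fun do rewrite cReD EFinD; exact: integrableD.
- under eq_fun do rewrite cImD EFinD; exact: integrableD.
Qed.

Lemma cintegrable_conj f : cintegrable f -> cintegrable (fun x => ((f x)^*)%C).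
Proof.
move=> [f1 f2]; split.
- by under eq_fun do rewrite cRe_conj.
- by under eq_fun do rewrite cIm_conj EFinN; exact: integrableN.
Qed.

Lemma cintegrable0 : cintegrable (fun=> 0).
Proof. by split; exact: integrable0. Qed.

Lemma cintegrableM_bounded f g (M : R) : cmeasurable f -> (forall x, normc (f x) <= M) ->
  cintegrable g -> cintegrable (fun x => f x * g x).
Proof.
move=> mf fM cg; have mg := cintegrable_measurable cg.
apply: (le_cintegrable (r := fun x => M * normc (g x))).
- exact: cmeasurableM.
- by move=> x; rewrite normcM ler_wpM2r ?normc_ge0.
- under eq_fun do rewrite EFinM.
  exact/integrableZl/cintegrable_normc.
Qed.

Lemma cintegrableZ (z : R[i]) f : cintegrable f -> cintegrable (fun x => z * f x).
Proof. apply: (cintegrableM_bounded (M := normc z)) => //; exact: cmeasurable_cst. Qed.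

Lemma cintegrable_sum I (s : seq I) (P : pred I) (F : I -> T -> R[i]) :
  (forall i, P i -> cintegrable (F i)) ->
  cintegrable (fun x => \sum_(i <- s | P i) F i x).
Proof.
move=> mF; elim: s => [|i s IH].
  by under eq_fun do rewrite big_nil; exact: cintegrable0.
have [Pi|Pi] := boolP (P i); under eq_fun do [rewrite big_cons ?Pi ?(negbTE Pi)]; last by [].
by apply: cintegrableD => //; exact: mF.
Qed.

Lemma eq_cintegrable f g : f =1 g -> cintegrable f -> cintegrable g.
Proof. by move=> /funext ->. Qed.

Lemma eq_cint f g : f =1 g -> cintegral mu f = cintegral mu g.
Proof. by move=> /funext ->. Qed.

Lemma ae_eq_cintegrable f g : cmeasurable g -> {ae mu, forall x, f x = g x} ->
  cintegrable f -> cintegrable g.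
Proof.
move=> mg fg /cintegrableP[mf ff]; apply/cintegrableP; split => //.
rewrite (le_lt_trans _ ff)//; apply: ae_ge0_le_integral => //.
- by move=> x _; rewrite lee_fin normc_ge0.
- exact/measurable_EFinP/measurable_normc.
- by move=> x _; rewrite lee_fin normc_ge0.
- exact/measurable_EFinP/measurable_normc.
- by apply: filterS fg => x -> _.
Qed.

Lemma ae_eq_cint f g : cmeasurable f -> cmeasurable g -> {ae mu, forall x, f x = g x} ->
  cintegral mu f = cintegral mu g.
Proof.
move=> [f1 f2] [g1 g2] fg; congr Complex; congr fine; apply: ae_eq_integral => //;
  try exact/measurable_EFinP; by apply: filterS fg => x ->.
Qed.

Lemma cintD f g : cintegrable f -> cintegrable g ->
  cintegral mu (fun x => f x + g x) = cintegral mu f + cintegral mu g.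
Proof.
move=> [f1 f2] [g1 g2]; apply: cext; rewrite ?cReD ?cImD /=.
- by under eq_Rintegral do rewrite cReD; rewrite RintegralD.
- by under eq_Rintegral do rewrite cImD; rewrite RintegralD.
Qed.

Lemma integrableZl_EFin (a : R) r : mu.-integrable setT (fun x => (r x)%:E) ->
  mu.-integrable setT (fun x => (a * r x)%:E).
Proof. by move=> ir; under eq_fun do rewrite EFinM; exact: integrableZl. Qed.

Lemma cintZ (z : R[i]) f : cintegrable f ->
  cintegral mu (fun x => z * f x) = z * cintegral mu f.
Proof.
move=> [f1 f2]; apply: cext; rewrite ?cReM ?cImM /=.
- under eq_Rintegral do rewrite cReM.
  by rewrite RintegralB ?RintegralZl//; exact: integrableZl_EFin.
- under eq_Rintegral do rewrite cImM.
  by rewrite RintegralD ?RintegralZl//; exact: integrableZl_EFin.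
Qed.

Lemma cintZr (z : R[i]) f : cintegrable f ->
  cintegral mu (fun x => f x * z) = cintegral mu f * z.
Proof. by move=> cf; under eq_cint do rewrite mulrC; rewrite cintZ// mulrC. Qed.

Lemma cint_conj f : cintegrable f ->
  cintegral mu (fun x => ((f x)^*)%C) = ((cintegral mu f)^*)%C.
Proof.
move=> [f1 f2]; apply: cext; rewrite ?cRe_conj ?cIm_conj /=.
- by apply: eq_Rintegral => x _; rewrite cRe_conj.
- under eq_Rintegral do rewrite cIm_conj -mulN1r.
  by rewrite RintegralZl// mulN1r.
Qed.

Lemma cint0 : cintegral mu (fun=> 0) = 0.
Proof. by apply: cext => /=; rewrite /Rintegral /= integral0. Qed.

Lemma cint_sum I (s : seq I) (P : pred I) (F : I -> T -> R[i]) :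
  (forall i, P i -> cintegrable (F i)) ->
  cintegral mu (fun x => \sum_(i <- s | P i) F i x) =
  \sum_(i <- s | P i) cintegral mu (F i).
Proof.
move=> cF; elim: s => [|i s IH].
  by rewrite big_nil; under eq_cint do rewrite big_nil; rewrite cint0.
have [Pi|Pi] := boolP (P i); rewrite big_cons ?Pi ?(negbTE Pi); under eq_cint do [rewrite big_cons ?Pi ?(negbTE Pi)]; last by [].
rewrite cintD ?IH//; first exact: cF.
exact: cintegrable_sum.
Qed.

Lemma cint_real r : cintegral mu (fun x => (r x)%:C%C) = ((\int[mu]_x r x)%:C)%C.
Proof. by apply: cext => //=; rewrite /Rintegral/= integral0. Qed.

(** Multiplication by the unimodular [u] rotates the integral onto the positive real axis, where its
    modulus is the integral of a real part. An infinite right-hand side is disposed of first, so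
    measurability of [f] suffices. *)
Lemma normc_cint_le f : cmeasurable f ->
  ((normc (cintegral mu f))%:E <= \int[mu]_x (normc (f x))%:E)%E.
Proof.
move=> mf; set B := (X in (_ <= X)%E).
have B0 : (0 <= B)%E by apply: integral_ge0 => x _; rewrite lee_fin normc_ge0.
have [Boo|] := ltP B +oo%E; last by rewrite leye_eq => /eqP ->; rewrite leey.
have cf : cintegrable f by exact/cintegrableP.
set z := cintegral mu f; have [z0|z0] := eqVneq z 0.
  by rewrite z0 normc0.
have nz : normc z != 0 by apply: contra_neq z0; exact: eq0_normc.
pose u : R[i] := (z^*)%C * ((normc z)^-1)%:C%C.
have nu : normc u = 1.
  have nn : normc ((z^*)%C) = normc z by rewrite !normcE nsq_conj.
  rewrite /u normcM nn [normc (_%:C)%C]normcE /nsq /= expr0n addr0 sqrtr_sqr.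
  by rewrite ger0_norm ?invr_ge0 ?normc_ge0// divff.
have uz : u * z = (normc z)%:C%C.
  rewrite /u mulrAC [_^*%C * z]mulrC -nsqE -sqr_normcE; apply: cext => /=;
    rewrite ?mul0r ?mulr0 ?addr0 ?subr0 // expr2 -mulrA divff ?mulr1//.
have -> : normc z = complex.Re (cintegral mu (fun x => u * f x)).
  by rewrite cintZ// -/z uz.
have [i1 i2] := cintegrableZ u cf.
rewrite /= /Rintegral fineK; last exact: integrable_fin_num.
apply: le_integral => //; first exact: cintegrable_normc.
move=> x _; rewrite lee_fin (le_trans (ler_norm _))// (le_trans (Re_le_normc _))//.
by rewrite normcM nu mul1r.
Qed.

Lemma normc_cint_le_fin f : cintegrable f ->
  normc (cintegral mu f) <= \int[mu]_x normc (f x).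
Proof.
move=> cf; rewrite -lee_fin /Rintegral fineK.
  by apply: normc_cint_le; exact: cintegrable_measurable.
exact/integrable_fin_num/cintegrable_normc.
Qed.

End ComplexIntegral.

Section ComplexDominated.
Context d (T : measurableType d) (R : realType) (mu : {measure set T -> \bar R}).

Lemma cvg_EFin_comp (u : nat -> R) (l : R) :
  u @ \oo --> l -> (fun n => (u n)%:E) @ \oo --> l%:E.
Proof. by move=> h; apply: cvg_EFin => //; exact: nearW. Qed.

Lemma Rintegral_dominated (f_ : nat -> T -> R) (f g : T -> R) :
  (forall n, measurable_fun setT (f_ n)) -> measurable_fun setT f ->
  {ae mu, forall x, f_ ^~ x @ \oo --> f x} ->
  mu.-integrable setT (fun x => (g x)%:E) ->
  (forall n x, `|f_ n x| <= g x) ->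
  (fun n => \int[mu]_x f_ n x) @ \oo --> \int[mu]_x f x.
Proof.
move=> mf_ mf cf ig fg.
have [ifi _ c] := @dominated_convergence _ _ _ mu setT measurableT
  (fun n x => (f_ n x)%:E) (fun x => (f x)%:E) (fun x => (g x)%:E)
  (fun n => (measurable_EFinP _ _).2 (mf_ n)) ((measurable_EFinP _ _).2 mf)
  (filterS (fun x h _ => cvg_EFin_comp h) cf) ig
  (aeW _ (fun x n _ => fg n x)).
apply: fine_cvg; rewrite fineK//; exact: integrable_fin_num.
Qed.

Lemma cint_dominated (f_ : nat -> T -> R[i]) (f : T -> R[i]) (g : T -> R) :
  (forall n, cmeasurable (f_ n)) -> cmeasurable f ->
  {ae mu, forall x, (fun n => complex.Re (f_ n x)) @ \oo --> complex.Re (f x) /\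
     (fun n => complex.Im (f_ n x)) @ \oo --> complex.Im (f x)} ->
  mu.-integrable setT (fun x => (g x)%:E) ->
  (forall n x, normc (f_ n x) <= g x) ->
  (fun n => complex.Re (cintegral mu (f_ n))) @ \oo --> complex.Re (cintegral mu f) /\
  (fun n => complex.Im (cintegral mu (f_ n))) @ \oo --> complex.Im (cintegral mu f).
Proof.
move=> mf_ [mf1 mf2] cf ig fg; split; apply: (Rintegral_dominated (g := g)) => //.
- by move=> n; case: (mf_ n).
- by apply: filterS cf => x [].
- by move=> n x; rewrite (le_trans (Re_le_normc _)).
- by move=> n; case: (mf_ n).
- by apply: filterS cf => x [].
- by move=> n x; rewrite (le_trans (Im_le_normc _)).
Qed.

End ComplexDominated.

(** * Fubini's theorem and almost everywhere statements on products *)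

Section ComplexFubini.
Context d1 d2 (T1 : measurableType d1) (T2 : measurableType d2) (R : realType).
Variables (m1 : {sigma_finite_measure set T1 -> \bar R})
          (m2 : {sigma_finite_measure set T2 -> \bar R}).
Implicit Type f : T1 * T2 -> R[i].

(** Splitting into positive and negative parts reduces a function of arbitrary sign to Tonelli's
    measurability statement. *)
Lemma measurable_integral_pair2 (f : T1 * T2 -> \bar R) : measurable_fun setT f ->
  measurable_fun setT (fun x => \int[m2]_y f (x, y))%E.
Proof.
move=> mf; rewrite (_ : (fun x => _) = fun x =>
  (\int[m2]_y f^\+ (x, y) - \int[m2]_y f^\- (x, y))%E); last first.
  apply/funext => x; rewrite integralE; congr (_ - _)%E.
    by under eq_integral do rewrite funepos_comp/=.
  by under eq_integral do rewrite funeneg_comp/=.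
apply: emeasurable_funB.
- apply: (measurable_fun_fubini_tonelli_F (f^\+)%E) => //.
  exact: measurable_funepos.
- apply: (measurable_fun_fubini_tonelli_F (f^\-)%E) => //.
  exact: measurable_funeneg.
Qed.

Lemma measurable_fine_comp d (T : measurableType d) (f : T -> \bar R) :
  measurable_fun setT f -> measurable_fun setT (fun x => fine (f x)).
Proof. by move=> mf; apply: (measurableT_comp (f := fine)) mf. Qed.

Lemma cmeasurable_cint f : cmeasurable f ->
  cmeasurable (fun x => cintegral m2 (fun y => f (x, y))).
Proof.
move=> [f1 f2]; split; apply: measurable_fine_comp.
- by apply: (measurable_integral_pair2 (f := fun z => (complex.Re (f z))%:E)); exact/measurable_EFinP.
- by apply: (measurable_integral_pair2 (f := fun z => (complex.Im (f z))%:E)); exact/measurable_EFinP.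
Qed.

Lemma cmeasurable_pair1 f (y : T2) : cmeasurable f -> cmeasurable (fun x => f (x, y)).
Proof. by move=> mf; apply: (cmeasurable_comp mf); exact: measurable_pair2. Qed.

Lemma cmeasurable_pair2 f (x : T1) : cmeasurable f -> cmeasurable (fun y => f (x, y)).
Proof. by move=> mf; apply: (cmeasurable_comp mf); exact: measurable_pair1. Qed.

Lemma cintegrable_prodP f : cmeasurable f ->
  (\int[m1]_x \int[m2]_y (normc (f (x, y)))%:E < +oo)%E ->
  cintegrable (m1 \x m2)%E f.
Proof.
move=> mf h; apply/cintegrableP; split => //.
rewrite (fubini_tonelli1 (fun z => (normc (f z))%:E))//.
- exact/measurable_EFinP/measurable_normc.
- by move=> z; rewrite lee_fin normc_ge0.
Qed.

Lemma cintegrable_ae1 f : cintegrable (m1 \x m2)%E f ->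
  {ae m1, forall x, cintegrable m2 (fun y => f (x, y))}.
Proof.
move=> [/ae_integrable1 h1 /ae_integrable1 h2].
by apply: filterS2 h1 h2 => x; split.
Qed.

Lemma cintegrable_ae2 f : cintegrable (m1 \x m2)%E f ->
  {ae m2, forall y, cintegrable m1 (fun x => f (x, y))}.
Proof.
move=> [/ae_integrable2 h1 /ae_integrable2 h2].
by apply: filterS2 h1 h2 => x; split.
Qed.

(** [Rintegral] replaces an infinite inner integral by a real default value; for an integrable [g]
    this happens only on a null set. *)
Let fine_fubini1 (g : T1 * T2 -> R) :
  (m1 \x m2)%E.-integrable setT (fun z => (g z)%:E) ->
  \int[m1]_x (\int[m2]_y g (x, y)) = \int[(m1 \x m2)%E]_z g z.
Proof.
move=> ig; rewrite /Rintegral -(integral12_prod_meas1 ig); congr fine.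
apply: ae_eq_integral => //.
- apply/measurable_EFinP/measurable_fine_comp.
  exact: (measurable_fubini_F ig).
- exact: (measurable_fubini_F ig).
have := integrable_ae measurableT (integrable_fubini_F ig).
by apply: filterS => x /(_ Logic.I) fx _; rewrite fineK.
Qed.

Let fine_fubini2 (g : T1 * T2 -> R) :
  (m1 \x m2)%E.-integrable setT (fun z => (g z)%:E) ->
  \int[m2]_y (\int[m1]_x g (x, y)) = \int[(m1 \x m2)%E]_z g z.
Proof.
move=> ig; rewrite /Rintegral -(integral21_prod_meas1 ig); congr fine.
(* Integrability of the inner integral in the second order comes from the finite iterated integral
   of [|g|] taken in that order. *)
have iG : m2.-integrable setT (fubini_G m1 (fun z => (g z)%:E)).
  apply/integrableP; split; first exact: (measurable_fubini_G ig).
  have /integrableP[mg _] := ig.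
  have := (integrable21ltyP m1 m2 mg).1 ig.
  apply: (@le_lt_trans _ _ _ _ _).
  apply: ge0_le_integral => //.
  - by apply: measurableT_comp => //; exact: (measurable_fubini_G ig).
  - apply: (measurable_fun_fubini_tonelli_G (fun z => `|(g z)%:E|%E)) => //.
    exact: measurableT_comp.
  - move=> y _; apply: le_abse_integral => //.
    exact: (measurableT_comp mg (measurable_pair2 y)).
apply: ae_eq_integral => //.
- apply/measurable_EFinP/measurable_fine_comp.
  exact: (measurable_fubini_G ig).
- exact: (measurable_fubini_G ig).
have := integrable_ae measurableT iG.
by apply: filterS => x /(_ Logic.I) fx _; rewrite fineK.
Qed.

Lemma cfubini1 f : cintegrable (m1 \x m2)%E f ->
  cintegral m1 (fun x => cintegral m2 (fun y => f (x, y))) = cintegral (m1 \x m2)%E f.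
Proof.
move=> [f1 f2]; apply: cext => /=.
- exact: (fine_fubini1 (g := fun z => complex.Re (f z))).
- exact: (fine_fubini1 (g := fun z => complex.Im (f z))).
Qed.

Lemma cfubini2 f : cintegrable (m1 \x m2)%E f ->
  cintegral m2 (fun y => cintegral m1 (fun x => f (x, y))) = cintegral (m1 \x m2)%E f.
Proof.
move=> [f1 f2]; apply: cext => /=.
- exact: (fine_fubini2 (g := fun z => complex.Re (f z))).
- exact: (fine_fubini2 (g := fun z => complex.Im (f z))).
Qed.

Lemma cfubini f : cintegrable (m1 \x m2)%E f ->
  cintegral m1 (fun x => cintegral m2 (fun y => f (x, y))) =
  cintegral m2 (fun y => cintegral m1 (fun x => f (x, y))).
Proof. by move=> cf; rewrite cfubini1// cfubini2. Qed.

Lemma ae_ge0_integral0 d (T : measurableType d) (mu : {measure set T -> \bar R})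
    (f : T -> \bar R) : measurable_fun setT f -> (forall x, (0 <= f x)%E) ->
  (\int[mu]_x f x = 0)%E <-> {ae mu, forall x, f x = 0%E}.
Proof.
move=> mf f0; have -> : (\int[mu]_x f x = \int[mu]_x `|f x|)%E.
  by apply: eq_integral => x _; rewrite gee0_abs.
split=> [/(ae_eq_integral_abs mu measurableT mf).1|h].
  by apply: filterS => x; exact.
by apply/(ae_eq_integral_abs mu measurableT mf).2; apply: filterS h => x ->.
Qed.

(** [{ae mu, ...}] only asks that the complement lie inside a null set; a measurable complement is
    then null itself. *)
Lemma negligible_ae d (T : measurableType d) (mu : {measure set T -> \bar R})
    (P : T -> Prop) : measurable [set x | P x] ->
  {ae mu, forall x, P x} <-> mu (~` [set x | P x]) = 0%E.
Proof.
move=> mP; split=> [[N [mN N0 PN]]|h]; last first.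
  by exists (~` [set x | P x]); split => //; exact: measurableC.
apply/eqP; rewrite eq_le measure_ge0 andbT -N0.
by apply: le_measure => //; rewrite inE//; exact: measurableC.
Qed.

(** The product measure of the complement is the integral of the measures of its sections, and a
    nonnegative function with zero integral vanishes almost everywhere. *)
Lemma ae_prod1 (P : T1 * T2 -> Prop) : measurable [set z | P z] ->
  {ae (m1 \x m2)%E, forall z, P z} <-> {ae m1, forall x, {ae m2, forall y, P (x, y)}}.
Proof.
move=> mP; have mC : measurable (~` [set z | P z]) by exact: measurableC.
rewrite negligible_ae//.
transitivity {ae m1, forall x, m2 (xsection (~` [set z | P z]) x) = 0%E}.
  apply: (ae_ge0_integral0 m1 (f := m2 \o xsection _)) => //.
  exact: measurable_fun_xsection.
split; apply: filterS => x.
- move=> h; exists (xsection (~` [set z | P z]) x); split => //.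
    exact: measurable_xsection.
  by move=> y /= nP; rewrite xsectionE/=.
- move=> [N [mN N0 PN]]; apply/eqP; rewrite eq_le measure_ge0 andbT -N0.
  apply: le_measure; rewrite ?inE//; first exact: measurable_xsection.
  by move=> y; rewrite xsectionE /= => h; apply: PN.
Qed.

Lemma ae_prod2 (P : T1 * T2 -> Prop) : measurable [set z | P z] ->
  {ae (m1 \x m2)%E, forall z, P z} <-> {ae m2, forall y, {ae m1, forall x, P (x, y)}}.
Proof.
move=> mP; have mC : measurable (~` [set z | P z]) by exact: measurableC.
rewrite negligible_ae//.
transitivity {ae m2, forall y, m1 (ysection (~` [set z | P z]) y) = 0%E}.
  (* The product measure unfolds to sections over the first coordinate; the other order goes through
     Tonelli for the indicator. *)
  transitivity (\int[m1 \x m2]_z (\1_(~` [set z | P z]) z)%:E = 0)%E.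
    by rewrite integral_indic// setIT.
  rewrite (fubini_tonelli2 (fun z => (\1_(~` [set z | P z]) z)%:E))//; last first.
    exact/measurable_EFinP/measurable_indic.
  have -> : fubini_G m1 (fun z => (\1_(~` [set z | P z]) z)%:E) =
            m1 \o ysection (~` [set z | P z]).
    exact: indic_fubini_tonelli_GE.
  apply: (ae_ge0_integral0 m2 (f := m1 \o ysection _)) => //.
  exact: measurable_fun_ysection.
split; apply: filterS => y.
- move=> h; exists (ysection (~` [set z | P z]) y); split => //.
    exact: measurable_ysection.
  by move=> x /= nP; rewrite ysectionE/=.
- move=> [N [mN N0 PN]]; apply/eqP; rewrite eq_le measure_ge0 andbT -N0.
  apply: le_measure; rewrite ?inE//; first exact: measurable_ysection.
  by move=> x; rewrite ysectionE /= => h; apply: PN.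
Qed.

Lemma ae_swap (P : T1 * T2 -> Prop) : measurable [set z | P z] ->
  {ae m1, forall x, {ae m2, forall y, P (x, y)}} <->
  {ae m2, forall y, {ae m1, forall x, P (x, y)}}.
Proof. by move=> mP; rewrite -ae_prod1// ae_prod2. Qed.

End ComplexFubini.

(** * Invariance of integrals under measure-preserving maps *)

Section MeasurePreserving.
Context d (T : measurableType d) (R : realType) (mu : {measure set T -> \bar R}).
Variable phi : T -> T.

Definition mpres := measurable_fun setT phi /\
  forall A, measurable A -> mu (phi @^-1` A) = mu A.

Hypothesis mphi : mpres.

Lemma ge0_integral_mpres (f : T -> \bar R) : measurable_fun setT f ->
  (forall x, 0 <= f x)%E -> (\int[mu]_x f (phi x) = \int[mu]_x f x)%E.
Proof.
move=> mf f0; have [m1 m2] := mphi.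
have := @ge0_integral_pushforward _ _ _ _ _ phi m1 mu setT f measurableT mf (fun y _ => f0 y).
rewrite preimage_setT => <-; apply: eq_measure_integral => A mA _; exact: m2.
Qed.

Lemma integral_mpres (f : T -> \bar R) : measurable_fun setT f ->
  (\int[mu]_x f (phi x) = \int[mu]_x f x)%E.
Proof.
move=> mf; rewrite integralE [RHS]integralE; congr (_ - _)%E.
- rewrite -(ge0_integral_mpres (f := f^\+%E))//; last exact: measurable_funepos.
  by apply: eq_integral => x _; rewrite (funepos_comp f phi).
- rewrite -(ge0_integral_mpres (f := f^\-%E))//; last exact: measurable_funeneg.
  by apply: eq_integral => x _; rewrite (funeneg_comp f phi).
Qed.

Lemma cint_mpres (f : T -> R[i]) : cmeasurable f ->
  cintegral mu (fun x => f (phi x)) = cintegral mu f.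
Proof.
move=> [f1 f2]; apply: cext; rewrite /= /Rintegral; congr fine.
- by apply: (integral_mpres (f := fun x => (complex.Re (f x))%:E)); exact/measurable_EFinP.
- by apply: (integral_mpres (f := fun x => (complex.Im (f x))%:E)); exact/measurable_EFinP.
Qed.

Lemma cintegrable_mpres (f : T -> R[i]) : cintegrable mu f ->
  cintegrable mu (fun x => f (phi x)).
Proof.
move=> /cintegrableP[mf foo]; apply/cintegrableP; split.
  by apply: cmeasurable_comp mf _; case: mphi.
rewrite (ge0_integral_mpres (f := fun x => (normc (f x))%:E))//.
  exact/measurable_EFinP/measurable_normc.
by move=> x; rewrite lee_fin normc_ge0.
Qed.

Lemma ae_mpres (P : T -> Prop) : {ae mu, forall x, P x} -> {ae mu, forall x, P (phi x)}.
Proof.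
move=> [N [mN N0 PN]]; have [m1 m2] := mphi; exists (phi @^-1` N); split.
- by rewrite -[_ @^-1` _]setTI; exact: m1.
- by rewrite m2.
- by move=> x /= nP; apply: PN.
Qed.

End MeasurePreserving.

(** * Lebesgue measure on the line: translation, reflection, differentiation along grids *)

Section LebesgueLine.
Context (R : realType).
Local Notation mu := (@lebesgue_measure R).

(** The pushforward agrees with Lebesgue measure on the half-open intervals that generate the Borel
    sets, so uniqueness of Lebesgue measure applies. *)
Lemma mpres_addr (a : R) : mpres mu (fun x => x + a).
Proof.
have ma : measurable_fun setT (fun x : measurableTypeR R => (x + a : measurableTypeR R)).
  by apply: measurable_funD => //; exact: measurable_cst.
split => // A mA; apply/esym.
apply: (lebesgue_measure_unique (mu := pushforward mu (fun x : measurableTypeR R => x + a : measurableTypeR R))) => //= _ [[b c]] _ <-.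
rewrite /pushforward (_ : _ @^-1` _ = `]b - a, c - a]%classic); last first.
  by apply/seteqP; split => x /=; rewrite !in_itv /= ltrBlDr lerBrDr.
rewrite !lebesgue_measure_itv/= !lte_fin ltrD2r; case: ifP => // _.
by rewrite -!EFinB; congr EFin; ring.
Qed.

Lemma mpres_subl (a : R) : mpres mu (fun x => a - x).
Proof.
have ma : measurable_fun setT (fun x : measurableTypeR R => (a - x : measurableTypeR R)).
  by apply: measurable_funB => //; exact: measurable_cst.
split => // A mA; apply/esym.
apply: (lebesgue_measure_unique (mu := pushforward mu (fun x : measurableTypeR R => a - x : measurableTypeR R))) => //= _ [[b c]] _ <-.
rewrite /pushforward (_ : _ @^-1` _ = `[a - c, a - b[%classic); last first.
  by apply/seteqP; split => x /=; rewrite !in_itv /= => /andP[h1 h2]; apply/andP; split; lra.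
rewrite !lebesgue_measure_itv/= !lte_fin ltrD2l ltrN2; case: ifP => // _.
by rewrite -!EFinB; congr EFin; ring.
Qed.

(** Cells of width [1/(n+1)]: a countable family of test sets, rich enough to shrink nicely to every
    point of the line. *)
Definition grid (k : int) (n : nat) : set R :=
  `[k%:~R / n.+1%:R, (k + 1)%:~R / n.+1%:R[%classic.

Lemma lebesgue_measure_grid k n : mu (grid k n) = (n.+1%:R^-1)%:E.
Proof.
rewrite /grid lebesgue_measure_itv /= lte_fin ltr_pM2r ?invr_gt0//.
rewrite ltr_int ltrDl ltr01 -EFinB; congr EFin.
by rewrite -mulrBl -intrB addrAC subrr add0r mul1r.
Qed.

Let cell (x : R) (n : nat) : set R := grid (Num.floor (x * n.+1%:R)) n.

Let cell_shrink x : nicely_shrinking x (cell x).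
Proof.
split=> [n|]; first exact: measurable_itv.
pose r n : {posnum R} := PosNum (ltac:(by rewrite invr_gt0 ltr0n) : 0 < (n.+1%:R^-1 : R)).
(* The ball of radius [1/(n+1)] about [x] contains the cell of [x] and has twice its measure, whence
   the constant 2. *)
exists (2, r); split => //=.
- exact: cvg_harmonic.
- move=> n y /=; rewrite /cell /grid /= in_itv /= => /andP[h1 h2].
  have n0 : 0 < (n.+1%:R : R) by rewrite ltr0n.
  have := floor_le (x * n.+1%:R); have := floorD1_gt (x * n.+1%:R).
  move: h1 h2; rewrite ler_pdivrMr// ltr_pdivlMr// intrD /=.
  set k := (Num.floor _)%:~R => h1 h2 h3 h4.
  rewrite /ball /= -(ltr_pM2r n0) mulVf ?gt_eqF//.
  rewrite -[X in _ * X < _](gtr0_norm n0) -normrM mulrBl ltr_norml.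
  by apply/andP; split; lra.
- move=> n; rewrite lebesgue_measure_ball// /cell lebesgue_measure_grid -EFinM lee_fin.
  by rewrite /= mulr_natl.
Qed.

(** By Lebesgue differentiation the averages over the cells around almost every [x] converge to
    [u x], and they are all 0. *)
Lemma locint_grid_eq0 (u : R -> R) : locally_integrable setT u ->
  (forall k n, (\int[mu]_(y in grid k n) (u y)%:E = 0)%E) ->
  {ae mu, forall x, u x = 0}.
Proof.
move=> lu h; apply: (ae_imp (lebesgue_differentiation lu)) => x ux.
have := @nice_lebesgue_differentiation R cell cell_shrink u lu x ux.
under eq_fun do rewrite h mule0.
move=> h0; have : 0%E = (u x)%:E :> \bar R by rewrite -(cvg_lim (@ereal_hausdorff R) h0) lim_cst.
by move=> [<-].
Qed.

Lemma integral_indic_mul (u : R -> R) (A : set R) :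
  (\int[mu]_(y in A) (u y)%:E = \int[mu]_y (\1_A y * u y)%:E)%E.
Proof.
rewrite integral_mkcond; apply: eq_integral => x _.
by rewrite patchE indicE; case: (x \in A); rewrite ?mul1r ?mul0r.
Qed.

Definition cindic (A : set R) (x : R) : R[i] := ((\1_A x)%:C)%C.

Lemma cmeasurable_cindic (A : set R) : measurable (A : set (measurableTypeR R)) ->
  cmeasurable (cindic A : measurableTypeR R -> _).
Proof. by move=> mA; apply: cmeasurable_real; exact: measurable_indic. Qed.

Lemma nsq_cindic A x : nsq (cindic A x) = \1_A x.
Proof.
rewrite /nsq /cindic /= expr0n addr0 indicE.
by case: (x \in A); rewrite ?expr1n ?expr0n.
Qed.

Lemma normc_cindic A x : normc (cindic A x) = \1_A x.
Proof.
rewrite normcE nsq_cindic indicE.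
by case: (x \in A); rewrite ?sqrtr1 ?sqrtr0.
Qed.

Lemma cRe_cindicM A x z : complex.Re (cindic A x * z) = \1_A x * complex.Re z.
Proof. by rewrite cReM /= mul0r subr0. Qed.

Lemma cIm_cindicM A x z : complex.Im (cindic A x * z) = \1_A x * complex.Im z.
Proof. by rewrite cImM /= mul0r addr0. Qed.

Lemma cgrid_eq0 (u : R -> R[i]) : cmeasurable (u : measurableTypeR R -> _) ->
  (forall a b, cintegrable mu (fun x => cindic `[a, b[ x * u x)) ->
  (forall k n, cintegral mu (fun x => cindic (grid k n) x * u x) = 0) ->
  {ae mu, forall x, u x = 0}.
Proof.
move=> mu_ iu gu.
have loc (v : R -> R) : measurable_fun setT (v : measurableTypeR R -> R) ->
    (forall a b, mu.-integrable setT (fun x => (\1_(`[a, b[) x * v x)%:E)) ->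
    locally_integrable setT v.
  move=> mv iv; split => // [|K _ cK]; first exact: openT.
  have [M [_ KM]] := compact_bounded cK.
  (* The bound on [K] holds for every number above [M]; taking [|M| + 1/2] leaves room for the open
     right end of the interval. *)
  have KI : K `<=` `[- (`|M| + 1), `|M| + 1[.
    move=> x Kx /=; have /KM : M < `|M| + 2^-1 by rewrite (le_lt_trans (ler_norm M))// ltrDl.
    move=> /(_ x Kx) /= h; rewrite in_itv /=; move: h; rewrite ler_norml => /andP[h1 h2].
    by apply/andP; split; lra.
  have /integrableP[_] := iv (- (`|M| + 1)) (`|M| + 1).
  apply: le_lt_trans; rewrite integral_mkcond; apply: ge0_le_integral => //.
  - by move=> x _; rewrite patchE; case: ifP.
  - apply/(measurable_restrictT _ _).1; first exact: compact_measurable.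
    apply: measurable_funTS; apply/measurable_EFinP; exact: measurableT_comp.
  - apply/measurable_EFinP; apply: measurableT_comp => //; apply: measurable_funM => //.
  - move=> x _; rewrite patchE; case: ifPn => xK; last by rewrite abse_ge0.
    have xI := KI _ (set_mem xK).
    by rewrite indicE mem_set// mul1r.
have [m1 m2] := mu_.
have h1 : {ae mu, forall x, complex.Re (u x) = 0}.
  apply: locint_grid_eq0.
    apply: loc => // a b; have [] := iu a b.
    by under eq_fun do rewrite cRe_cindicM.
  move=> k n; rewrite integral_indic_mul.
  have [i1 _] := iu (k%:~R / n.+1%:R) ((k + 1)%:~R / n.+1%:R).
  have := gu k n => /(congr1 (@complex.Re R)) /=; rewrite /Rintegral.
  under eq_integral do rewrite cRe_cindicM.
  move=> h; rewrite -[LHS]fineK ?h//.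
  move: i1; under eq_fun do rewrite cRe_cindicM; exact: integrable_fin_num.
have h2 : {ae mu, forall x, complex.Im (u x) = 0}.
  apply: locint_grid_eq0.
    apply: loc => // a b; have [] := iu a b.
    by under [in X in _ -> X -> _]eq_fun do rewrite cIm_cindicM.
  move=> k n; rewrite integral_indic_mul.
  have [_ i1] := iu (k%:~R / n.+1%:R) ((k + 1)%:~R / n.+1%:R).
  have := gu k n => /(congr1 (@complex.Im R)) /=; rewrite /Rintegral.
  under eq_integral do rewrite cIm_cindicM.
  move=> h; rewrite -[LHS]fineK ?h//.
  move: i1; under eq_fun do rewrite cIm_cindicM; exact: integrable_fin_num.
by apply: (ae_imp2 h1 h2) => x hx1 hx2; apply: cext.
Qed.

End LebesgueLine.

(** * Fourier inversion and the Plancherel identity *)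

Section PoissonKernel.
Context (R : realType).
Local Notation mu := (@lebesgue_measure R).
Variables (c : R).
Hypothesis c0 : 0 < c.

Let den_gt0 (th : R) : 0 < c ^+ 2 + th ^+ 2.
Proof. by rewrite ltr_pwDl ?exprn_gt0// sqr_ge0. Qed.

(* [F th] is the antiderivative on [0, +oo[ of the density of [g th] below; adding 1 to the
   cosine makes that density nonnegative, as the fundamental theorem on half-lines requires. *)
Let F (th t : R) : R := expR (- (c * t)) *
  (- c^-1 + (th * sin (th * t) - c * cos (th * t)) / (c ^+ 2 + th ^+ 2)).

Let isdF (th t : R) : is_derive t 1 (F th) (expR (- (c * t)) * (1 + cos (th * t))).
Proof.
apply: is_derive_eq.
rewrite /GRing.scale /=; have := lt0r_neq0 (den_gt0 th); have := lt0r_neq0 c0.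
set s := sin _; set k := cos _; set e := expR _ => ? ?; field; exact/andP.
Qed.

Let cvg_expc : expR (- (c * t)) @[t --> +oo] --> (0 : R).
Proof.
apply: (@cvg_comp _ _ _ (fun t : R => c * t) (fun t => expR (- t))); last exact: cvgr_expR.
apply/cvgryPge => A; near=> t; rewrite -ler_pdivrMl//; near: t.
Unshelve. all: by end_near. Qed.

Let cvgF th : F th t @[t --> +oo] --> (0 : R).
Proof.
pose K := c^-1 + (`|th| + c) / (c ^+ 2 + th ^+ 2).
apply: norm_cvg0.
apply: (@squeeze_cvgr _ _ _ _ (cst 0) (fun t => expR (- (c * t)) * K)).
- near=> t; rewrite normr_ge0 /= /F normrM (ger0_norm (expR_ge0 _)).
  rewrite ler_pM2l ?expR_gt0// /K (le_trans (ler_normD _ _))// normrN normfV (gtr0_norm c0).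
  rewrite lerD2l normrM normfV (gtr0_norm (den_gt0 th)) ler_pM2r ?invr_gt0//.
  rewrite (le_trans (ler_normB _ _))// !normrM (gtr0_norm c0) lerD//.
    rewrite ler_piMr// ler_norml; apply/andP; split; [exact: sin_geN1|exact: sin_le1].
  rewrite ler_piMr ?(ltW c0)// ler_norml; apply/andP; split; [exact: cos_geN1|exact: cos_le1].
- exact: cvg_cst.
- rewrite -[X in _ --> X](mul0r K); apply: cvgM; [exact: cvg_expc|exact: cvg_cst].
Unshelve. all: by end_near. Qed.

Let g (th t : R) : R := expR (- (c * `|t|)) * (1 + cos (th * t)).

Let g_ge0 th t : 0 <= g th t.
Proof.
rewrite mulr_ge0 ?expR_ge0//; have := cos_geN1 (th * t); lra.
Qed.

Let cont_g th : continuous (g th).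
Proof.
move=> t; apply: cvgM.
  apply: continuous_comp; last exact: continuous_expR.
  apply: cvgN; apply: cvgM; [exact: cvg_cst|exact: norm_continuous].
apply: cvgD; first exact: cvg_cst.
apply: continuous_comp; last exact: continuous_cos.
apply: cvgM; [exact: cvg_cst|exact: cvg_id].
Qed.

(** Evenness reduces the integral to twice the one over the half-line, which is [- F th 0] since the
    primitive tends to 0. *)
Let int_g th : (\int[mu]_t (g th t)%:E = (2 * (c^-1 + c / (c ^+ 2 + th ^+ 2)))%:E)%E.
Proof.
rewrite ge0_symfun_integralT//; last first.
  by move=> t /=; rewrite /g normrN mulrN cosN.
rewrite EFinM; congr (_ * _)%E.
transitivity (\int[mu]_(t in `[0%R, +oo[) (expR (- (c * t)) * (1 + cos (th * t)))%:E)%E.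
  rewrite -set_itvcy; apply: eq_integral => t /set_mem /=; rewrite in_itv /= andbT => t0.
  by rewrite /g ger0_norm.
rewrite (@ge0_continuous_FTC2y _ _ (F th) 0 0).
- rewrite /F mulr0 oppr0 expR0 mul1r mulr0 sin0 mulr0 cos0 mulr1 -EFinB; congr EFin; ring.
- move=> x _; rewrite mulr_ge0 ?expR_ge0//; have := cos_geN1 (th * x); lra.
- apply: continuous_subspaceT => t; apply: cvgM.
    apply: continuous_comp; last exact: continuous_expR.
    apply: cvgN; apply: cvgM; [exact: cvg_cst|exact: cvg_id].
  apply: cvgD; first exact: cvg_cst.
  apply: continuous_comp; last exact: continuous_cos.
  apply: cvgM; [exact: cvg_cst|exact: cvg_id].
- exact: cvgF.
- by move=> x _; case: (isdF th x).
- apply: cvg_at_right_filter; apply: differentiable_continuous; apply/derivable1_diffP.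
  by case: (isdF th 0).
- by move=> x _; rewrite derive1E; case: (isdF th x).
Qed.

Let integrable_g th : mu.-integrable setT (fun t => (g th t)%:E).
Proof.
apply: integrable_ge0P => //; first by apply: continuous_measurable_fun; exact: cont_g.
by rewrite int_g ltry.
Qed.

(** [g 0] is twice this function, as [cos 0 = 1]. *)
Lemma integrable_expR_abs : mu.-integrable setT (fun t => (expR (- (c * `|t|)))%:E).
Proof.
have := integrableZl measurableT 2^-1 (integrable_g 0).
by under eq_fun do rewrite /g mul0r cos0 -EFinM mulrCA -[1 + 1]/2 mulVf ?mulr1//.
Qed.

Lemma Rintegral_poisson_cos (th : R) :
  \int[mu]_t (expR (- (c * `|t|)) * cos (th * t)) = 2 * c / (c ^+ 2 + th ^+ 2).
Proof.
(* Half of [g 0] is the damping factor itself; subtracting it removes the 1 that was added for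
   positivity. *)
have e t : expR (- (c * `|t|)) * cos (th * t) = g th t - 2^-1 * g 0 t.
  by rewrite /g mul0r cos0; field.
under eq_Rintegral do rewrite e.
have i2 := integrableZl_EFin 2^-1 (integrable_g 0).
have rg th' : \int[mu]_t g th' t = 2 * (c^-1 + c / (c ^+ 2 + th' ^+ 2)).
  by rewrite /Rintegral int_g.
have -> : \int[mu]_t (g th t - 2^-1 * g 0 t) = \int[mu]_t g th t - \int[mu]_t (2^-1 * g 0 t).
  by apply: RintegralB => //; exact: integrable_g.
have -> : \int[mu]_t (2^-1 * g 0 t) = 2^-1 * \int[mu]_t g 0 t.
  by apply: RintegralZl => //; exact: integrable_g.
rewrite !rg expr0n addr0.
have := lt0r_neq0 (den_gt0 th); have := lt0r_neq0 c0 => ? ?; field; exact/andP.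
Qed.

Lemma cint_poisson (th : R) :
  cintegral mu (fun t => ((expR (- (c * `|t|)))%:C)%C * cexpi (th * t)) =
  ((2 * c / (c ^+ 2 + th ^+ 2))%:C)%C.
Proof.
apply: cext => /=.
  under eq_Rintegral do rewrite mul0r subr0.
  exact: Rintegral_poisson_cos.
under eq_Rintegral do rewrite mul0r addr0.
(* The sine part is odd, so the reflection of the line shows that its integral is its own
   negative. *)
set I := (LHS); suff : I = - I by lra.
rewrite {1}/I /Rintegral.
have me : measurable_fun setT (fun t : measurableTypeR R => (expR (- (c * `|t|)) * sin (th * t))%:E).
  apply/measurable_EFinP; apply: continuous_measurable_fun => t; apply: cvgM.
    apply: continuous_comp; last exact: continuous_expR.
    apply: cvgN; apply: cvgM; [exact: cvg_cst|exact: norm_continuous].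
  apply: continuous_comp; last exact: continuous_sin.
  apply: cvgM; [exact: cvg_cst|exact: cvg_id].
rewrite -(integral_mpres (mpres_subl 0) me).
under eq_integral do rewrite sub0r normrN mulrN sinN mulrN -mulN1r.
rewrite -[X in fine X]/(\int[mu]_x (-1 * (expR (- (c * `|x|)) * sin (th * x)))%:E)%E.
rewrite -/(Rintegral mu setT (fun x => -1 * (expR (- (c * `|x|)) * sin (th * x)))).
rewrite RintegralZl ?mulN1r//.
apply: le_integrable integrable_expR_abs => //.
move=> t _; rewrite !abse_EFin lee_fin normrM ler_piMr// ler_norml.
apply/andP; split; [exact: sin_geN1|exact: sin_le1].
Qed.

End PoissonKernel.

Section Exchange.
Context d1 d2 (T1 : measurableType d1) (T2 : measurableType d2) (R : realType).
Variables (m1 : {sigma_finite_measure set T1 -> \bar R})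
          (m2 : {sigma_finite_measure set T2 -> \bar R}).

Lemma cintegrable_prod_mul (u : T1 -> R[i]) (w : T2 -> R[i]) :
  cintegrable m1 u -> cintegrable m2 w ->
  cintegrable (m1 \x m2)%E (fun z => u z.1 * w z.2).
Proof.
move=> cu cw; apply: cintegrable_prodP.
  apply: cmeasurableM.
    by apply: (cmeasurable_comp (cintegrable_measurable cu)); exact: measurable_fst.
  by apply: (cmeasurable_comp (cintegrable_measurable cw)); exact: measurable_snd.
have [mw wf] := (cintegrableP m2 w).1 cw.
have [mu_ uf] := (cintegrableP m1 u).1 cu.
have e x : (\int[m2]_y (normc (u x * w y))%:E =
    \int[m2]_y (normc (w y))%:E * (normc (u x))%:E)%E.
  under eq_integral do rewrite normcM EFinM muleC.
  rewrite ge0_integralZr//.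
  - exact/measurable_EFinP/measurable_normc.
  - by move=> y _; rewrite lee_fin normc_ge0.
  - by rewrite lee_fin normc_ge0.
under eq_integral do rewrite /= e.
rewrite ge0_integralZl//.
- have I0 : (0 <= \int[m2]_y (normc (w y))%:E)%E.
    by apply: integral_ge0 => y _; rewrite lee_fin normc_ge0.
  by apply: lte_mul_pinfty => //; rewrite ge0_fin_numE.
- exact/measurable_EFinP/measurable_normc.
- by move=> y _; rewrite lee_fin normc_ge0.
- by apply: integral_ge0 => y _; rewrite lee_fin normc_ge0.
Qed.

(** The form of Fubini used throughout the Fourier part, with a phase for [B]: the bound by 1 makes
    the whole integrand integrable on the product. *)
Lemma cint_exchange (u : T1 -> R[i]) (w : T2 -> R[i]) (B : T1 * T2 -> R[i]) :
  cintegrable m1 u -> cintegrable m2 w -> cmeasurable B -> (forall z, normc (B z) <= 1) ->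
  cintegral m1 (fun x => u x * cintegral m2 (fun y => w y * B (x, y))) =
  cintegral m2 (fun y => w y * cintegral m1 (fun x => u x * B (x, y))).
Proof.
move=> cu cw mB B1.
have c2 x : cintegrable m2 (fun y => w y * B (x, y)).
  under eq_fun do rewrite mulrC.
  by apply: (cintegrableM_bounded (M := 1)) => //; exact: cmeasurable_pair2.
have c1 y : cintegrable m1 (fun x => u x * B (x, y)).
  under eq_fun do rewrite mulrC.
  by apply: (cintegrableM_bounded (M := 1)) => //; exact: cmeasurable_pair1.
have cp : cintegrable (m1 \x m2)%E (fun z => B z * (u z.1 * w z.2)).
  by apply: (cintegrableM_bounded (M := 1)) => //; exact: cintegrable_prod_mul.
have := cfubini cp => /= h.
transitivity (cintegral m1 (fun x => cintegral m2 (fun y => B (x, y) * (u x * w y)))).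
  apply: eq_cint => x; rewrite -cintZ//; apply: eq_cint => y; ring.
rewrite h; apply: eq_cint => y; rewrite -cintZ//; apply: eq_cint => x; ring.
Qed.

End Exchange.

Section Fourier.
Context (R : realType).
Local Notation mu := (@lebesgue_measure R).
Local Notation RR := (measurableTypeR R).
Implicit Types u w : R -> R[i].

(** The sign of the exponent is the one in the Weyl transform, whose kernel is such a transform of a
    slice of [f]. *)
Definition fourier u (t : R) : R[i] :=
  cintegral mu (fun y => u y * cexpi (2 * pi * (y * t))).

Definition ifourier w (y : R) : R[i] :=
  cintegral mu (fun t => w t * cexpi (- (2 * pi * (y * t)))).

Lemma cmeasurable_phase : cmeasurable (fun z : RR * RR => cexpi (2 * pi * (z.1 * z.2))).
Proof.
apply: cmeasurable_cexpi; apply: measurable_funM; first exact: measurable_cst.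
by apply: measurable_funM; [exact: measurable_fst|exact: measurable_snd].
Qed.

Lemma cmeasurable_iphase : cmeasurable (fun z : RR * RR => cexpi (- (2 * pi * (z.1 * z.2)))).
Proof.
apply: cmeasurable_cexpi; apply: measurable_funN; apply: measurable_funM; first exact: measurable_cst.
by apply: measurable_funM; [exact: measurable_fst|exact: measurable_snd].
Qed.

Lemma cmeasurable_swap d1 d2 (T1 : measurableType d1) (T2 : measurableType d2)
    (f : T1 * T2 -> R[i]) : cmeasurable f -> cmeasurable (fun z : T2 * T1 => f (z.2, z.1)).
Proof.
move=> mf; apply: (cmeasurable_comp mf); apply: measurable_fun_pair.
- exact: measurable_snd.
- exact: measurable_fst.
Qed.

Lemma cmeasurable_fourier u : cmeasurable (u : RR -> _) -> cmeasurable (fourier u : RR -> _).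
Proof.
move=> mu_; apply: (cmeasurable_cint mu (f := fun z : RR * RR => u z.2 * cexpi (2 * pi * (z.2 * z.1)))).
apply: cmeasurableM; first by apply: (cmeasurable_comp mu_); exact: measurable_snd.
exact: (cmeasurable_swap cmeasurable_phase).
Qed.

Lemma cmeasurable_ifourier w : cmeasurable (w : RR -> _) -> cmeasurable (ifourier w : RR -> _).
Proof.
move=> mw; apply: (cmeasurable_cint mu (f := fun z : RR * RR => w z.2 * cexpi (- (2 * pi * (z.1 * z.2))))).
apply: cmeasurableM; first by apply: (cmeasurable_comp mw); exact: measurable_snd.
exact: cmeasurable_iphase.
Qed.

Lemma cintegrable_phase u t : cintegrable mu u ->
  cintegrable mu (fun y => u y * cexpi (2 * pi * (y * t))).
Proof.
move=> cu; under eq_fun do rewrite mulrC.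
apply: (cintegrableM_bounded (M := 1)) => //.
  exact: (cmeasurable_pair1 (f := fun z : RR * RR => cexpi (2 * pi * (z.1 * z.2))) t cmeasurable_phase).
by move=> x; rewrite normc_cexpi.
Qed.

Lemma cintegrable_iphase w y : cintegrable mu w ->
  cintegrable mu (fun t => w t * cexpi (- (2 * pi * (y * t)))).
Proof.
move=> cu; under eq_fun do rewrite mulrC.
apply: (cintegrableM_bounded (M := 1)) => //.
  exact: (cmeasurable_pair2 (f := fun z : RR * RR => cexpi (- (2 * pi * (z.1 * z.2)))) y cmeasurable_iphase).
by move=> x; rewrite normc_cexpi.
Qed.

Lemma cint_iphase_norm w : cintegrable mu w ->
  forall y, normc (ifourier w y) <= \int[mu]_t normc (w t).
Proof.
move=> cw y; rewrite (le_trans (normc_cint_le_fin (cintegrable_iphase y cw)))//.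
by under eq_Rintegral do rewrite normcM normc_cexpi mulr1.
Qed.

Lemma normc_fourier u : cintegrable mu u ->
  forall t, normc (fourier u t) <= \int[mu]_y normc (u y).
Proof.
move=> cw y; rewrite (le_trans (normc_cint_le_fin (cintegrable_phase y cw)))//.
by under eq_Rintegral do rewrite normcM normc_cexpi mulr1.
Qed.

Section Inversion.
Variables (u : R -> R[i]) (a b : R).
Hypotheses (ab : a < b) (cu : cintegrable mu u) (cfu : cintegrable mu (fourier u)).
Let A : set R := `[a, b[%classic.

Let mA : measurable (A : set RR).
Proof. exact: measurable_itv. Qed.

Let cA : cintegrable mu (cindic A).
Proof.
apply: (le_cintegrable (r := \1_A : RR -> R)); first exact: cmeasurable_cindic.
  by move=> x; rewrite normc_cindic.
exact: integrable_indic_itv.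
Qed.

(** The phase is symmetric in its two variables, so [D] is also what remains of the inversion
    integral once it is tested against the indicator of [[a, b[]. *)
Let D (t : R) := ifourier (cindic A) t.

Let Dsym t : D t = cintegral mu (fun y => cindic A y * cexpi (- (2 * pi * (y * t)))).
Proof. by apply: eq_cint => y; rewrite (mulrC t). Qed.

Let D_le t : normc (D t) <= b - a.
Proof.
rewrite (le_trans (cint_iphase_norm cA t))//.
under eq_Rintegral do rewrite normc_cindic.
rewrite /Rintegral integral_indic// setIT.
rewrite -[X in fine X]/(@lebesgue_measure R `[a, b[%classic).
by rewrite lebesgue_measure_itv /= lte_fin ab -EFinB /=.
Qed.

Let mD : cmeasurable (D : RR -> _).
Proof. by apply: cmeasurable_ifourier; exact: cintegrable_measurable cA. Qed.

Let eps (n : nat) : R := n.+1%:R^-1.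
(** The factor [2 * pi] cancels the one in the phases, so that the Poisson kernel has the primitive
    [G], an arctangent of [(y - z) * n.+1%:R]. *)
Let c (n : nat) : R := 2 * pi * eps n.

Let eps_gt0 n : 0 < eps n. Proof. by rewrite invr_gt0 ltr0n. Qed.
Let c_gt0 n : 0 < c n. Proof. by rewrite !mulr_gt0 ?pi_gt0. Qed.

Let phi (n : nat) (t : R) : R[i] := ((expR (- (c n * `|t|)))%:C)%C.

Let cphi n : cintegrable mu (phi n).
Proof.
have i := integrable_expR_abs (c_gt0 n).
apply: (le_cintegrable (r := fun t : RR => expR (- (c n * `|t|)))) => //.
  by have /measurable_EFinP mi := measurable_int _ i; apply: cmeasurable_real.
move=> x; rewrite normcE /phi /nsq /= expr0n addr0 sqrtr_sqr ger0_norm ?expR_ge0//.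
Qed.

Let mphi n : cmeasurable (phi n : RR -> _).
Proof. exact: cintegrable_measurable (cphi n). Qed.

Let phi_le1 n t : normc (phi n t) <= 1.
Proof.
rewrite normcE /phi /nsq /= expr0n addr0 sqrtr_sqr ger0_norm ?expR_ge0//.
by rewrite expR_le1 oppr_le0 mulr_ge0// ltW.
Qed.

(* Inversion by Abel summation: damping the inversion integral by [phi n] smooths the
   indicator of [a, b[ with the Poisson kernel of width [c n], which gives [Q n]. *)
Let Q (n : nat) (z : R) : R := pi^-1 * (atan ((b - z) * n.+1%:R) - atan ((a - z) * n.+1%:R)).

Let Q_le1 n z : `|Q n z| <= 1.
Proof.
have pp := pi_gt0 R.
have pp' : 0 < (pi : R)^-1 by rewrite invr_gt0.
rewrite /Q normrM (gtr0_norm pp') ler_pdivrMl// mulr1 ler_norml.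
have := atan_gtNpi2 ((b - z) * n.+1%:R); have := atan_ltpi2 ((b - z) * n.+1%:R).
have := atan_gtNpi2 ((a - z) * n.+1%:R); have := atan_ltpi2 ((a - z) * n.+1%:R).
by move=> ? ? ? ?; apply/andP; split; lra.
Qed.

Let G n z (y : R) : R := pi^-1 * atan ((y - z) * n.+1%:R).

Let isdG (n : nat) (z y : R) : is_derive y 1 (G n z) (2 * c n / (c n ^+ 2 + (2 * pi * (z - y)) ^+ 2)).
Proof.
apply: is_derive_eq.
rewrite /GRing.scale /= /c /eps.
have n0 : (n.+1%:R : R) != 0 by [].
have p0 : (pi : R) != 0 by rewrite gt_eqF ?pi_gt0.
set m : R := n.+1%:R in n0 *.
have d0 : 1 + ((y - z) * m) ^+ 2 != 0 by rewrite gt_eqF// ltr_pwDl// sqr_ge0.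
have -> : (2 * pi * m^-1) ^+ 2 + (2 * pi * (z - y)) ^+ 2 =
   (2 * pi * m^-1) ^+ 2 * (1 + ((y - z) * m) ^+ 2) by field.
rewrite subr0 mulr0 add0r mulr1; clearbody m.
move: (1 + _) d0 => q d0.
move: (pi : R) p0 => p p0.
by field; rewrite n0 d0.
Qed.

Let Q_int n z : cintegral mu (fun y => cindic A y * ((2 * c n / (c n ^+ 2 + (2 * pi * (z - y)) ^+ 2))%:C)%C) = ((Q n z)%:C)%C.
Proof.
under eq_cint do rewrite /cindic -rmorphM /=.
rewrite cint_real; congr (_%:C)%C; rewrite /Rintegral -integral_indic_mul.
rewrite /A integral_itv_bndo_bndc; last first.
  apply/measurable_EFinP; apply: measurable_funTS; apply: continuous_measurable_fun => y.
  apply: cvgM; first exact: cvg_cst.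
  apply: cvgV.
    by rewrite gt_eqF// ltr_pwDl ?exprn_gt0// sqr_ge0.
  apply: cvgD; first exact: cvg_cst.
  apply: cvgM; apply: cvgM => //; first [exact: cvg_cst|apply: cvgB; [exact: cvg_cst|exact: cvg_id]].
rewrite (@continuous_FTC2 _ _ (G n z) a b ab).
- by rewrite /G /Q -EFinB /= mulrBr.
- apply: continuous_subspaceT => y.
  apply: cvgM; first exact: cvg_cst.
  apply: cvgV.
    by rewrite gt_eqF// ltr_pwDl ?exprn_gt0// sqr_ge0.
  apply: cvgD; first exact: cvg_cst.
  apply: cvgM; apply: cvgM => //; first [exact: cvg_cst|apply: cvgB; [exact: cvg_cst|exact: cvg_id]].
- split.
  + by move=> y _; case: (isdG n z y).
  + apply: cvg_at_right_filter; apply: differentiable_continuous; apply/derivable1_diffP.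
    by case: (isdG n z a).
  + apply: cvg_at_left_filter; apply: differentiable_continuous; apply/derivable1_diffP.
    by case: (isdG n z b).
- by move=> y _; rewrite derive1E; case: (isdG n z y).
Qed.

(** Two exchanges: the first moves the transform from [u] to [phi n * D]; the second unfolds [D] and
    leaves, for each [y], the transform of [phi n] at [z - y], which is the Poisson kernel. *)
Let abel n : cintegral mu (fun t => fourier u t * (phi n t * D t)) =
  cintegral mu (fun z => u z * ((Q n z)%:C)%C).
Proof.
have cphiD : cintegrable mu (fun t => phi n t * D t).
  under eq_fun do rewrite mulrC.
  by apply: (cintegrableM_bounded (M := b - a)) => //; exact: cphi.
transitivity (cintegral mu (fun t => (phi n t * D t) * fourier u t)).
  by apply: eq_cint => t; rewrite mulrC.
rewrite -(cint_exchange (B := fun z : RR * RR => cexpi (2 * pi * (z.1 * z.2))) cu cphiD cmeasurable_phase); last first.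
  by move=> z; rewrite normc_cexpi.
apply: eq_cint => z; congr (_ * _).
pose w t := phi n t * cexpi (2 * pi * (z * t)).
have cw : cintegrable mu w.
  rewrite /w; under eq_fun do rewrite (mulrC z).
  exact: (cintegrable_phase (u := phi n) z (cphi n)).
transitivity (cintegral mu (fun t => w t * cintegral mu (fun y => cindic A y * cexpi (- (2 * pi * (y * t)))))).
  by apply: eq_cint => t; rewrite -Dsym /w; ring.
rewrite -(cint_exchange (B := fun z : RR * RR => cexpi (- (2 * pi * (z.1 * z.2)))) cA cw cmeasurable_iphase); last first.
  by move=> z'; rewrite normc_cexpi.
rewrite -Q_int; apply: eq_cint => y; congr (_ * _).
rewrite -cint_poisson//; apply: eq_cint => t /=.
by rewrite /w -mulrA -cexpiD; congr (_ * cexpi _); ring.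
Qed.

Let cvg_phi (t : R) : (fun n => expR (- (c n * `|t|))) @ \oo --> (1 : R).
Proof.
rewrite -[X in _ --> X](expR0 R); apply: continuous_cvg; first exact: continuous_expR.
rewrite -oppr0; apply: cvgN; rewrite -(mul0r `|t|); apply: cvgM; last exact: cvg_cst.
rewrite /c -(mulr0 (2 * pi)); apply: cvgM; first exact: cvg_cst.
exact: cvg_harmonic.
Qed.

Let cvg_lhs : (fun n => complex.Re (cintegral mu (fun t => fourier u t * (phi n t * D t)))) @ \oo
    --> complex.Re (cintegral mu (fun t => fourier u t * D t)) /\
  (fun n => complex.Im (cintegral mu (fun t => fourier u t * (phi n t * D t)))) @ \oo
    --> complex.Im (cintegral mu (fun t => fourier u t * D t)).
Proof.
have mf := cmeasurable_fourier (cintegrable_measurable cu).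
apply: (cint_dominated (g := fun t : RR => (b - a) * normc (fourier u t))).
- by move=> n; apply: cmeasurableM => //; exact: cmeasurableM.
- exact: cmeasurableM.
- apply: aeW => t; set z := fourier u t * D t.
  have e n : fourier u t * (phi n t * D t) = phi n t * z by rewrite /z; ring.
  split.
  + have -> : (fun n => complex.Re (fourier u t * (phi n t * D t))) =
      (fun n => expR (- (c n * `|t|)) * complex.Re z) by apply/funext => n; rewrite e cRe_realM.
    rewrite -[X in _ --> X]mul1r; apply: cvgM; [exact: cvg_phi|exact: cvg_cst].
  + have -> : (fun n => complex.Im (fourier u t * (phi n t * D t))) =
      (fun n => expR (- (c n * `|t|)) * complex.Im z) by apply/funext => n; rewrite e cIm_realM.
    rewrite -[X in _ --> X]mul1r; apply: cvgM; [exact: cvg_phi|exact: cvg_cst].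
- by apply: integrableZl_EFin; exact: cintegrable_normc.
- move=> n t; rewrite !normcM mulrC ler_wpM2r ?normc_ge0//.
  by rewrite -[leRHS]mul1r ler_pM ?normc_ge0.
Qed.

Let cvg_atan_pos (x : R) : 0 < x -> (fun n => atan (x * n.+1%:R)) @ \oo --> (pi / 2 : R).
Proof.
move=> x0; apply: (@cvg_comp _ _ _ (fun n : nat => x * n.+1%:R) (@atan R)); last exact: cvgy_atan.
apply/cvgryPge => M; near=> n; rewrite -ler_pdivrMl// (le_trans (ler_norm _))//.
rewrite (le_trans (ltW (truncnS_gt _)))// ler_nat ltnS; near: n; exact: nbhs_infty_ge.
Unshelve. all: by end_near. Qed.

Let cvg_atan_neg (x : R) : x < 0 -> (fun n => atan (x * n.+1%:R)) @ \oo --> (- (pi / 2) : R).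
Proof.
move=> x0; have e n : atan (x * n.+1%:R) = - atan ((- x) * n.+1%:R) by rewrite mulNr atanN opprK.
by under eq_fun do rewrite e; apply: cvgN; apply: cvg_atan_pos; rewrite oppr_gt0.
Qed.

(** At either endpoint the limit would be 1/2; the two points form a null set and are discarded in
    [cvg_rhs]. *)
Let cvgQ z : z != a -> z != b -> (fun n => Q n z) @ \oo --> (\1_A z : R).
Proof.
move=> za zb; have p0 : (pi : R) != 0 by rewrite gt_eqF ?pi_gt0.
have key (l1 l2 : R) : (fun n => atan ((b - z) * n.+1%:R)) @ \oo --> l1 ->
    (fun n => atan ((a - z) * n.+1%:R)) @ \oo --> l2 ->
    (fun n => Q n z) @ \oo --> pi^-1 * (l1 - l2).
  by move=> h1 h2; apply: cvgM; [exact: cvg_cst|apply: cvgB].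
have [az|az] := ltP z a.
  have zA : z \notin A by rewrite notin_setE /A /= in_itv /= leNgt az.
  rewrite (_ : \1_A z = pi^-1 * (pi / 2 - pi / 2)); last first.
    by rewrite indicE (negbTE zA) subrr mulr0.
  by apply: key; apply: cvg_atan_pos; rewrite subr_gt0 // (lt_trans az).
have {}az : a < z by rewrite lt_neqAle eq_sym za.
have [bz|bz] := ltP z b.
  have zA : z \in A by rewrite inE /A /= in_itv /= bz ltW.
  rewrite (_ : \1_A z = pi^-1 * (pi / 2 - - (pi / 2))); last first.
    by rewrite indicE zA /=; move: (pi : R) p0 => p p0; field.
  by apply: key; [apply: cvg_atan_pos; rewrite subr_gt0|apply: cvg_atan_neg; rewrite subr_lt0].
have {}bz : b < z by rewrite lt_neqAle eq_sym zb.
have zA : z \notin A by rewrite notin_setE /A /= in_itv /= (ltNge z) (ltW bz) andbF.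
rewrite (_ : \1_A z = pi^-1 * (- (pi / 2) - - (pi / 2))); last first.
  by rewrite indicE (negbTE zA) subrr mulr0.
by apply: key; apply: cvg_atan_neg; rewrite subr_lt0 // (lt_trans ab).
Qed.

Let mQ n : measurable_fun setT (Q n : RR -> R).
Proof.
apply: continuous_measurable_fun => z; apply: cvgM; first exact: cvg_cst.
apply: cvgB; apply: continuous_comp; try exact: continuous_atan.
all: apply: cvgM; last exact: cvg_cst.
all: by apply: cvgB; [exact: cvg_cst|exact: cvg_id].
Qed.

Let cvg_rhs : (fun n => complex.Re (cintegral mu (fun z => u z * ((Q n z)%:C)%C))) @ \oo
    --> complex.Re (cintegral mu (fun z => u z * cindic A z)) /\
  (fun n => complex.Im (cintegral mu (fun z => u z * ((Q n z)%:C)%C))) @ \oo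
    --> complex.Im (cintegral mu (fun z => u z * cindic A z)).
Proof.
have mu_ := cintegrable_measurable cu.
apply: (cint_dominated (g := fun t : RR => normc (u t))).
- by move=> n; apply: cmeasurableM => //; exact: cmeasurable_real.
- by apply: cmeasurableM => //; exact: cmeasurable_cindic.
- have h x : {ae mu, forall z, z != x :> R}.
    exists [set x]; split; [exact: measurable_set1|exact: lebesgue_measure_set1|].
    by move=> z /= /negP; rewrite negbK => /eqP.
  apply: (ae_imp2 (h a) (h b)) => z za zb; have q := cvgQ za zb.
  split.
  + under eq_fun do rewrite mulrC cRe_realM; rewrite mulrC cRe_realM.
    by apply: cvgM => //; exact: cvg_cst.
  + under eq_fun do rewrite mulrC cIm_realM; rewrite mulrC cIm_realM.
    by apply: cvgM => //; exact: cvg_cst.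
- exact: cintegrable_normc.
- move=> n t; rewrite normcM ler_piMr ?normc_ge0//.
  by rewrite normcE /nsq /= expr0n addr0 sqrtr_sqr.
Qed.

(** Both sides are limits of the two sides of [abel]: on the right, an exchange turns the integral
    over [[a, b[] into the pairing of [fourier u] with [D]. *)
Lemma fourier_inversion_itv :
  cintegral mu (fun y => cindic A y * u y) =
  cintegral mu (fun y => cindic A y * ifourier (fourier u) y).
Proof.
rewrite [RHS](cint_exchange (B := fun z : RR * RR => cexpi (- (2 * pi * (z.1 * z.2)))) cA cfu cmeasurable_iphase); last first.
  by move=> z; rewrite normc_cexpi.
transitivity (cintegral mu (fun z => u z * cindic A z)).
  by apply: eq_cint => z; rewrite mulrC.
transitivity (cintegral mu (fun t => fourier u t * D t)); last first.
  by apply: eq_cint => t; rewrite -Dsym.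
have [r1 r2] := cvg_rhs; have [l1 l2] := cvg_lhs.
have abelf : (fun n => cintegral mu (fun t => fourier u t * (phi n t * D t))) =
  (fun n => cintegral mu (fun z => u z * ((Q n z)%:C)%C)) by apply/funext => n; exact: abel.
apply: cext.
- apply: (cvg_unique _ r1) => //.
  by have := congr1 (fun F : nat -> R[i] => fun n => complex.Re (F n)) abelf => /= <-.
- apply: (cvg_unique _ r2) => //.
  by have := congr1 (fun F : nat -> R[i] => fun n => complex.Im (F n)) abelf => /= <-.
Qed.

End Inversion.

(** Grid cells are half-open intervals, so the difference of the two sides has integral 0 over each
    of them and [cgrid_eq0] applies. *)
Lemma fourier_inversion u : cintegrable mu u -> cintegrable mu (fourier u) ->
  {ae mu, forall y, u y = ifourier (fourier u) y}.
Proof.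
move=> cu cfu; set v := ifourier (fourier u).
have mv : cmeasurable (v : RR -> _) by exact: cmeasurable_ifourier (cintegrable_measurable cfu).
have cAu a b : cintegrable mu (fun y => cindic `[a, b[ y * u y).
  apply: (cintegrableM_bounded (M := 1)) => //; first by apply: cmeasurable_cindic; exact: measurable_itv.
  by move=> x; rewrite normc_cindic indicE; case: (_ \in _).
have cAv a b : cintegrable mu (fun y => cindic `[a, b[ y * v y).
  under eq_fun do rewrite mulrC.
  apply: (cintegrableM_bounded (M := \int[mu]_t normc (fourier u t))) => //.
    by move=> x; exact: cint_iphase_norm.
  apply: (le_cintegrable (r := \1_(`[a, b[) : RR -> R)); first by apply: cmeasurable_cindic; exact: measurable_itv.
    by move=> x; rewrite normc_cindic.
  exact: integrable_indic_itv.
have h : {ae mu, forall y, u y + -1 * v y = 0}.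
  apply: cgrid_eq0.
  - apply: cmeasurableD; first exact: cintegrable_measurable cu.
    exact: cmeasurableZ.
  - move=> a b; under eq_fun do rewrite mulrDr mulrCA.
    by apply: cintegrableD => //; exact: cintegrableZ.
  - move=> k n; under eq_cint do rewrite mulrDr mulrCA.
    rewrite cintD ?cintZ//; [|exact: cAv|exact: cAu|exact/cintegrableZ/cAv].
    rewrite /grid fourier_inversion_itv//; first by rewrite mulN1r subrr.
    by rewrite ltr_pM2r ?invr_gt0// ltr_int ltrDl.
by apply: (ae_imp h) => y /eqP; rewrite mulN1r subr_eq0 => /eqP.
Qed.

(** Inversion makes [u] almost everywhere equal to a bounded function, so that both energies are
    finite; substituting it for one factor of [|u|^2] leaves an exchange of integrals. *)
Lemma plancherel u : cintegrable mu u -> cintegrable mu (fourier u) ->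
  (\int[mu]_t (nsq (fourier u t))%:E = \int[mu]_y (nsq (u y))%:E)%E.
Proof.
move=> cu cfu.
have inv := fourier_inversion cu cfu.
have mfu := cintegrable_measurable cfu.
have mu_ := cintegrable_measurable cu.
set M := \int[mu]_t normc (fourier u t); set M' := \int[mu]_t normc (u t).
have c1 : cintegrable mu (fun y => u y * ((ifourier (fourier u) y)^*)%C).
  under eq_fun do rewrite mulrC.
  apply: (cintegrableM_bounded (M := M)) => //.
    by apply: cmeasurable_conj; exact: cmeasurable_ifourier.
  by move=> x; rewrite normcE nsq_conj -normcE; exact: cint_iphase_norm.
have c2 : cintegrable mu (fun t => ((fourier u t)^*)%C * fourier u t).
  apply: (cintegrableM_bounded (M := M')) => //; first exact: cmeasurable_conj.
  by move=> x; rewrite normcE nsq_conj -normcE; exact: normc_fourier.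
have e : cintegral mu (fun t => ((fourier u t)^*)%C * fourier u t) =
         cintegral mu (fun y => u y * ((ifourier (fourier u) y)^*)%C).
  rewrite -(cint_exchange (B := fun z : RR * RR => cexpi (2 * pi * (z.1 * z.2))) cu (cintegrable_conj cfu) cmeasurable_phase); last first.
    by move=> z; rewrite normc_cexpi.
  apply: eq_cint => y; congr (_ * _); rewrite -cint_conj; last exact: cintegrable_iphase.
  apply: eq_cint => t.
  rewrite conjcM.
  by rewrite -cexpiN opprK.
have c3 : cintegrable mu (fun y => ((nsq (u y))%:C)%C).
  apply: ae_eq_cintegrable c1; first by apply: cmeasurable_real; exact: measurable_nsq.
  by apply: (ae_imp inv) => y <-; rewrite nsqE.
have c4 : cintegrable mu (fun t => ((nsq (fourier u t))%:C)%C).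
  by move: c2; under eq_fun do rewrite mulrC -nsqE.
have : cintegral mu (fun t => ((nsq (fourier u t))%:C)%C) = cintegral mu (fun y => ((nsq (u y))%:C)%C).
  transitivity (cintegral mu (fun t => ((fourier u t)^*)%C * fourier u t)).
    by apply: eq_cint => t; rewrite mulrC nsqE.
  rewrite e; apply: ae_eq_cint; first exact: cintegrable_measurable c1.
    exact: cintegrable_measurable c3.
  by apply: (ae_imp inv) => y <-; rewrite nsqE.
rewrite !cint_real => -[].
rewrite /Rintegral => /(congr1 (@EFin R)); rewrite !fineK//.
- by case: c3 => i _; exact: integrable_fin_num i.
- by case: c4 => i _; exact: integrable_fin_num i.
Qed.

End Fourier.

(** * Orthonormal families of square integrable functions *)

Section SquareIntegrable.
Context d (T : measurableType d) (R : realType) (mu : {measure set T -> \bar R}).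
Implicit Types f g h : T -> R[i].

Definition sqint g : Prop := cmeasurable g /\ (\int[mu]_x (nsq (g x))%:E < +oo)%E.

Lemma sqint_integrable g : sqint g -> mu.-integrable setT (fun x => (nsq (g x))%:E).
Proof.
move=> [mg gf]; apply: integrable_ge0P => //; first exact: measurable_nsq.
by move=> x; exact: nsq_ge0.
Qed.

Lemma le_sqint g (r : T -> R) : cmeasurable g -> (forall x, nsq (g x) <= r x) ->
  mu.-integrable setT (fun x => (r x)%:E) -> sqint g.
Proof.
move=> mg gr ir; split => //; apply: integrable_lty => //.
apply: le_integrable ir => //; first exact/measurable_EFinP/measurable_nsq.
move=> x _; rewrite !abse_EFin lee_fin ger0_norm ?nsq_ge0//.
by rewrite (le_trans (gr x))// ler_norm.
Qed.

Lemma sqintM g h : sqint g -> sqint h -> cintegrable mu (fun x => g x * h x).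
Proof.
move=> sg sh; apply: (le_cintegrable (r := fun x => nsq (g x) + nsq (h x))).
- by apply: cmeasurableM; [case: sg|case: sh].
- by move=> x; exact: normc_le_nsqD.
- under eq_fun do rewrite EFinD; apply: integrableD => //; exact: sqint_integrable.
Qed.

Lemma sqintM_bounded f g (M : R) : cmeasurable f -> (forall x, nsq (f x) <= M) ->
  sqint g -> sqint (fun x => f x * g x).
Proof.
move=> mf fM sg; apply: (le_sqint (r := fun x => M * nsq (g x))).
- by apply: cmeasurableM => //; case: sg.
- by move=> x; rewrite nsqM ler_wpM2r ?nsq_ge0.
- by apply: integrableZl_EFin; exact: sqint_integrable.
Qed.

Lemma sqintZ (z : R[i]) g : sqint g -> sqint (fun x => z * g x).
Proof. by apply: (sqintM_bounded (M := nsq z)) => //; exact: cmeasurable_cst. Qed.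

Lemma sqintD g h : sqint g -> sqint h -> sqint (fun x => g x + h x).
Proof.
move=> sg sh; apply: (le_sqint (r := fun x => 2 * nsq (g x) + 2 * nsq (h x))).
- by apply: cmeasurableD; [case: sg|case: sh].
- by move=> x; exact: nsqD_le.
- under eq_fun do rewrite EFinD.
  by apply: integrableD => //; apply: integrableZl_EFin; exact: sqint_integrable.
Qed.

Lemma sqint0 : sqint (fun=> 0).
Proof.
split; first exact: cmeasurable_cst.
by under eq_integral do rewrite nsq0; rewrite integral0.
Qed.

Lemma sqint_sum I (s : seq I) (P : pred I) (F : I -> T -> R[i]) :
  (forall i, P i -> sqint (F i)) -> sqint (fun x => \sum_(i <- s | P i) F i x).
Proof.
move=> mF; elim: s => [|i s IH].
  by under eq_fun do rewrite big_nil; exact: sqint0.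
have [Pi|Pi] := boolP (P i); under eq_fun do [rewrite big_cons ?Pi ?(negbTE Pi)]; last by [].
by apply: sqintD => //; exact: mF.
Qed.

Lemma sqint_lincomb n (c : 'I_n -> R[i]) (F : 'I_n -> T -> R[i]) :
  (forall i, sqint (F i)) -> sqint (fun x => \sum_(i < n) c i * F i x).
Proof. by move=> sF; apply: sqint_sum => i _; exact: sqintZ. Qed.

Lemma sqint_conj g : sqint g -> sqint (fun x => ((g x)^*)%C).
Proof.
move=> [mg gf]; split; first exact: cmeasurable_conj.
by under eq_integral do rewrite nsq_conj.
Qed.

Definition ip g h : R[i] := cintegral mu (fun x => g x * ((h x)^*)%C).

Lemma cintegrable_ip g h : sqint g -> sqint h -> cintegrable mu (fun x => g x * ((h x)^*)%C).
Proof. by move=> sg sh; apply: sqintM => //; exact: sqint_conj. Qed.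

Lemma ipC g h : sqint g -> sqint h -> ip h g = ((ip g h)^*)%C.
Proof.
move=> sg sh; rewrite /ip -cint_conj; last exact: cintegrable_ip.
by apply: eq_cint => x; rewrite conjcM conjcK mulrC.
Qed.

Lemma ip_suml n (c : 'I_n -> R[i]) (F : 'I_n -> T -> R[i]) h :
  (forall i, sqint (F i)) -> sqint h ->
  ip (fun x => \sum_(i < n) c i * F i x) h = \sum_(i < n) c i * ip (F i) h.
Proof.
move=> sF sh; rewrite /ip; under eq_cint do rewrite mulr_suml.
rewrite cint_sum; last first.
  by move=> i _; apply: cintegrable_ip => //; exact: sqintZ.
apply: eq_bigr => i _; rewrite -cintZ; last exact: cintegrable_ip.
by apply: eq_cint => x; rewrite mulrA.
Qed.

Lemma ip_sumr n (c : 'I_n -> R[i]) (F : 'I_n -> T -> R[i]) h :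
  (forall i, sqint (F i)) -> sqint h ->
  ip h (fun x => \sum_(i < n) c i * F i x) = \sum_(i < n) ((c i)^*)%C * ip h (F i).
Proof.
move=> sF sh; rewrite ipC//; last exact: sqint_lincomb.
rewrite ip_suml// conjc_sum; apply: eq_bigr => i _.
by rewrite conjcM -ipC.
Qed.

Lemma ipDl g h f : sqint g -> sqint h -> sqint f ->
  ip (fun x => g x + h x) f = ip g f + ip h f.
Proof.
move=> sg sh sf; rewrite /ip -cintD; [|exact: cintegrable_ip..].
by apply: eq_cint => x; rewrite mulrDl.
Qed.

Lemma ipDr g h f : sqint g -> sqint h -> sqint f ->
  ip f (fun x => g x + h x) = ip f g + ip f h.
Proof.
move=> sg sh sf; rewrite ipC//; last exact: sqintD.
by rewrite ipDl// conjcD -!ipC.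
Qed.

Lemma ip_nsq g : ip g g = ((\int[mu]_x nsq (g x))%:C)%C.
Proof. by rewrite -cint_real; apply: eq_cint => x; rewrite nsqE. Qed.

Lemma ip_eq0 g : sqint g -> ip g g = 0 -> {ae mu, forall x, g x = 0}.
Proof.
move=> sg; rewrite ip_nsq => -[]; rewrite /Rintegral => h.
have h0 : (\int[mu]_x (nsq (g x))%:E = 0)%E.
  by rewrite -[LHS]fineK ?h//; exact: integrable_fin_num (sqint_integrable sg).
have mg : measurable_fun setT (fun x => (nsq (g x))%:E).
  by apply/measurable_EFinP; apply: measurable_nsq; case: sg.
have /(ae_ge0_integral0 mu mg) : forall x, (0 <= (nsq (g x))%:E)%E.
  by move=> x; rewrite lee_fin nsq_ge0.
by move=> [/(_ h0) + _] => /ae_imp; apply => x [] /nsq_eq0.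
Qed.

Definition orthonormal_fam n (e : 'I_n -> T -> R[i]) : Prop :=
  forall k l, ip (e k) (e l) = (k == l)%:R.

(** The pairing has no conjugate, like the values produced by Fourier inversion, so the coefficients
    are those of the conjugate [Phi]. [Phi + S] is [Phi] minus its projection, and its squared norm
    is nonnegative. *)
Lemma bessel n (e : 'I_n -> T -> R[i]) (Psi : T -> R[i]) :
  (forall k, sqint (e k)) -> orthonormal_fam e -> sqint Psi ->
  \sum_(k < n) nsq (cintegral mu (fun x => e k x * Psi x)) <= \int[mu]_x nsq (Psi x).
Proof.
move=> se oe sP; pose Phi x := ((Psi x)^*)%C.
have sPhi : sqint Phi by exact: sqint_conj.
pose a k := cintegral mu (fun x => e k x * Psi x).
have aE k : a k = ip (e k) Phi by apply: eq_cint => x; rewrite conjcK.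
pose S x := \sum_(k < n) (- ((a k)^*)%C) * e k x.
have sS : sqint S by exact: sqint_lincomb.
have ipPS : ip Phi S = - (\sum_(k < n) ((nsq (a k))%:C)%C).
  rewrite ip_sumr// -sumrN; apply: eq_bigr => k _.
  by rewrite ipC// -aE conjcN conjcK nsqE mulNr.
have ipSS : ip S S = \sum_(k < n) ((nsq (a k))%:C)%C.
  rewrite ip_suml//; apply: eq_bigr => k _.
  have -> : ip (e k) S = - a k.
    rewrite ip_sumr//; under eq_bigr do rewrite conjcN conjcK oe.
    rewrite (bigD1 k)//= eqxx mulr1 big1 ?addr0// => l lk.
    by rewrite eq_sym (negbTE lk) mulr0.
  by rewrite mulrNN nsqE mulrC.
have ipSP : ip S Phi = - (\sum_(k < n) ((nsq (a k))%:C)%C).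
  rewrite ipC// ipPS conjcN conjc_sum; congr (- _); apply: eq_bigr => k _.
  exact: conjc_real.
have : ip (fun x => Phi x + S x) (fun x => Phi x + S x) =
   ((\int[mu]_x nsq (Psi x) - \sum_(k < n) nsq (a k))%:C)%C.
  rewrite ipDl ?ipDr//; last exact: sqintD.
  rewrite ipPS ipSS ipSP ip_nsq.
  under eq_Rintegral do rewrite nsq_conj.
  by rewrite addrA subrK rmorphB rmorph_sum.
rewrite ip_nsq => -[] h; rewrite -subr_ge0 -h.
by apply: Rintegral_ge0 => x _; exact: nsq_ge0.
Qed.

Local Open Scope sesquilinear_scope.

(* Diagonalizing the Gram matrix by a unitary matrix makes the family orthogonal. *)
Lemma gram_diag n (g : 'I_n -> T -> R[i]) : (forall i, sqint (g i)) ->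
  exists2 P : 'M[R[i]]_n, P \is unitarymx &
  exists dg : 'I_n -> R[i], forall k l,
    ip (fun x => \sum_(j < n) P k j * g j x) (fun x => \sum_(j < n) P l j * g j x) =
    (k == l)%:R * dg k.
Proof.
move=> sg; pose A : 'M[R[i]]_n := \matrix_(i, j) ip (g i) (g j).
have hA : A \is hermsymmx.
  apply/is_hermitianmxP; rewrite expr0 scale1r; apply/matrixP => i j.
  by rewrite !mxE conjCE -ipC.
have nA := hermitian_normalmx hA.
have uP := spectral_unitarymx A.
have /orthomx_spectralP eA := nA.
exists (spectralmx A) => //; exists (fun k => spectral_diag A 0 k) => k l.
set P := spectralmx A in uP eA *.
have e : P *m A *m P^t* = diag_mx (spectral_diag A).
  rewrite {1}eA !mulmxA mulmxV ?spectral_unit// mul1mx -mulmxA (unitarymxP uP).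
  by rewrite mulmx1.
transitivity ((P *m A *m P^t*) k l); last by rewrite e mxE eq_sym mulr_natl.
rewrite ip_suml//; last exact: sqint_lincomb.
under eq_bigr do rewrite ip_sumr//.
rewrite mxE; under [RHS]eq_bigr do rewrite mxE mulr_suml.
rewrite exchange_big /=; apply: eq_bigr => j _; rewrite mulr_sumr; apply: eq_bigr => i _.
by rewrite !mxE; ring.
Qed.

Let normalize n (G : 'I_n -> T -> R[i]) (dg : 'I_n -> R[i]) : (forall k, sqint (G k)) ->
  (forall k l, ip (G k) (G l) = (k == l)%:R * dg k) ->
  forall k l, dg k != 0 ->
  ip (fun x => ((Num.sqrt (complex.Re (dg k)))^-1)%:C%C * G k x)
     (fun x => ((Num.sqrt (complex.Re (dg l)))^-1)%:C%C * G l x) = (k == l)%:R.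
Proof.
move=> sG oG k l dk.
pose s k := ((Num.sqrt (complex.Re (dg k)))^-1)%:C%C : R[i].
transitivity (s k * s l * ip (G k) (G l)).
  rewrite /ip -cintZ; last exact: cintegrable_ip.
  apply: eq_cint => x; rewrite conjcM conjc_real /s; ring.
rewrite oG; case: eqVneq => [<-|_]; last by rewrite !mul0r mulr0.
rewrite mul1r /s.
(* On the diagonal [dg k] is the squared norm of [G k], hence real and nonnegative, and the root of
   its real part is the norm. *)
have := oG k k; rewrite eqxx mul1r ip_nsq => e; rewrite -e in dk *.
set r := (\int[mu]_x _) in e dk *.
have r0 : 0 <= r by apply: Rintegral_ge0 => x _; exact: nsq_ge0.
have {}dk : r != 0 by apply: contra_neq dk => ->.
rewrite /= -!rmorphM /= -invfM -expr2 sqr_sqrtr// mulVf//.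
Qed.

(** Combinations with Gram eigenvalue 0 vanish almost everywhere and are dropped; the others are
    normalized. Hence [m] may be smaller than [n], and spans agree only almost everywhere. *)
Lemma orthonormalize n (g : 'I_n -> T -> R[i]) : (forall i, sqint (g i)) ->
  exists m (e : 'I_m -> T -> R[i]), [/\ forall k, sqint (e k), orthonormal_fam e &
    forall c : 'I_n -> R[i], exists c' : 'I_m -> R[i],
      {ae mu, forall x, \sum_(i < n) c i * g i x = \sum_(k < m) c' k * e k x}].
Proof.
move=> sg; have [P uP [dg hdg]] := gram_diag sg.
pose G k x := \sum_(j < n) P k j * g j x.
have sG k : sqint (G k) by exact: sqint_lincomb.
pose D := [set k | dg k != 0]%SET.
pose s k : R[i] := ((Num.sqrt (complex.Re (dg k)))^-1)%:C%C.
pose e (i : 'I_#|D|) x := s (enum_val i) * G (enum_val i) x.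
have dD (i : 'I_#|D|) : dg (enum_val i) != 0.
  by have := enum_valP i; rewrite inE.
exists #|D|, e; split.
- by move=> k; exact: sqintZ.
- move=> k l; rewrite (normalize sG hdg)//.
  by rewrite (inj_eq enum_val_inj).
move=> c; pose b k := \sum_(i < n) c i * ((P k i)^*)%C.
(* Unitarity recovers the [g i] from the [G k] through the conjugate transpose, which is the origin
   of [b]. *)
have gG x : \sum_(i < n) c i * g i x = \sum_(k < n) b k * G k x.
  have PP : P^t* *m P = 1%:M by apply: mulmx1C; exact/unitarymxP.
  transitivity (\sum_(i < n) c i * \sum_(j < n) (P^t* *m P) i j * g j x).
    apply: eq_bigr => i _; rewrite PP (bigD1 i)//= big1 ?addr0.
      by rewrite mxE eqxx mul1r.
    by move=> j ji; rewrite mxE eq_sym (negbTE ji) mul0r.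
  under eq_bigr do under eq_bigr do rewrite mxE mulr_suml.
  under eq_bigr do rewrite exchange_big /= mulr_sumr.
  rewrite exchange_big /=; apply: eq_bigr => k _; rewrite /b mulr_suml.
  apply: eq_bigr => i _; rewrite /G !mulr_sumr; apply: eq_bigr => j _.
  by rewrite !mxE conjCE; ring.
exists (fun i => b (enum_val i) * (s (enum_val i))^-1).
have G0 : {ae mu, forall x, forall k, dg k = 0 -> G k x = 0}.
  apply: ae_forall_fin => k; have [dk|dk] := eqVneq (dg k) 0; last first.
    by apply: aeW => x dk0; rewrite dk0 eqxx in dk.
  apply: (ae_imp (ip_eq0 (sG k) _)) => //.
  by rewrite hdg dk mulr0.
apply: (ae_imp G0) => x G0x; rewrite gG.
rewrite (bigID (fun k => k \in D)) /= [X in _ + X]big1 ?addr0; last first.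
  by move=> k; rewrite inE negbK => /eqP /G0x ->; rewrite mulr0.
rewrite big_enum_val /=; apply: eq_bigr => i _; rewrite /e mulrA; congr (_ * _).
rewrite -mulrA mulVf ?mulr1//.
(* [s] cannot vanish here: the normalized function would be 0, whereas its squared norm is 1. *)
have := normalize sG hdg (enum_val i) (dD i); rewrite eqxx.
apply: contra_eq_neq => /=; rewrite -/(s _) => ->.
rewrite /ip; under eq_cint do rewrite mul0r mul0r.
by rewrite cint0 eq_sym oner_eq0.
Qed.

(** A zero Gram eigenvalue would turn a row of the unitary matrix, which is nonzero, into a
    vanishing combination. The matrix is returned because the new functions must be recognized as
    trigonometric polynomials times a fixed factor. *)
Lemma orthonormalize_free n (g : 'I_n -> T -> R[i]) : (forall i, sqint (g i)) ->
  (forall c : 'I_n -> R[i], {ae mu, forall x, \sum_(i < n) c i * g i x = 0} ->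
    forall i, c i = 0) ->
  exists M : 'M[R[i]]_n, orthonormal_fam (fun k x => \sum_(j < n) M k j * g j x).
Proof.
move=> sg fg; have [P uP [dg hdg]] := gram_diag sg.
pose G k x := \sum_(j < n) P k j * g j x.
have sG k : sqint (G k) by exact: sqint_lincomb.
have d0 k : dg k != 0.
  apply/eqP => dk; have : ip (G k) (G k) = 0 by rewrite hdg dk mulr0.
  move=> /(ip_eq0 (sG k))/fg Pk.
  have := congr1 (fun A : 'M[R[i]]_n => A k k) (unitarymxP uP).
  rewrite !mxE big1 ?eqxx; first by move/eqP; rewrite eq_sym oner_eq0.
  by move=> j _; rewrite Pk mul0r.
pose s k : R[i] := ((Num.sqrt (complex.Re (dg k)))^-1)%:C%C.
exists (\matrix_(k, j) (s k * P k j)) => k l.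
rewrite -(normalize sG hdg l (d0 k)); congr ip; apply/funext => x;
  by rewrite mulr_sumr; apply: eq_bigr => j _; rewrite mxE mulrA.
Qed.

End SquareIntegrable.

(** * Small translates of sets of finite measure *)

Lemma measure_dominated_cvg0 d (T : measurableType d) (R : realType)
    (mu : {measure set T -> \bar R}) (B : nat -> set T) (A : set T) :
  (forall n, measurable (B n)) -> measurable A -> (mu A < +oo)%E ->
  (forall n, B n `<=` A) -> (forall y, \forall n \near \oo, ~ B n y) ->
  mu (B n) @[n --> \oo] --> 0%E.
Proof.
move=> mB mA Afin BA Bnot.
have iA : mu.-integrable setT (fun y => (\1_A y : R)%:E).
  by apply: integrable_ge0P => //; rewrite integral_indic// setIT.
have mF n : measurable_fun setT (fun y => (\1_(B n) y : R)%:E).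
  by apply/measurable_EFinP; exact: measurable_indic.
have cF : {ae mu, forall y, setT y -> (fun n => (\1_(B n) y : R)%:E) @ \oo --> (0 : \bar R)%E}.
  apply: aeW => y _; apply: cvg_near_cst; apply: filterS (Bnot y) => n nB.
  by rewrite indicE memNset.
have dF : {ae mu, forall y n, setT y -> (`|(\1_(B n) y : R)%:E| <= (\1_A y : R)%:E)%E}.
  apply: aeW => y n _; rewrite abse_EFin lee_fin ger0_norm//.
  rewrite !indicE; have [yB|] := boolP (y \in B n); last by rewrite ler0n.
  by rewrite (mem_set (BA n y (set_mem yB))).
have [_ _] := dominated_convergence measurableT mF (measurable_cst (0%E : \bar R)) cF iA dF.
rewrite integral0; apply: cvg_trans; apply: near_eq_cvg; apply: nearW => n /=.
by rewrite integral_indic// setIT.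
Qed.

Section Translates.
Context (R : realType).
Local Notation mu := (@lebesgue_measure R).
Local Notation RR := (measurableTypeR R).

Lemma ge0_cvge0P (f : nat -> \bar R) : (forall n, 0 <= f n)%E ->
  f @ \oo --> 0%E <-> forall e : R, 0 < e -> \forall n \near \oo, (f n <= e%:E)%E.
Proof.
move=> f0; split=> [/fine_cvgP[ff fc] e e0|h].
  move/cvgrPdist_le : fc => /(_ e e0) fc.
  near=> n; have fn : f n \is a fin_num by near: n.
  rewrite -(fineK fn) lee_fin (le_trans (ler_norm _))// -normrN -sub0r.
  by near: n.
apply/fine_cvgP; split.
  near=> n; rewrite ge0_fin_numE//.
  have : (f n <= 1%:E)%E by near: n; exact: h.
  by move=> /le_lt_trans; apply; rewrite ltry.
apply/cvgrPdist_le => e e0; near=> n.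
have fn : (f n <= e%:E)%E by near: n; exact: h.
rewrite /= sub0r normrN ger0_norm ?fine_ge0//.
rewrite -lee_fin fineK// ge0_fin_numE//.
by rewrite (le_lt_trans fn)// ltry.
Unshelve. all: by end_near. Qed.

Definition shift_set (t : R) (A : set RR) : set RR := [set y | A (y - t)].

Lemma measurable_shift_set t (A : set RR) : measurable A -> measurable (shift_set t A : set RR).
Proof.
move=> mA; have [m _] := mpres_addr (- t).
by rewrite -[shift_set t A]setTI; exact: m.
Qed.

Lemma lebesgue_shift_set t (A : set RR) : measurable A -> mu (shift_set t A) = mu A.
Proof. by move=> mA; have [_] := mpres_addr (- t); apply. Qed.

(* For [U] open a point of [A] eventually stays in [U] under small shifts, so dominated
   convergence applies; outer regularity then reduces the general case to this one. *)
Lemma shift_diff_open_cvg0 (A U : set RR) (tau : nat -> R) :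
  measurable A -> (mu A < +oo)%E -> open (U : set R) -> A `<=` U ->
  tau @ \oo --> (0 : R) -> mu (shift_set (tau n) A `\` U) @[n --> \oo] --> 0%E.
Proof.
move=> mA Afin oU AU tau0.
have mU : measurable U by exact: open_measurable.
have mD n : measurable (A `\` shift_set (- tau n) U).
  by apply: measurableD => //; exact: measurable_shift_set.
(* Shifting back transfers the translation from [A] to [U], so that all the sets lie in the fixed
   set [A]. *)
have eF n : mu (shift_set (tau n) A `\` U) = mu (A `\` shift_set (- tau n) U).
  rewrite -[RHS](lebesgue_shift_set (tau n))//; congr (mu _).
  by apply/seteqP; split => y; rewrite /shift_set /= opprK subrK.
under eq_fun do rewrite eF.
apply: (measure_dominated_cvg0 mD mA Afin) => // y.
have [yU|nyU] := pselect (U y); last first.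
  by apply: nearW => n [Ay _]; apply: nyU; exact: AU.
have : (fun n => y - - tau n) @ \oo --> (y : R).
  rewrite -[X in _ --> X]addr0; under eq_fun do rewrite opprK.
  by apply: cvgD => //; exact: cvg_cst.
move=> /(_ U (open_nbhs_nbhs (conj oU yU))) h.
have {}h : \forall n \near \oo, U (y - - tau n) := h.
by apply: filterS h => n Un [_]; apply.
Qed.

Lemma shift_diff_cvg0 (A : set RR) (tau : nat -> R) :
  measurable A -> (mu A < +oo)%E -> tau @ \oo --> (0 : R) ->
  mu (shift_set (tau n) A `\` A) @[n --> \oo] --> 0%E.
Proof.
move=> mA Afin tau0; apply/ge0_cvge0P => [n//|e e0].
have e20 : 0 < e / 2 by rewrite divr_gt0.
have [U [oU AU UA]] := lebesgue_regularity_outer mA Afin e20.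
have mU : measurable (U : set RR) by exact: open_measurable.
have := shift_diff_open_cvg0 mA Afin oU AU tau0.
move=> /ge0_cvge0P => /(_ (fun n => measure_ge0 _ _)) /(_ _ e20).
apply: filterS => n h.
have mS := measurable_shift_set (tau n) mA.
apply: (@le_trans _ _ (mu ((shift_set (tau n) A `\` U) `|` (U `\` A)))).
  apply: le_measure; rewrite ?inE.
  - exact: measurableD.
  - by apply: measurableU; exact: measurableD.
  - move=> y [Sy nA]; have [Uy|nU] := pselect (U y); [by right|by left].
apply: (le_trans (measureU2 _ _ _)); [exact: measurableD|exact: measurableD|].
by rewrite (_ : e = e / 2 + e / 2) ?EFinD; [apply: leeD => //; exact: ltW|field].
Qed.

Local Notation mu2 := (mu \x mu)%E.

Definition vshift (t : R) (E : set (RR * RR)) : set (RR * RR) := [set z | E (z.1, z.2 - t)].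

Lemma measurable_vshift t (E : set (RR * RR)) : measurable E -> measurable (vshift t E : set (RR * RR)).
Proof.
move=> mE; rewrite -[vshift t E]setTI.
have m : measurable_fun setT (fun z : RR * RR => (z.1, z.2 - t) : RR * RR).
  apply: measurable_fun_pair; first exact: measurable_fst.
  by apply: measurable_funB; [exact: measurable_snd|exact: measurable_cst].
exact: m.
Qed.

(** A vertical shift acts on each slice as a shift of the line. Almost every slice of [E] has finite
    measure, and these measures dominate. *)
Lemma vshift_diff_cvg0 (E : set (RR * RR)) (tau : nat -> R) :
  measurable E -> (mu2 E < +oo)%E -> tau @ \oo --> (0 : R) ->
  mu2 (vshift (tau n) E `\` E) @[n --> \oo] --> 0%E.
Proof.
move=> mE Efin tau0.
have xs n x : xsection (vshift (tau n) E `\` E) x =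
    shift_set (tau n) (xsection E x) `\` xsection E x.
  by apply/seteqP; split => y; rewrite /xsection /shift_set /vshift /= !inE.
have mD n : measurable (vshift (tau n) E `\` E).
  by apply: measurableD => //; exact: measurable_vshift.
have mF n : measurable_fun setT (fun x : RR => mu (xsection (vshift (tau n) E `\` E) x)).
  exact: (measurable_fun_xsection mu (mD n)).
have mEx : measurable_fun setT (fun x : RR => mu (xsection E x)).
  exact: (measurable_fun_xsection mu mE).
have iE : mu.-integrable setT (fun x : RR => mu (xsection E x)).
  by apply/integrableP; split => //; under eq_integral do rewrite gee0_abs//.
have cF : {ae mu, forall x : RR, setT x ->
    (fun n => mu (xsection (vshift (tau n) E `\` E) x)) @ \oo --> (0 : \bar R)%E}.
  apply: (ae_imp (integrable_ae measurableT iE)) => x /(_ Logic.I) xfin _.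
  under eq_fun do rewrite xs.
  apply: shift_diff_cvg0 => //; first exact: measurable_xsection.
  by rewrite ltey_eq xfin.
have dF : {ae mu, forall (x : RR) n, setT x ->
    (`|mu (xsection (vshift (tau n) E `\` E) x)| <= mu (xsection E x))%E}.
  apply: aeW => x n _; rewrite gee0_abs// xs.
  have mx : measurable (xsection E x : set RR) by exact: measurable_xsection.
  rewrite -[leRHS](lebesgue_shift_set (tau n))//.
  apply: le_measure; rewrite ?inE//; first apply: measurableD => //; exact: measurable_shift_set.
have [_ _] := dominated_convergence measurableT mF (measurable_cst (0%E : \bar R)) cF iE dF.
by rewrite integral0.
Qed.

(** With [N] fixed, the parts of the [N] translates outside [E] have total measure tending to 0 with
    the spacing, hence at most 1 for some [dl = 1/(n+1)]. *)
Lemma union_vshift (E : set (RR * RR)) (N : nat) : measurable E -> (mu2 E < +oo)%E ->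
  exists2 dl : R, 0 < dl &
    (mu2 (\bigcup_(j in [set j | (j < N)%N]) vshift (j%:R * dl) E) <= mu2 E + 1)%E.
Proof.
move=> mE Efin.
pose tau (j n : nat) : R := j%:R * n.+1%:R^-1.
have tau0 j : tau j @ \oo --> (0 : R).
  by rewrite -(mulr0 (j%:R)); apply: cvgM; [exact: cvg_cst|exact: cvg_harmonic].
have c : \sum_(0 <= j < N) mu2 (vshift (tau j n) E `\` E) @[n --> \oo] --> (\sum_(0 <= j < N) 0)%E.
  apply: cvg_nnesum => [j _|j _]; first exact: nearW.
  exact: vshift_diff_cvg0.
rewrite big1// in c.
have /ge0_cvge0P := c => /(_ _ 1 ltr01)[].
  by move=> n; apply: sume_ge0.
move=> n _ /(_ n (leqnn _)) h.
exists (n.+1%:R^-1); first by rewrite invr_gt0.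
have mD j : measurable (vshift (tau j n) E `\` E).
  by apply: measurableD => //; exact: measurable_vshift.
apply: (@le_trans _ _ (mu2 (E `|` \big[setU/set0]_(j < N) (vshift (tau j n) E `\` E)))).
  apply: le_measure; rewrite ?inE.
  - by apply: bigcup_measurable => j _; exact: measurable_vshift.
  - by apply: measurableU => //; exact: bigsetU_measurable.
  - move=> z [j /= jN zj]; have [Ez|nEz] := pselect (E z); first by left.
    by right; rewrite -(bigcup_mkord N (fun j => vshift (tau j n) E `\` E)); exists j.
apply: (le_trans (measureU2 _ _ _)) => //; first exact: bigsetU_measurable.
rewrite leeD2l// (le_trans _ h)//.
rewrite (big_mkord xpredT (fun j => mu2 (vshift (tau j n) E `\` E))).
exact: (@Boole_inequality _ _ _ (mu \x mu)%E (fun j => vshift (tau j n) E `\` E) N (fun j _ => mD j)).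
Qed.

End Translates.

(** * The kernel of a finite rank Weyl transform *)

Section Lfun.
Context d (T : measurableType d) (R : realType) (mu : {measure set T -> \bar R}).

Lemma cLfun1P (f : T -> R[i]) : cLfun mu 1%E f -> cintegrable mu f.
Proof.
move=> [mf]; rewrite /finite_norm Lnorm1 => h; apply/cintegrableP; split => //.
by move: h; under eq_integral do rewrite /= ger0_norm ?normc_ge0//.
Qed.

Let Lnorm2E (f : T -> R[i]) : (\int[mu]_x (nsq (f x))%:E =
  \int[mu]_x `|(EFin \o (fun x => normc (f x))) x| `^ 2)%E.
Proof.
apply: eq_integral => x _.
by rewrite /= ger0_norm ?normc_ge0// powR_mulrn ?normc_ge0// sqr_normcE.
Qed.

Lemma cLfun2P (f : T -> R[i]) : cLfun mu 2%:E f <-> sqint mu f.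
Proof.
rewrite /cLfun /finite_norm /sqint Lnorm2E; split=> -[mf h]; split => //.
- by rewrite -powR_Lnorm// poweR_lty.
- by rewrite unlock /Lnorm poweR_lty.
Qed.

End Lfun.

Section Kernel.
Context (R : realType).
Local Notation mu := (@lebesgue_measure R).
Local Notation RR := (measurableTypeR R).
Local Notation mu2 := (mu \x mu)%E.
Implicit Type f : R * R -> R[i].

Definition kern f (t x : R) : R[i] :=
  cintegral mu (fun y => f (x, y) * cexpi (pi * (x * y + 2 * y * t))).

(** The [L^1] norm of a slice bounds [kern f t x] uniformly in [t], so the operator is dominated by
    convolution with an integrable function. *)
Definition mass f (x : R) : \bar R := (\int[mu]_y (normc (f (x, y)))%:E)%E.

Variable f : R * R -> R[i].
Hypothesis cf : cintegrable mu2 f.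

Let mf : cmeasurable (f : RR * RR -> _).
Proof. exact: cintegrable_measurable cf. Qed.

Lemma measurable_mass : measurable_fun setT (mass f : RR -> _).
Proof.
apply: (measurable_fun_fubini_tonelli_F (fun z : RR * RR => (normc (f z))%:E)) => //.
  exact/measurable_EFinP/measurable_normc.
by move=> z; rewrite lee_fin normc_ge0.
Qed.

Lemma mass_ge0 x : (0 <= mass f x)%E.
Proof. by apply: integral_ge0 => y _; rewrite lee_fin normc_ge0. Qed.

Lemma mass_fin : (\int[mu]_x mass f x < +oo)%E.
Proof.
have [_] := (cintegrableP _ _).1 cf.
rewrite (fubini_tonelli1 (fun z : RR * RR => (normc (f z))%:E))//.
- exact/measurable_EFinP/measurable_normc.
- by move=> z; rewrite lee_fin normc_ge0.
Qed.

Lemma cmeasurable_kern : cmeasurable (fun z : RR * RR => kern f z.1 z.2).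
Proof.
apply: (cmeasurable_cint mu (f := fun z : (RR * RR) * RR =>
  f (z.1.2, z.2) * cexpi (pi * (z.1.2 * z.2 + 2 * z.2 * z.1.1)))).
have m11 : measurable_fun setT (fun z : (RR * RR) * RR => z.1.1).
  by apply: (measurableT_comp (f := fst)) => //; exact: measurable_fst.
have m12 : measurable_fun setT (fun z : (RR * RR) * RR => z.1.2).
  by apply: (measurableT_comp (f := snd)) => //; exact: measurable_fst.
have m2 : measurable_fun setT (fun z : (RR * RR) * RR => z.2) by exact: measurable_snd.
apply: cmeasurableM.
  by apply: (cmeasurable_comp mf); exact: measurable_fun_pair.
apply: cmeasurable_cexpi; apply: measurable_funM; first exact: measurable_cst.
apply: measurable_funD; first exact: measurable_funM.
by apply: measurable_funM => //; apply: measurable_funM => //; exact: measurable_cst.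
Qed.

Lemma cmeasurable_phase_y (x t : R) : cmeasurable (fun y : RR => cexpi (pi * (x * y + 2 * y * t))).
Proof.
apply: cmeasurable_cexpi; apply: measurable_funM; first exact: measurable_cst.
apply: measurable_funD; first by apply: measurable_funM => //; exact: measurable_cst.
apply: measurable_funM; last exact: measurable_cst.
by apply: measurable_funM => //; exact: measurable_cst.
Qed.

Lemma normc_kern_le t x : ((normc (kern f t x))%:E <= mass f x)%E.
Proof.
apply: (le_trans (normc_cint_le _ _)).
  by apply: cmeasurableM; [exact: cmeasurable_pair2|exact: cmeasurable_phase_y].
rewrite le_eqVlt; apply/orP; left; apply/eqP; apply: eq_integral => y _.
by rewrite normcM normc_cexpi mulr1.
Qed.

(* The Weyl transform is the integral operator with kernel [Kern]. *)
Definition Kern (t s : R) : R[i] := kern f t (s - t).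

Lemma cmeasurable_Kern : cmeasurable (fun z : RR * RR => Kern z.1 z.2).
Proof.
apply: (cmeasurable_comp cmeasurable_kern (u := fun z : RR * RR => (z.1, z.2 - z.1))).
apply: measurable_fun_pair; first exact: measurable_fst.
by apply: measurable_funB; [exact: measurable_snd|exact: measurable_fst].
Qed.

(** Boundedness of [phi] makes the double integral converge absolutely for every [t], so the
    identity is pointwise. The substitution is [s = x + t]. *)
Lemma weyl_kern (phi : R -> R[i]) t : cmeasurable (phi : RR -> _) ->
  (forall s, normc (phi s) <= 1) ->
  weyl f phi t = cintegral mu (fun s => Kern t s * phi s).
Proof.
move=> mphi phi1.
have mtx : measurable_fun setT (fun x : RR => t + x).
  by apply: measurable_funD => //; exact: measurable_cst.
have mB : cmeasurable (fun z : RR * RR => rho z.1 z.2 phi t).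
  apply: cmeasurableM.
    apply: cmeasurable_cexpi; apply: measurable_funM; first exact: measurable_cst.
    apply: measurable_funD; first by apply: measurable_funM; [exact: measurable_fst|exact: measurable_snd].
    apply: measurable_funM; last exact: measurable_cst.
    by apply: measurable_funM; [exact: measurable_cst|exact: measurable_snd].
  apply: (cmeasurable_comp mphi (u := fun z : RR * RR => t + z.1)).
  by apply: measurable_funD; [exact: measurable_cst|exact: measurable_fst].
have B1 z : normc (rho z.1 z.2 phi t) <= 1 by rewrite normcM normc_cexpi mul1r.
have cfB : cintegrable mu2 (fun z => f z * rho z.1 z.2 phi t).
  under eq_fun do rewrite mulrC; exact: (cintegrableM_bounded (M := 1)).
rewrite /weyl -[LHS]/(cintegral mu2 (fun z => f z * rho z.1 z.2 phi t)) -cfubini1//=.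
transitivity (cintegral mu (fun x => Kern t (x + t) * phi (x + t))); last first.
  apply: (cint_mpres (mpres_addr t) (f := fun s : RR => Kern t s * phi s)).
  by apply: cmeasurableM => //; exact: (cmeasurable_pair2 (f := fun z : RR * RR => Kern z.1 z.2) t cmeasurable_Kern).
apply: ae_eq_cint.
- exact: (cmeasurable_cint mu (cintegrable_measurable cfB)).
- apply: (cmeasurable_comp (f := fun s : RR => Kern t s * phi s) (u := fun x : RR => x + t)).
    by apply: cmeasurableM => //; exact: (cmeasurable_pair2 (f := fun z : RR * RR => Kern z.1 z.2) t cmeasurable_Kern).
  by apply: measurable_funD => //; exact: measurable_cst.
apply: (ae_imp (cintegrable_ae1 cf)) => x cfx /=.
rewrite /Kern addrK /kern -cintZr; last first.
  under eq_fun do rewrite mulrC.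
  apply: (cintegrableM_bounded (M := 1)) => //; first exact: cmeasurable_phase_y.
  by move=> y; rewrite normc_cexpi.
by apply: eq_cint => y; rewrite /rho mulrA (addrC t).
Qed.

Let ka (u : R) := mass f u.

(** With [int_mass_subl], this says that the rows and the columns of the dominating kernel
    [ka (s - t)] have one common finite integral, as Schur's test requires. *)
Lemma int_mass_subr t : (\int[mu]_s ka (s - t) = \int[mu]_x mass f x)%E.
Proof.
apply: (ge0_integral_mpres (mpres_addr (- t)) (f := mass f)).
  exact: measurable_mass.
exact: mass_ge0.
Qed.

Lemma int_mass_subl s : (\int[mu]_t ka (s - t) = \int[mu]_x mass f x)%E.
Proof.
apply: (ge0_integral_mpres (mpres_subl s) (f := mass f)).
  exact: measurable_mass.
exact: mass_ge0.
Qed.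

Let measurable_ka2 : measurable_fun setT (fun z : RR * RR => ka (z.2 - z.1)).
Proof.
apply: (measurableT_comp (f := mass f) (g := fun z : RR * RR => z.2 - z.1)).
  exact: measurable_mass.
by apply: measurable_funB; [exact: measurable_snd|exact: measurable_fst].
Qed.

Let A0 : R := fine (\int[mu]_x mass f x).

Let A0E : (\int[mu]_x mass f x = A0%:E)%E.
Proof.
rewrite fineK// ge0_fin_numE ?mass_fin//; apply: integral_ge0 => x _; exact: mass_ge0.
Qed.

Let A0_ge0 : 0 <= A0.
Proof. by rewrite fine_ge0// integral_ge0// => x _; exact: mass_ge0. Qed.

Let measurable_ka_t s : measurable_fun setT (fun t : RR => ka (s - t)).
Proof. exact: (measurableT_comp measurable_ka2 (measurable_pair2 (s : RR))). Qed.

Let measurable_ka_s t : measurable_fun setT (fun s : RR => ka (s - t)).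
Proof. exact: (measurableT_comp measurable_ka2 (measurable_pair1 (t : RR))). Qed.

Lemma int_conv_t (v : R -> R) : measurable_fun setT (v : RR -> R) -> (forall t, 0 <= v t) ->
  (\int[mu]_t \int[mu]_s (ka (s - t) * (v t)%:E) = A0%:E * \int[mu]_t (v t)%:E)%E.
Proof.
move=> mv v0; rewrite -ge0_integralZl_EFin//; last 2 first.
- by move=> t _; rewrite lee_fin.
- exact/measurable_EFinP.
apply: eq_integral => t _; rewrite ge0_integralZr ?lee_fin//.
- by rewrite int_mass_subr A0E.
- by move=> s _; exact: mass_ge0.
Qed.

Lemma int_conv_s (v : R -> R) : measurable_fun setT (v : RR -> R) -> (forall t, 0 <= v t) ->
  (\int[mu]_t \int[mu]_s (ka (s - t) * (v s)%:E) = A0%:E * \int[mu]_t (v t)%:E)%E.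
Proof.
move=> mv v0.
rewrite (fubini_tonelli (fun z : RR * RR => ka (z.2 - z.1) * (v z.2)%:E)%E)//=; last 2 first.
- apply: emeasurable_funM => //; apply/measurable_EFinP.
  by apply: (measurableT_comp mv); exact: measurable_snd.
- by move=> z; rewrite mule_ge0 ?mass_ge0 ?lee_fin.
rewrite -ge0_integralZl_EFin//; last 2 first.
- by move=> t _; rewrite lee_fin.
- exact/measurable_EFinP.
apply: eq_integral => t _; rewrite ge0_integralZr ?lee_fin//.
- by rewrite int_mass_subl A0E.
- by move=> s _; exact: mass_ge0.
Qed.

Lemma cintegrable_Kern_s t : cintegrable mu (fun s => Kern t s).
Proof.
apply/cintegrableP; split.
  exact: (cmeasurable_pair2 (f := fun z : RR * RR => Kern z.1 z.2) t cmeasurable_Kern).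
apply: le_lt_trans mass_fin; rewrite -(int_mass_subr t).
apply: ge0_le_integral => //.
- by move=> s _; rewrite lee_fin normc_ge0.
- apply/measurable_EFinP/measurable_normc.
  exact: (cmeasurable_pair2 (f := fun z : RR * RR => Kern z.1 z.2) t cmeasurable_Kern).
- by move=> s _; exact: normc_kern_le.
Qed.

(** The bound of [|g phi|] by [|g|^2 + |phi|^2] reduces the claim to convolutions of integrable
    functions. *)
Lemma cintegrable_Kern_mul (g phi : R -> R[i]) : sqint mu g -> sqint mu phi ->
  cintegrable mu2 (fun z => Kern z.1 z.2 * (g z.1 * phi z.2)).
Proof.
move=> sg sphi.
have mg : cmeasurable (g : RR -> _) by case: sg.
have mphi : cmeasurable (phi : RR -> _) by case: sphi.
apply: cintegrable_prodP.
  apply: cmeasurableM; first exact: cmeasurable_Kern.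
  by apply: cmeasurableM; [apply: (cmeasurable_comp mg); exact: measurable_fst|
     apply: (cmeasurable_comp mphi); exact: measurable_snd].
pose v t := nsq (g t); pose w s := nsq (phi s).
have mv : measurable_fun setT (v : RR -> R) by exact: measurable_nsq.
have mw : measurable_fun setT (w : RR -> R) by exact: measurable_nsq.
apply: (@le_lt_trans _ _ (\int[mu]_t \int[mu]_s (ka (s - t) * (v t)%:E + ka (s - t) * (w s)%:E))%E).
  apply: ge0_le_integral => //.
  - by move=> t _; apply: integral_ge0 => s _; rewrite lee_fin normc_ge0.
  - apply: (measurable_fun_fubini_tonelli_F (fun z : RR * RR => (normc (Kern z.1 z.2 * (g z.1 * phi z.2)))%:E)) => //.
      apply/measurable_EFinP/measurable_normc; apply: cmeasurableM; first exact: cmeasurable_Kern.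
      by apply: cmeasurableM; [apply: (cmeasurable_comp mg); exact: measurable_fst|
         apply: (cmeasurable_comp mphi); exact: measurable_snd].
    by move=> z; rewrite lee_fin normc_ge0.
  - apply: (measurable_fun_fubini_tonelli_F (fun z : RR * RR => ka (z.2 - z.1) * (v z.1)%:E + ka (z.2 - z.1) * (w z.2)%:E)%E).
      apply: emeasurable_funD; apply: emeasurable_funM => //; apply/measurable_EFinP.
        by apply: (measurableT_comp mv); exact: measurable_fst.
      by apply: (measurableT_comp mw); exact: measurable_snd.
    by move=> z; rewrite adde_ge0// mule_ge0 ?mass_ge0 ?lee_fin ?nsq_ge0.
  - move=> t _; apply: ge0_le_integral => //.
    + by move=> s _; rewrite lee_fin normc_ge0.
    + apply/measurable_EFinP/measurable_normc; apply: cmeasurableM.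
        exact: (cmeasurable_pair2 (f := fun z : RR * RR => Kern z.1 z.2) t cmeasurable_Kern).
      exact: (cmeasurableZ (g t) mphi).
    + apply: emeasurable_funD; apply: emeasurable_funM => //; exact/measurable_EFinP.
    + move=> s _ /=; rewrite -ge0_muleDr ?lee_fin ?nsq_ge0// -EFinD normcM EFinM.
      apply: lee_pmul; rewrite ?lee_fin ?normc_ge0//; first exact: normc_kern_le.
      exact: normc_le_nsqD.
under eq_integral => t _.
  rewrite ge0_integralD//; last 4 first.
  - by move=> s _; rewrite mule_ge0 ?mass_ge0 ?lee_fin ?nsq_ge0.
  - by apply: emeasurable_funM => //; exact: measurable_cst.
  - by move=> s _; rewrite mule_ge0 ?mass_ge0 ?lee_fin ?nsq_ge0.
  - by apply: emeasurable_funM => //; exact/measurable_EFinP.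
  over.
rewrite ge0_integralD//; last 4 first.
- by move=> t _; apply: integral_ge0 => s _; rewrite mule_ge0 ?mass_ge0 ?lee_fin ?nsq_ge0.
- apply: (measurable_fun_fubini_tonelli_F (fun z : RR * RR => ka (z.2 - z.1) * (v z.1)%:E)%E).
    apply: emeasurable_funM => //; apply/measurable_EFinP.
    by apply: (measurableT_comp mv); exact: measurable_fst.
  by move=> z; rewrite mule_ge0 ?mass_ge0 ?lee_fin ?nsq_ge0.
- by move=> t _; apply: integral_ge0 => s _; rewrite mule_ge0 ?mass_ge0 ?lee_fin ?nsq_ge0.
- apply: (measurable_fun_fubini_tonelli_F (fun z : RR * RR => ka (z.2 - z.1) * (w z.2)%:E)%E).
    apply: emeasurable_funM => //; apply/measurable_EFinP.
    by apply: (measurableT_comp mw); exact: measurable_snd.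
  by move=> z; rewrite mule_ge0 ?mass_ge0 ?lee_fin ?nsq_ge0.
rewrite int_conv_t ?int_conv_s//; try by move=> ?; exact: nsq_ge0.
have [_ gf] := sg; have [_ pf] := sphi.
by apply: lte_add_pinfty; apply: lte_mul_pinfty => //; rewrite lee_fin.
Qed.

(* The functional [phi |-> <W(f) phi, g>] is integration against [dualfun g]. *)
Definition dualfun (g : R -> R[i]) (s : R) : R[i] :=
  cintegral mu (fun t => Kern t s * ((g t)^*)%C).

Let cmeasurable_dual g : cmeasurable (g : RR -> _) -> cmeasurable (dualfun g : RR -> _).
Proof.
move=> mg; apply: (cmeasurable_cint mu (f := fun z : RR * RR => Kern z.2 z.1 * ((g z.2)^*)%C)).
apply: cmeasurableM; first exact: (cmeasurable_swap cmeasurable_Kern).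
by apply: cmeasurable_conj; apply: (cmeasurable_comp mg); exact: measurable_snd.
Qed.

(** The pointwise bound of [|dualfun g|^2] by [(A0 + 1) * B] suffices, because [B] is the
    convolution of the integrable functions [mass f] and [|g|^2]. *)
Lemma sqint_dualfun g : sqint mu g -> sqint mu (dualfun g).
Proof.
move=> sg; have mg : cmeasurable (g : RR -> _) by case: sg.
split; first exact: cmeasurable_dual.
pose v t := nsq (g t).
have mv : measurable_fun setT (v : RR -> R) by exact: measurable_nsq.
have mkv : measurable_fun setT (fun z : RR * RR => ka (z.2 - z.1) * (v z.1)%:E)%E.
  apply: emeasurable_funM => //; apply/measurable_EFinP.
  by apply: (measurableT_comp mv); exact: measurable_fst.
pose B s : \bar R := (\int[mu]_t (ka (s - t) * (v t)%:E))%E.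
have B0 s : (0 <= B s)%E.
  by apply: integral_ge0 => t _; rewrite mule_ge0 ?mass_ge0 ?lee_fin ?nsq_ge0.
have mB : measurable_fun setT (B : RR -> _).
  apply: (measurable_fun_fubini_tonelli_G (fun z : RR * RR => ka (z.2 - z.1) * (v z.1)%:E)%E) => //.
  by move=> z; rewrite mule_ge0 ?mass_ge0 ?lee_fin ?nsq_ge0.
apply: (@le_lt_trans _ _ (\int[mu]_s ((A0 + 1)%:E * B s))%E); last first.
  rewrite ge0_integralZl_EFin ?addr_ge0//.
  rewrite -(fubini_tonelli (fun z : RR * RR => ka (z.2 - z.1) * (v z.1)%:E)%E)//=; last first.
    by move=> z; rewrite mule_ge0 ?mass_ge0 ?lee_fin ?nsq_ge0.
  rewrite int_conv_t//; last by move=> ?; exact: nsq_ge0.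
  have [_ gf] := sg.
  by apply: lte_mul_pinfty; rewrite ?lee_fin ?addr_ge0//; apply: lte_mul_pinfty.
apply: ge0_le_integral => //.
- by move=> s _; rewrite lee_fin nsq_ge0.
- by apply/measurable_EFinP/measurable_nsq; exact: cmeasurable_dual.
- by apply: emeasurable_funM => //; exact: measurable_cst.
move=> s _; have A1 : 0 < A0 + 1 by rewrite ltr_pwDr.
have [Bfin|] := ltP (B s) +oo%E; last first.
  by rewrite leye_eq => /eqP ->; rewrite gt0_muley ?leey// lte_fin.
have Bs : B s = (fine (B s))%:E by rewrite fineK// ge0_fin_numE.
rewrite Bs -EFinM lee_fin -sqr_normcE.
set j := normc _; set b := fine _ in Bs *.
have j0 : 0 <= j by exact: normc_ge0.
(* The optimal parameter would be [j / A0]; adding 1 avoids a division by zero when [f] vanishes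
   almost everywhere. *)
pose lam := j / (A0 + 1).
have lam0 : 0 <= lam by rewrite divr_ge0 ?(ltW A1).
have mKs : cmeasurable (fun t : RR => Kern t s).
  exact: (cmeasurable_pair1 (f := fun z : RR * RR => Kern z.1 z.2) s cmeasurable_Kern).
have l20 : 0 <= 2 * lam by rewrite mulr_ge0.
(* Schur's test: AM-GM with the parameter [lam] replaces the Cauchy-Schwarz inequality. *)
have key : 2 * lam * j <= lam ^+ 2 * A0 + b.
  rewrite -lee_fin EFinD [X in (_ <= X + _)%E]EFinM -A0E -(int_mass_subl s) -Bs /B.
  rewrite -ge0_integralZl_EFin ?sqr_ge0//; last by move=> t _; exact: mass_ge0.
  rewrite -ge0_integralD//; last 4 first.
  - by move=> t _; rewrite mule_ge0 ?mass_ge0 ?lee_fin ?sqr_ge0.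
  - by apply: emeasurable_funM => //; exact: measurable_cst.
  - by move=> t _; rewrite mule_ge0 ?mass_ge0 ?lee_fin ?nsq_ge0.
  - by apply: emeasurable_funM => //; exact/measurable_EFinP.
  rewrite EFinM.
  apply: (@le_trans _ _ ((2 * lam)%:E * \int[mu]_t (normc (Kern t s * ((g t)^*)%C))%:E)%E).
    apply: lee_wpmul2l; first by rewrite lee_fin.
    by apply: normc_cint_le; apply: cmeasurableM => //; exact: cmeasurable_conj.
  rewrite -ge0_integralZl_EFin ?l20//; last first.
  - by apply/measurable_EFinP/measurable_normc; apply: cmeasurableM => //; exact: cmeasurable_conj.
  - by move=> t _; rewrite lee_fin normc_ge0.
  apply: ge0_le_integral => //.
  - by move=> t _; rewrite mule_ge0 ?lee_fin ?normc_ge0.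
  - apply: emeasurable_funM; first exact: measurable_cst.
    by apply/measurable_EFinP/measurable_normc; apply: cmeasurableM => //; exact: cmeasurable_conj.
  - apply: emeasurable_funD; apply: emeasurable_funM => //; exact/measurable_EFinP.
  move=> t _; rewrite (muleC (lam ^+ 2)%:E) -ge0_muleDr ?lee_fin ?sqr_ge0 ?nsq_ge0//.
  rewrite -EFinM -EFinD normcM mulrCA EFinM.
  apply: lee_pmul; [by rewrite lee_fin normc_ge0| |exact: normc_kern_le|rewrite lee_fin].
    by rewrite lee_fin; apply: mulr_ge0; [exact: l20|exact: normc_ge0].
  rewrite /v -sqr_normcE [normc (_^*)%C]normcE nsq_conj -normcE.
  by have := sqr_ge0 (lam - normc (g t)); nra.
have jl : j = lam * (A0 + 1) by rewrite /lam divfK// gt_eqF.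
have l2 : 0 <= lam ^+ 2 by exact: sqr_ge0.
rewrite jl in key *.
have k2 : lam ^+ 2 * (A0 + 1) <= b by nra.
by rewrite exprMn expr2 mulrA [leRHS]mulrC ler_wpM2r// ltW.
Qed.

Lemma sqint_cindic_itv a b : sqint mu (cindic (`[a, b[%classic : set R)).
Proof.
split; first by apply: cmeasurable_cindic; exact: measurable_itv.
under eq_integral do rewrite nsq_cindic.
rewrite integral_indic// setIT.
rewrite -[X in (X < _)%E]/(@lebesgue_measure R `[a, b[%classic).
by rewrite lebesgue_measure_itv /=; case: ifP => _; rewrite ?ltry// -EFinB ltry.
Qed.

Lemma normc_cindic_le1 (A : set R) s : normc (cindic A s) <= 1.
Proof. by rewrite normc_cindic indicE; case: (_ \in _). Qed.

(** Orthonormality of the spanning family allows the coefficients to be read off as inner products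
    in [weyl_coef]. *)
Lemma finite_rank_orthonormal : finite_rank (weyl f) ->
  exists m (e : 'I_m -> R -> R[i]), [/\ forall k, sqint mu (e k), orthonormal_fam mu e &
  forall phi, sqint mu phi -> exists c : 'I_m -> R[i],
    {ae mu, forall t, weyl f phi t = \sum_(k < m) c k * e k t}].
Proof.
move=> [n [g [gL hg]]].
have sg i : sqint mu (g i) by exact/(cLfun2P mu)/gL.
have [m [e [se oe he]]] := orthonormalize sg.
exists m, e; split => // phi sphi.
have [c hc] := hg phi ((cLfun2P mu phi).2 sphi).
have [c' hc'] := he c; exists c'.
by apply: (ae_imp2 hc hc') => t -> ->.
Qed.

Section Factor.
Variables (m : nat) (e : 'I_m -> R -> R[i]).
Hypotheses (se : forall k, sqint mu (e k)) (oe : orthonormal_fam mu e).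

(** Pairing with [e k] isolates [c k], and Fubini carries the integration in [t] onto the kernel,
    where it produces [dualfun (e k)]. *)
Lemma weyl_coef (phi : R -> R[i]) (c : 'I_m -> R[i]) : sqint mu phi ->
  (forall s, normc (phi s) <= 1) ->
  {ae mu, forall t, weyl f phi t = \sum_(k < m) c k * e k t} ->
  forall k, c k = cintegral mu (fun s => dualfun (e k) s * phi s).
Proof.
move=> sphi phi1 hc k.
have mphi : cmeasurable (phi : RR -> _) by case: sphi.
have ww : {ae mu, forall t, cintegral mu (fun s => Kern t s * phi s) = \sum_(k < m) c k * e k t}.
  by apply: (ae_imp hc) => t; rewrite weyl_kern.
have -> : c k = ip mu (fun t => \sum_(l < m) c l * e l t) (e k).
  rewrite ip_suml// (bigD1 k)//= oe eqxx mulr1 big1 ?addr0// => l lk.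
  by rewrite oe (negbTE lk) mulr0.
have sek : sqint mu (fun t => ((e k t)^*)%C) by exact: sqint_conj.
have mek : cmeasurable (fun t : RR => ((e k t)^*)%C) by case: sek.
have cK := cintegrable_Kern_mul sek sphi.
have mK : cmeasurable (fun t : RR => cintegral mu (fun s => Kern t s * phi s)).
  apply: (cmeasurable_cint mu (f := fun z : RR * RR => Kern z.1 z.2 * phi z.2)).
  apply: cmeasurableM; first exact: cmeasurable_Kern.
  by apply: (cmeasurable_comp mphi); exact: measurable_snd.
transitivity (cintegral mu (fun t => cintegral mu (fun s => Kern t s * phi s) * ((e k t)^*)%C)).
  apply: ae_eq_cint.
  - by apply: cmeasurableM => //; have [] := sqint_lincomb c se.
  - exact: cmeasurableM.
  - by apply: (ae_imp ww) => t ->.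
transitivity (cintegral mu (fun t => cintegral mu (fun s => Kern t s * (((e k t)^*)%C * phi s)))).
  apply: eq_cint => t; rewrite -cintZr.
    by apply: eq_cint => s; ring.
  apply: (eq_cintegrable (f := fun s : RR => phi s * Kern t s)) => [s|]; first by rewrite mulrC.
  by apply: (cintegrableM_bounded (M := 1)) => //; exact: cintegrable_Kern_s.
have F := cfubini cK; rewrite /= in F.
rewrite F; apply: ae_eq_cint.
- exact: (cmeasurable_cint mu (cmeasurable_swap (cintegrable_measurable cK))).
- have mh : cmeasurable (dualfun (e k) : RR -> _) by case: (sqint_dualfun (se k)).
  exact: (cmeasurableM mh mphi).
apply: (ae_imp (cintegrable_ae2 cK)) => s /= csK.
(* Integrability of [Kern t s * (e k t)^*] in [t] is known only after multiplication by [phi s]; it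
   is recovered by division where [phi s] is nonzero. *)
have [->|ps] := eqVneq (phi s) 0.
  by rewrite mulr0 -[RHS](cint0 mu); apply: eq_cint => t; rewrite !mulr0.
rewrite /dualfun -cintZr; first by apply: eq_cint => t; ring.
apply: eq_cintegrable (cintegrableZ (phi s)^-1 csK) => t /=.
by rewrite mulrC -!mulrA mulfV ?mulr1.
Qed.

Hypothesis he : forall phi, sqint mu phi -> exists c : 'I_m -> R[i],
    {ae mu, forall t, weyl f phi t = \sum_(k < m) c k * e k t}.

(** The exceptional null set in [he] depends on [phi]; with the indicators of countably many cells
    as test functions, one null set serves for all. *)
Let Kern_grid : {ae mu, forall t, forall jn : int * nat,
  cintegral mu (fun s => cindic (grid jn.1 jn.2) s * Kern t s) =
  \sum_(k < m) cintegral mu (fun s => dualfun (e k) s * cindic (grid jn.1 jn.2) s) * e k t}.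
Proof.
apply: ae_forall_count => -[j q] /=; set phi := cindic _.
have sphi : sqint mu phi by exact: sqint_cindic_itv.
have phi1 s : normc (phi s) <= 1 by exact: normc_cindic_le1.
have [c hc] := he sphi.
have cE := weyl_coef sphi phi1 hc.
apply: (ae_imp hc) => t ht; transitivity (weyl f phi t).
  rewrite weyl_kern//; last by case: sphi.
  by apply: eq_cint => s; rewrite mulrC.
by rewrite ht; apply: eq_bigr => k _; rewrite cE.
Qed.

(* Both sides have the same integral over every cell of the grids [grid k n]; these are
   countably many conditions on [t], so Lebesgue differentiation in [s] applies. *)
Lemma Kern_factor : {ae mu, forall t, {ae mu, forall s,
  Kern t s = \sum_(k < m) e k t * dualfun (e k) s}}.
Proof.
apply: (ae_imp Kern_grid) => t ht.
have sh k : sqint mu (dualfun (e k)) by exact: sqint_dualfun.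
have cKt := cintegrable_Kern_s t.
pose G (s : R) := \sum_(k < m) e k t * dualfun (e k) s.
have sG : sqint mu G by exact: sqint_lincomb.
have ciK a b : cintegrable mu (fun s => cindic `[a, b[ s * Kern t s).
  apply: (cintegrableM_bounded (M := 1)) => //.
    by apply: cmeasurable_cindic; exact: measurable_itv.
  by move=> s; exact: normc_cindic_le1.
have ciG a b : cintegrable mu (fun s => cindic `[a, b[ s * G s).
  by apply: sqintM => //; exact: sqint_cindic_itv.
have dE (A : set R) s : cindic A s * (Kern t s + -1 * G s) = cindic A s * Kern t s + -1 * (cindic A s * G s).
  by ring.
suff h0 : {ae mu, forall s, Kern t s + -1 * G s = 0}.
  by apply: (ae_imp h0) => s /eqP; rewrite mulN1r subr_eq0 => /eqP.
apply: cgrid_eq0.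
- apply: cmeasurableD; first exact: cintegrable_measurable cKt.
  by apply: cmeasurableZ; case: sG.
- move=> a b; apply: (eq_cintegrable (f := fun s : RR => cindic `[a, b[ s * Kern t s + -1 * (cindic `[a, b[ s * G s))).
    by move=> s; rewrite dE.
  by apply: cintegrableD => //; exact: cintegrableZ.
- move=> j q; rewrite (eq_cint mu (dE (grid j q))).
  rewrite cintD; [|exact: ciK|exact/cintegrableZ/ciG].
  rewrite cintZ; last exact: ciG.
  have /= -> := ht (j, q).
  rewrite [X in -1 * X](_ : _ =
    \sum_(k < m) cintegral mu (fun s => dualfun (e k) s * cindic (grid j q) s) * e k t).
    by rewrite mulN1r subrr.
  have chk k : cintegrable mu (fun s => dualfun (e k) s * cindic (grid j q) s).
    by apply: sqintM => //; exact: sqint_cindic_itv.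
  transitivity (cintegral mu (fun s => \sum_(k < m) (dualfun (e k) s * cindic (grid j q) s) * e k t)).
    by apply: eq_cint => s; rewrite /G mulr_sumr; apply: eq_bigr => k _; ring.
  rewrite cint_sum; last first.
    move=> k _; apply: eq_cintegrable (cintegrableZ (e k t) (chk k)) => s /=.
    by rewrite mulrC.
  by apply: eq_bigr => k _; rewrite cintZr.
Qed.

(** For fixed [t], a translation turns almost every [s] into almost every [x]; exchanging the
    quantifiers then requires joint measurability of the relation. *)
Lemma kern_factor : {ae mu, forall x, {ae mu, forall t,
  kern f t x = \sum_(k < m) e k t * dualfun (e k) (t + x)}}.
Proof.
pose P (z : RR * RR) := kern f z.1 z.2 = \sum_(k < m) e k z.1 * dualfun (e k) (z.1 + z.2).
have mP : measurable [set z : RR * RR | P z].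
  pose D (z : RR * RR) := kern f z.1 z.2 + -1 * \sum_(k < m) e k z.1 * dualfun (e k) (z.1 + z.2).
  have mD : cmeasurable D.
    apply: cmeasurableD; first exact: cmeasurable_kern.
    apply: cmeasurableZ; apply: cmeasurable_sum => k _; apply: cmeasurableM.
      apply: (cmeasurable_comp (f := (e k : RR -> _)) (u := fst)); first by case: (se k).
      exact: measurable_fst.
    apply: (cmeasurable_comp (f := (dualfun (e k) : RR -> _)) (u := fun z : RR * RR => z.1 + z.2)).
      by case: (sqint_dualfun (se k)).
    by apply: measurable_funD; [exact: measurable_fst|exact: measurable_snd].
  rewrite (_ : [set z | P z] = [set z | D z = 0]); first exact: cmeasurable_eq0.
  apply/seteqP; split => z; rewrite /P /D /=.
    by move=> ->; rewrite mulN1r subrr.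
  by move=> /eqP; rewrite mulN1r subr_eq0 => /eqP.
have sw := ae_swap mu mu mP.
apply: sw.1; apply: (ae_imp Kern_factor) => t ht.
apply: (ae_imp (ae_mpres (mpres_addr t) ht)) => x.
rewrite /Kern addrK /P /= => ->.
by apply: eq_bigr => k _; rewrite (addrC t).
Qed.

End Factor.

End Kernel.

(** * The dimension bound *)

Section CharactersIndependent.
Context (R : realType).
Local Notation mu := (@lebesgue_measure R).
Local Notation RR := (measurableTypeR R).

(** [cos d = 1] forces [sin (d / 2) = 0], which is excluded when [|d| / 2] lies strictly between 0
    and [pi]. *)
Lemma cexpi_inj_lt (a b : R) : `|a - b| < 2 * pi -> cexpi a = cexpi b -> a = b.
Proof.
move=> ab eab; apply/eqP; rewrite -subr_eq0; apply/negPn/negP => d0.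
set d := a - b in ab d0.
have : cexpi d = 1.
  by rewrite /d cexpiD cexpiN eab -nsqE nsq_cexpi.
move=> /(congr1 (@complex.Re R)) /= cd.
have s0 : sin (d / 2) = 0.
  have d2 : (d / 2) *+ 2 = d by rewrite -mulr_natr divfK.
  have := cos_mulr2n (d / 2); rewrite d2 cd => h.
  apply/eqP; rewrite -sqrf_eq0 sin2cos2; apply/eqP.
  by move: h; rewrite -[_ *+ 2]mulr_natr; lra.
have : 0 < sin (`|d| / 2).
  apply: sin_gt0_pi; rewrite divr_gt0 ?normr_gt0//=; lra.
have [d1|d1] := leP 0 d.
  by rewrite ger0_norm// s0 ltxx.
by rewrite ltr0_norm// mulNr sinN s0 oppr0 ltxx.
Qed.

Lemma ae_neq (x : R) : {ae mu, forall z : RR, z <> x}.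
Proof.
exists [set x]; split; [exact: measurable_set1|exact: lebesgue_measure_set1|].
by move=> z /= /notP.
Qed.

(** Each of the countably many half-open periods of length [T] contains at most one solution of
    [cexpi (th * s) = z]. *)
Lemma ae_cexpi_neq (th : R) (z : R[i]) : 0 < th -> {ae mu, forall s : RR, cexpi (th * s) <> z}.
Proof.
move=> th0.
have pi0 := pi_gt0 R.
pose T : R := 2 * pi / th.
have T0 : 0 < T by rewrite divr_gt0// mulr_gt0.
have key (k : int) : {ae mu, forall s : RR, k%:~R * T <= s < (k%:~R + 1) * T -> cexpi (th * s) <> z}.
  have [[s0 [h0 e0]]|nex] := pselect (exists s0 : R, k%:~R * T <= s0 < (k%:~R + 1) * T /\ cexpi (th * s0) = z).
    apply: (ae_imp (ae_neq s0)) => s ss0 hs es; apply: ss0.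
    apply: (mulfI (lt0r_neq0 th0)); apply: cexpi_inj_lt; last by rewrite es e0.
    rewrite -mulrBr normrM (gtr0_norm th0).
    have -> : 2 * pi = th * T by rewrite /T [RHS]mulrC divfK// gt_eqF.
    rewrite ltr_pM2l// ltr_norml.
    move: h0 hs => /andP[? ?] /andP[? ?]; apply/andP; split; lra.
  by apply: aeW => s hs es; apply: nex; exists s.
apply: (ae_imp (ae_forall_count key)) => s hs.
apply: (hs (Num.floor (s / T))).
rewrite -ler_pdivlMr// -ltr_pdivrMr// floor_le /=.
by have := floorD1_gt (s / T); rewrite intrD.
Qed.

(* A nontrivial combination of the characters is a nonzero polynomial in [cexpi (th * s)], and
   each of its finitely many roots is attained on a null set only. *)
Lemma characters_free (th : R) N (c : 'I_N -> R[i]) (g : R -> R[i]) : 0 < th ->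
  {ae mu, forall s, \sum_(j < N) c j * (cexpi (j%:R * th * s) * g s) = 0} ->
  (exists j, c j != 0) -> {ae mu, forall s, g s = 0}.
Proof.
move=> th0 h0 [j0 cj0].
pose P : {poly R[i]} := \poly_(j < N) (if insub j is Some i then c i else 0).
have Pn0 : P != 0.
  apply/eqP => /polyP/(_ j0); rewrite coef_poly ltn_ord coef0 valK => /eqP.
  by rewrite (negbTE cj0).
have [rs Prs] := closed_field_poly_normal P.
have nr : {ae mu, forall s : RR, forall i : 'I_(size rs), cexpi (th * s) <> rs`_i}.
  by apply: ae_forall_fin => i; exact: ae_cexpi_neq.
apply: (ae_imp2 h0 nr) => s hs hrs.
have : P.[cexpi (th * s)] * g s = 0.
  rewrite -hs horner_poly mulr_suml; apply: eq_bigr => j _.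
  rewrite valK cexpiX (_ : th * s *+ j = j%:R * th * s); first by rewrite mulrA.
  by rewrite -mulr_natl mulrA.
move=> /eqP; rewrite mulf_eq0 => /orP[|/eqP //].
rewrite Prs hornerZ mulf_eq0 lead_coef_eq0 (negbTE Pn0) /= => r.
exfalso; move: r; rewrite -[_ == 0]/(root _ _) root_prod_XsubC => /(nthP 0)[i si ei].
exact: (hrs (Ordinal si)).
Qed.

End CharactersIndependent.

Section MainInequality.
Context (R : realType).
Local Notation mu := (@lebesgue_measure R).
Local Notation RR := (measurableTypeR R).
Local Notation mu2 := (mu \x mu)%E.
Variable f : R * R -> R[i].
Hypothesis cf : cintegrable mu2 f.

Let mf : cmeasurable (f : RR * RR -> _).
Proof. exact: cintegrable_measurable cf. Qed.

Lemma fourier_slice x t : fourier (fun y => f (x, y) * cexpi (pi * (x * y))) t = kern f t x.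
Proof.
apply: eq_cint => y; rewrite -mulrA -cexpiD; congr (_ * cexpi _); ring.
Qed.

Section TwistedTranslates.
Variables (N : nat) (dl : R) (c : 'I_N -> R[i]).

Definition trigpoly (s : R) : R[i] := \sum_(j < N) c j * cexpi (j%:R * (2 * pi * dl) * s).

(* Twisted translates of [f] by [(0, j * dl)], with phases chosen so that on the Fourier side
   they multiply [kern f t x] by characters of [t + x] (see [fourier_twist_slice]). *)
Definition twist (x y : R) : R[i] :=
  \sum_(j < N) c j * (cexpi (pi * (j%:R * dl) * x) * f (x, y - j%:R * dl)).

Lemma cmeasurable_trigpoly : cmeasurable (trigpoly : RR -> _).
Proof.
apply: cmeasurable_sum => j _; apply: cmeasurableZ; apply: cmeasurable_cexpi.
by apply: measurable_funM => //; exact: measurable_cst.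
Qed.

Lemma normc_trigpoly s : normc (trigpoly s) <= \sum_(j < N) normc (c j).
Proof.
rewrite /trigpoly; elim/big_rec2 : _ => [|j y z _ h]; first by rewrite normc0.
by rewrite (le_trans (le_normcD _ _))// lerD// normcM normc_cexpi mulr1.
Qed.

Variable x : R.
Hypothesis cfx : cintegrable mu (fun y => f (x, y)).

Let cterm j t : cintegrable mu (fun y => cexpi (pi * (j%:R * dl) * x) * f (x, y - j%:R * dl) * cexpi (pi * (x * y)) * cexpi (2 * pi * (y * t))).
Proof.
have c1 : cintegrable mu (fun y => f (x, y - j%:R * dl)).
  exact: (cintegrable_mpres (mpres_addr (- (j%:R * dl))) cfx).
apply: (cintegrable_phase (u := fun y => cexpi (pi * (j%:R * dl) * x) * f (x, y - j%:R * dl) * cexpi (pi * (x * y)))).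
apply: (eq_cintegrable (f := fun y : RR => cexpi (pi * (x * y)) * (cexpi (pi * (j%:R * dl) * x) * f (x, y - j%:R * dl)))).
  by move=> y; ring.
apply: (cintegrableM_bounded (M := 1)).
- apply: cmeasurable_cexpi; apply: measurable_funM; first exact: measurable_cst.
  by apply: measurable_funM => //; exact: measurable_cst.
- by move=> y; rewrite normc_cexpi.
- exact: cintegrableZ.
Qed.

Definition twist_slice (y : R) : R[i] := twist x y * cexpi (pi * (x * y)).

Let slice_sum t y : twist_slice y * cexpi (2 * pi * (y * t)) =
  \sum_(j < N) c j * (cexpi (pi * (j%:R * dl) * x) * f (x, y - j%:R * dl) * cexpi (pi * (x * y)) * cexpi (2 * pi * (y * t))).
Proof.
by rewrite /twist_slice /twist !mulr_suml; apply: eq_bigr => j _; ring.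
Qed.

Lemma cintegrable_twist_slice : cintegrable mu twist_slice.
Proof.
have h : cintegrable mu (fun y => twist_slice y * cexpi (2 * pi * (y * 0))).
  have -> : (fun y : RR => twist_slice y * cexpi (2 * pi * (y * 0))) =
    (fun y => \sum_(j < N) c j * (cexpi (pi * (j%:R * dl) * x) * f (x, y - j%:R * dl) *
       cexpi (pi * (x * y)) * cexpi (2 * pi * (y * 0)))).
    by apply/funext => y; exact: slice_sum.
  by apply: cintegrable_sum => j _; exact: cintegrableZ.
by apply: eq_cintegrable h => y; rewrite !mulr0 cexpi0 mulr1.
Qed.

Lemma fourier_twist_slice t : fourier twist_slice t = trigpoly (t + x) * kern f t x.
Proof.
rewrite /fourier (eq_cint mu (slice_sum t)) cint_sum; last first.
  by move=> j _; exact: cintegrableZ.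
rewrite /trigpoly mulr_suml; apply: eq_bigr => j _.
rewrite cintZ// -[RHS]mulrA; congr (_ * _).
set b : R := j%:R * dl.
pose F (y : RR) := cexpi (pi * b * x) * f (x, y - b) * cexpi (pi * (x * y)) * cexpi (2 * pi * (y * t)).
transitivity (cintegral mu (fun y => F (y + b))).
  apply/esym/(cint_mpres (mpres_addr b)); exact: cintegrable_measurable (cterm j t).
rewrite /F; transitivity (cintegral mu (fun y => cexpi (j%:R * (2 * pi * dl) * (t + x)) * (f (x, y) * cexpi (pi * (x * y + 2 * y * t))))).
  (* The shift by [b] releases [exp(pi i b x)] from the Weyl phase and [exp(2 pi i b t)] from the
     Fourier phase; with the twist they form [exp(2 pi i b (t + x))]. *)
  apply: eq_cint => y; rewrite addrK.
  rewrite [RHS]mulrCA -cexpiD -!mulrA [LHS]mulrCA -!cexpiD; congr (_ * cexpi _).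
  by rewrite /b; ring.
rewrite cintZ//.
apply: (eq_cintegrable (f := fun y : RR => cexpi (pi * (x * y + 2 * y * t)) * f (x, y))).
  by move=> y; rewrite mulrC.
apply: (cintegrableM_bounded (M := 1)) => //; first exact: cmeasurable_phase_y.
by move=> y; rewrite normc_cexpi.
Qed.

Lemma nsq_twist_slice y : nsq (twist_slice y) = nsq (twist x y).
Proof. by rewrite /twist_slice nsqM nsq_cexpi mulr1. Qed.

Lemma twist_support y :
  ~ (\bigcup_(j in [set j | (j < N)%N]) vshift (j%:R * dl) [set w | f w != 0]) (x, y) ->
  twist x y = 0.
Proof.
move=> h; rewrite /twist big1// => j _.
have [->|fj] := eqVneq (f (x, y - j%:R * dl)) 0; first by rewrite !mulr0.
by exfalso; apply: h; exists j => //=; exact: ltn_ord.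
Qed.

End TwistedTranslates.

(** When [h] is the dual family, this is the squared [L^2] norm in [t] of the kernel at [s], by
    [int_e_h]. *)
Definition weight m (h : 'I_m -> R -> R[i]) (s : R) : R := \sum_(k < m) nsq (h k s).

(** Multiplication by this function embeds the space weighted by [weight h] into the unweighted one,
    so that [ip] and [bessel] apply. *)
Definition sqrt_weight m (h : 'I_m -> R -> R[i]) (s : R) : R[i] := ((Num.sqrt (weight h s))%:C)%C.

Section Bound.
Variables (m : nat) (e h : 'I_m -> R -> R[i]).
Hypotheses (se : forall k, sqint mu (e k)) (oe : orthonormal_fam mu e)
  (sh : forall k, sqint mu (h k)).
Hypothesis KE : {ae mu, forall t, {ae mu, forall s, Kern f t s = \sum_(k < m) e k t * h k s}}.
Hypothesis kE : {ae mu, forall x, {ae mu, forall t, kern f t x = \sum_(k < m) e k t * h k (t + x)}}.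

Local Notation w := (weight h).
Local Notation rw := (sqrt_weight h).

Let w_ge0 s : 0 <= w s.
Proof. by apply: sumr_ge0 => k _; exact: nsq_ge0. Qed.

Let mw : measurable_fun setT (w : RR -> R).
Proof. by apply: measurable_sum => k; apply: measurable_nsq; case: (sh k). Qed.

Let iw : mu.-integrable setT (fun s => (w s)%:E).
Proof.
rewrite /weight; under eq_fun do rewrite -sumEFin.
by apply: integrable_sum => // k _; exact: sqint_integrable.
Qed.

Lemma nsq_sqrt_weight s : nsq (rw s) = w s.
Proof. by rewrite /nsq /sqrt_weight /= expr0n addr0 sqr_sqrtr. Qed.

Let mrw : cmeasurable (rw : RR -> _).
Proof.
apply: cmeasurable_real; apply: (measurableT_comp (f := @Num.sqrt R)) mw.
by apply: continuous_measurable_fun; exact: sqrt_continuous.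
Qed.

Lemma sqint_sqrt_weight : sqint mu rw.
Proof.
split => //; under eq_integral do rewrite nsq_sqrt_weight.
exact: integrable_lty iw.
Qed.

Let int_e_h s : (\int[mu]_t (nsq (\sum_(k < m) e k t * h k s))%:E = (w s)%:E)%E.
Proof.
pose G t := \sum_(k < m) h k s * e k t.
have sG : sqint mu G by exact: sqint_lincomb.
transitivity (\int[mu]_t (nsq (G t))%:E)%E.
  by apply: eq_integral => t _; congr (nsq _)%:E; apply: eq_bigr => k _; rewrite mulrC.
have : ip mu G G = ((w s)%:C)%C.
  rewrite ip_suml// /weight rmorph_sum; apply: eq_bigr => k _.
  rewrite ip_sumr// (bigD1 k)//= oe eqxx mulr1 big1 ?addr0 -?nsqE//.
  by move=> l lk; rewrite oe eq_sym (negbTE lk) mulr0.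
rewrite ip_nsq => -[] <-; rewrite /Rintegral fineK//.
exact: integrable_fin_num (sqint_integrable sG).
Qed.

(** With [s = t + x] the integrand becomes [|p(s) K(t, s)|^2]; integrating in [t] first,
    orthonormality of the [e k] leaves [|p(s)|^2 w(s)]. *)
Lemma energy (p : R -> R[i]) : cmeasurable (p : RR -> _) ->
  (\int[mu]_x \int[mu]_t (nsq (p (t + x) * kern f t x))%:E = \int[mu]_s (nsq (p s * rw s))%:E)%E.
Proof.
move=> mp.
have mk2 : cmeasurable (fun z : RR * RR => p (z.1 + z.2) * kern f z.1 z.2).
  apply: cmeasurableM; last exact: cmeasurable_kern.
  apply: (cmeasurable_comp mp (u := fun z : RR * RR => z.1 + z.2)).
  by apply: measurable_funD; [exact: measurable_fst|exact: measurable_snd].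
rewrite -(fubini_tonelli (fun z : RR * RR => (nsq (p (z.1 + z.2) * kern f z.1 z.2))%:E))//=; last 2 first.
- exact/measurable_EFinP/measurable_nsq.
- by move=> z; rewrite lee_fin nsq_ge0.
pose G (z : RR * RR) := p z.2 * \sum_(k < m) e k z.1 * h k z.2.
have mG : cmeasurable G.
  apply: cmeasurableM; first by apply: (cmeasurable_comp mp); exact: measurable_snd.
  apply: cmeasurable_sum => k _; apply: cmeasurableM.
    by apply: (cmeasurable_comp (f := e k : RR -> _) (u := fst)); [case: (se k)|exact: measurable_fst].
  by apply: (cmeasurable_comp (f := h k : RR -> _) (u := snd)); [case: (sh k)|exact: measurable_snd].
have mGe : measurable_fun setT (fun z => (nsq (G z))%:E) by exact/measurable_EFinP/measurable_nsq.
transitivity (\int[mu]_t \int[mu]_s (nsq (G (t, s)))%:E)%E.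
  apply: ge0_ae_eq_integral => //.
  - apply: (measurable_fun_fubini_tonelli_F (fun z : RR * RR => (nsq (p (z.1 + z.2) * kern f z.1 z.2))%:E)) => //.
      exact/measurable_EFinP/measurable_nsq.
    by move=> z; rewrite lee_fin nsq_ge0.
  - apply: (measurable_fun_fubini_tonelli_F (fun z => (nsq (G z))%:E)) => //.
    by move=> z; rewrite lee_fin nsq_ge0.
  - by move=> t _; apply: integral_ge0 => x _; rewrite lee_fin nsq_ge0.
  - by move=> t _; apply: integral_ge0 => x _; rewrite lee_fin nsq_ge0.
  apply: (ae_imp KE) => t ht _.
  pose H (s : RR) := (nsq (p s * Kern f t s))%:E.
  have mpK : cmeasurable (fun s : RR => p s * Kern f t s).
    apply: cmeasurableM => //.
    exact: (cmeasurable_pair2 (f := fun z : RR * RR => Kern f z.1 z.2) t (cmeasurable_Kern cf)).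
  have mH : measurable_fun setT H by exact/measurable_EFinP/measurable_nsq.
  transitivity (\int[mu]_x H (x + t)%R)%E.
    by apply: eq_integral => x _; rewrite /H /Kern addrK (addrC t).
  rewrite (ge0_integral_mpres (mpres_addr t) mH); last by move=> s; rewrite lee_fin nsq_ge0.
  apply: ge0_ae_eq_integral => //.
  - exact: (measurableT_comp mGe (measurable_pair1 (t : RR))).
  - by move=> s _; rewrite lee_fin nsq_ge0.
  - by move=> s _; rewrite lee_fin nsq_ge0.
  by apply: (ae_imp ht) => s hs _; rewrite /H hs.
rewrite (fubini_tonelli (fun z => (nsq (G z))%:E))//=; last first.
  by move=> z; rewrite lee_fin nsq_ge0.
apply: eq_integral => s _; rewrite nsqM nsq_sqrt_weight EFinM -int_e_h.
rewrite -ge0_integralZl_EFin ?nsq_ge0//; last 2 first.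
- by move=> t _; rewrite lee_fin nsq_ge0.
- apply/measurable_EFinP/measurable_nsq; apply: cmeasurable_sum => k _.
  by under eq_fun do rewrite mulrC; apply: cmeasurableZ; case: (se k).
by apply: eq_integral => t _; rewrite /G nsqM EFinM.
Qed.

Let fin_kern_slice : {ae mu, forall x, cintegrable mu (fun t => kern f t x)}.
Proof.
apply: (ae_imp kE) => x hx.
apply: (ae_eq_cintegrable (f := fun t : RR => \sum_(k < m) e k t * h k (t + x))).
- exact: (cmeasurable_pair1 (f := fun z : RR * RR => kern f z.1 z.2) x (cmeasurable_kern cf)).
- by apply: (ae_imp hx) => t ->.
- apply: cintegrable_sum => k _; apply: sqintM => //.
  split.
    apply: (cmeasurable_comp (f := h k : RR -> _) (u := fun t : RR => t + x)); first by case: (sh k).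
    by case: (mpres_addr x).
  rewrite (ge0_integral_mpres (mpres_addr x) (f := fun s : RR => (nsq (h k s))%:E)).
  + by case: (sh k).
  + by apply/measurable_EFinP/measurable_nsq; case: (sh k).
  + by move=> s; rewrite lee_fin nsq_ge0.
Qed.

Let slice_f : {ae mu, forall x, cintegrable mu (fun y => f (x, y))}.
Proof. exact: (cintegrable_ae1 cf). Qed.

(** Every [h k] vanishes where the weight does, so almost every slice has a transform that is zero
    almost everywhere. Such a transform is integrable, and [plancherel] then plays the part of the
    uniqueness theorem. *)
Lemma kernel_weight_eq0 : {ae mu, forall s, w s = 0} -> {ae mu2, forall z, f z = 0}.
Proof.
move=> w0; have mP : measurable [set z : RR * RR | f z = 0] by exact: cmeasurable_eq0.
have ap := ae_prod1 mu mu (P := fun z : RR * RR => f z = 0) mP.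
apply: ap.2.
have : {ae mu, forall x, {ae mu, forall t, kern f t x = 0}}.
  apply: (ae_imp kE) => x hx.
  apply: (ae_imp2 hx (ae_mpres (mpres_addr x) w0)) => t -> wtx.
  rewrite big1// => k _; suff -> : h k (t + x) = 0 by rewrite mulr0.
  apply: nsq_eq0; apply/eqP; move/eqP: wtx.
  by rewrite psumr_eq0 => [/allP/(_ k)|i _]; [rewrite mem_index_enum => /(_ isT)|exact: nsq_ge0].
move=> k0; apply: (ae_imp2 k0 slice_f) => x kx fx.
pose u (y : RR) := f (x, y) * cexpi (pi * (x * y)).
have cu : cintegrable mu u.
  apply: (eq_cintegrable (f := fun y : RR => cexpi (pi * (x * y)) * f (x, y))).
    by move=> y; rewrite mulrC.
  apply: (cintegrableM_bounded (M := 1)) => //.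
  - apply: cmeasurable_cexpi; apply: measurable_funM; first exact: measurable_cst.
    by apply: measurable_funM => //; exact: measurable_cst.
  - by move=> y; rewrite normc_cexpi.
have fu0 : {ae mu, forall t, fourier u t = 0}.
  by apply: (ae_imp kx) => t <-; exact: fourier_slice.
have mfu : cmeasurable (fourier u : RR -> _).
  exact: cmeasurable_fourier (cintegrable_measurable cu).
have cfu : cintegrable mu (fourier u).
  apply: (ae_eq_cintegrable (f := fun=> 0)) => //; last exact: cintegrable0.
  by apply: (ae_imp fu0) => t ->.
have p := plancherel cu cfu.
have : (\int[mu]_y (nsq (u y))%:E = 0)%E.
  rewrite -p; apply/(ae_ge0_integral0 mu).
  - exact/measurable_EFinP/measurable_nsq.
  - by move=> t; rewrite lee_fin nsq_ge0.
  - by apply: (ae_imp fu0) => t ->; rewrite nsq0.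
move=> /(ae_ge0_integral0 mu _ _).1 u0.
apply: (ae_imp (u0 _ _)).
- by apply/measurable_EFinP/measurable_nsq; exact: cintegrable_measurable cu.
- by move=> t; rewrite lee_fin nsq_ge0.
move=> y [] /nsq_eq0 /eqP; rewrite mulf_eq0 => /orP[/eqP//|].
by rewrite (negbTE (cexpi_neq0 _)).
Qed.

Variables (N : nat) (dl : R) (M : 'M[R[i]]_N).
Let p (j : 'I_N) : R -> R[i] := trigpoly dl (fun l => M j l).
Hypothesis op : orthonormal_fam mu (fun j s => p j s * rw s).

Let E' := \bigcup_(j in [set j | (j < N)%N]) vshift (j%:R * dl) [set z : RR * RR | f z != 0].

Let mE : measurable [set z : RR * RR | f z != 0].
Proof.
rewrite (_ : [set z | _] = ~` [set z | f z = 0]); last first.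
  by apply/seteqP; split => z /= /eqP.
by apply: measurableC; exact: cmeasurable_eq0.
Qed.

Let mE' : measurable E'.
Proof. by apply: bigcup_measurable => j _; exact: measurable_vshift. Qed.

Let mp j : cmeasurable (p j : RR -> _).
Proof. exact: cmeasurable_trigpoly. Qed.

Let sp j : sqint mu (fun s => p j s * rw s).
Proof.
apply: (sqintM_bounded (M := (\sum_(l < N) normc (M j l)) ^+ 2)) => //; last exact: sqint_sqrt_weight.
move=> s; rewrite -sqr_normcE ler_pXn2r ?nnegrE ?normc_ge0//; first exact: normc_trigpoly.
by apply: sumr_ge0 => l _; exact: normc_ge0.
Qed.

(* Where [w s = 0] the inverse is 0, which is harmless since all [h k s] vanish there. *)
Let Psi (x y s : R) : R[i] := (((Num.sqrt (w s))^-1)%:C)%C *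
  \sum_(k < m) (e k (s - x) * cexpi (- (2 * pi * (y * (s - x))))) * h k s.

Let mPsi x y : cmeasurable (Psi x y : RR -> _).
Proof.
apply: cmeasurableM.
  apply: cmeasurable_real.
  (* Written as a real power, the inverse is a measurable function of the root, including its value
     0 at 0. *)
  have -> : (fun s => (Num.sqrt (w s))^-1) = (fun s => powR (Num.sqrt (w s)) (-1)).
    by apply/funext => s; rewrite powRN powRr1// sqrtr_ge0.
  apply: (measurableT_comp (f := fun a : R => powR a (-1))); first exact: measurable_powR.
  apply: (measurableT_comp (f := @Num.sqrt R)) mw.
  by apply: continuous_measurable_fun; exact: sqrt_continuous.
apply: cmeasurable_sum => k _; apply: cmeasurableM; last by case: (sh k).
have msx : measurable_fun setT (fun s : RR => s - x) by case: (mpres_addr (- x)).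
apply: cmeasurableM.
  by apply: (cmeasurable_comp (f := e k : RR -> _) (u := fun s : RR => s - x)); [case: (se k)|].
apply: cmeasurable_cexpi; apply: measurable_funN; apply: measurable_funM; first exact: measurable_cst.
by apply: measurable_funM => //; exact: measurable_cst.
Qed.

(** After multiplication by [p j s], the right-hand side is the integrand of Fourier inversion at
    [y] on the slice over [x], with [s = t + x]. The value of the [j]-th twist is thus a pairing
    with [Psi x y], which does not depend on [j]. *)
Let rw_Psi x y s : rw s * Psi x y s =
  \sum_(k < m) (e k (s - x) * cexpi (- (2 * pi * (y * (s - x))))) * h k s.
Proof.
rewrite /Psi /sqrt_weight [LHS]mulrA.
have -> : ((Num.sqrt (w s))%:C)%C * (((Num.sqrt (w s))^-1)%:C)%C =
    ((Num.sqrt (w s) * (Num.sqrt (w s))^-1)%:C)%C by rewrite rmorphM.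
have [w0|w0] := eqVneq (w s) 0.
  rewrite w0 sqrtr0 mul0r mul0r big1// => k _; suff -> : h k s = 0 by rewrite mulr0.
  apply: nsq_eq0; apply/eqP; move/eqP: w0.
  by rewrite psumr_eq0 => [/allP/(_ k)|i _]; [rewrite mem_index_enum => /(_ isT)|exact: nsq_ge0].
rewrite divff ?mul1r// sqrtr_eq0 -ltNge lt_neqAle eq_sym w0; exact: w_ge0.
Qed.

Let mex x k : cmeasurable (fun s : RR => e k (s - x)).
Proof.
apply: (cmeasurable_comp (f := e k : RR -> _) (u := fun s : RR => s - x)); first by case: (se k).
by case: (mpres_addr (- x)).
Qed.

(** Cauchy-Schwarz in [k] produces the factor [w s], which cancels against the normalization of
    [Psi]. *)
Let nsq_Psi_le x y s : nsq (Psi x y s) <= \sum_(k < m) nsq (e k (s - x)).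
Proof.
rewrite /Psi nsqM.
have := nsq_sum_mul (fun k => e k (s - x) * cexpi (- (2 * pi * (y * (s - x))))) (fun k => h k s).
under [X in _ <= X * _ -> _]eq_bigr do rewrite nsqM nsq_cexpi mulr1.
rewrite -/(w s) => CS.
have S0 : 0 <= \sum_(k < m) nsq (e k (s - x)) by apply: sumr_ge0 => k _; exact: nsq_ge0.
have nI : nsq (((Num.sqrt (w s))^-1)%:C)%C = (w s)^-1.
  by rewrite /nsq /= expr0n addr0 exprVn sqr_sqrtr.
rewrite nI; have [w0|w0] := eqVneq (w s) 0; first by rewrite w0 invr0 mul0r.
have wp : 0 < w s by rewrite lt_neqAle eq_sym w0 w_ge0.
by rewrite mulrC ler_pdivrMr.
Qed.

Let int_e k : (\int[mu]_s (nsq (e k s))%:E = 1)%E.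
Proof.
have := oe k k; rewrite eqxx ip_nsq => -[] h1.
rewrite -[LHS]fineK; last exact: integrable_fin_num (sqint_integrable (se k)).
by congr _%:E.
Qed.

(** The rank enters here: [m] counts the functions [e k], whose translates all have norm 1. *)
Let int_nsq_Psi x y : (\int[mu]_s (nsq (Psi x y s))%:E <= m%:R%:E)%E.
Proof.
apply: (@le_trans _ _ (\int[mu]_s (\sum_(k < m) (nsq (e k (s - x)))%:E))%E).
  apply: ge0_le_integral => //.
  - by move=> s _; rewrite lee_fin nsq_ge0.
  - exact/measurable_EFinP/measurable_nsq.
  - by apply: emeasurable_sum => k; exact/measurable_EFinP/measurable_nsq.
  - by move=> s _; rewrite sumEFin lee_fin.
rewrite ge0_integral_sum//; last 2 first.
- by move=> k; exact/measurable_EFinP/measurable_nsq.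
- by move=> k s _; rewrite lee_fin nsq_ge0.
rewrite (eq_bigr (fun=> 1%E)).
  by rewrite sumEFin sumr_const card_ord.
move=> k _; rewrite -(int_e k).
apply: (ge0_integral_mpres (mpres_addr (- x)) (f := fun s : RR => (nsq (e k s))%:E)).
- by apply/measurable_EFinP/measurable_nsq; case: (se k).
- by move=> s; rewrite lee_fin nsq_ge0.
Qed.

Let sPsi x y : sqint mu (Psi x y).
Proof. by split => //; rewrite (le_lt_trans (int_nsq_Psi x y))// ltry. Qed.

Let bessel_Psi x y : \sum_(j < N) nsq (cintegral mu (fun s => p j s * rw s * Psi x y s)) <= m%:R.
Proof.
apply: (le_trans (bessel sp op (sPsi x y))).
rewrite -lee_fin /Rintegral fineK//.
exact: integrable_fin_num (sqint_integrable (sPsi x y)).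
Qed.

(** Plancherel turns the left-hand side into the energy in [y] of the twisted slices [u j], whose
    pointwise values are accessible through inversion. *)
Let slice_bound x : cintegrable mu (fun y => f (x, y)) -> cintegrable mu (fun t => kern f t x) ->
  {ae mu, forall t, kern f t x = \sum_(k < m) e k t * h k (t + x)} ->
  (\sum_(j < N) \int[mu]_t (nsq (p j (t + x) * kern f t x))%:E <= m%:R%:E * mu (xsection E' x))%E.
Proof.
move=> cfx ckx hx.
pose u j := twist_slice dl (fun l => M j l) x.
have cu j : cintegrable mu (u j) by exact: cintegrable_twist_slice.
have fu j t : fourier (u j) t = p j (t + x) * kern f t x by exact: fourier_twist_slice.
have mpx j : cmeasurable (fun t : RR => p j (t + x)).
  by apply: (cmeasurable_comp (mp j) (u := fun t : RR => t + x)); case: (mpres_addr x).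
have cfu j : cintegrable mu (fourier (u j)).
  apply: (eq_cintegrable (f := fun t : RR => p j (t + x) * kern f t x)); first by move=> t; rewrite fu.
  apply: (cintegrableM_bounded (M := \sum_(l < N) normc (M j l))) => // t.
  exact: normc_trigpoly.
have ifu j y : ifourier (fourier (u j)) y = cintegral mu (fun s => p j s * rw s * Psi x y s).
  pose F (s : RR) := p j s * rw s * Psi x y s.
  have mF : cmeasurable F by apply: cmeasurableM; [apply: cmeasurableM|].
  rewrite -[RHS](cint_mpres (mpres_addr x) mF).
  apply: ae_eq_cint.
  - exact: cintegrable_measurable (cintegrable_iphase _ (cfu j)).
  - by apply: (cmeasurable_comp mF (u := fun t : RR => t + x)); case: (mpres_addr x).
  apply: (ae_imp hx) => t ht.
  rewrite fu ht /F -[RHS]mulrA rw_Psi addrK -!mulrA; congr (_ * _).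
  by rewrite mulr_suml; apply: eq_bigr => k _; ring.
have ub : {ae mu, forall y, (\sum_(j < N) (nsq (u j y))%:E <= m%:R%:E * (\1_(xsection E' x) y)%:E)%E}.
  have inv : {ae mu, forall y, forall j, u j y = ifourier (fourier (u j)) y}.
    by apply: ae_forall_fin => j; exact: fourier_inversion.
  apply: (ae_imp inv) => y hy; rewrite sumEFin -EFinM lee_fin.
  have [Ey|nEy] := pselect (E' (x, y)).
    rewrite indicE mem_set; last by rewrite /xsection /= inE.
    rewrite mulr1; apply: le_trans (bessel_Psi x y).
    by apply: ler_sum => j _; rewrite hy ifu.
  rewrite indicE memNset; last by rewrite /xsection /= inE.
  by rewrite mulr0 big1// => j _; rewrite /u nsq_twist_slice twist_support ?nsq0.
have mu_ j : cmeasurable (u j : RR -> _) by exact: cintegrable_measurable (cu j).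
have mx : measurable (xsection E' x : set RR) by exact: measurable_xsection.
have mI : measurable_fun setT (fun y : RR => (\1_(xsection E' x) y : R)%:E).
  exact/measurable_EFinP/measurable_indic.
rewrite (eq_bigr (fun j => \int[mu]_y (nsq (u j y))%:E)%E); last first.
  by move=> j _; rewrite -(plancherel (cu j) (cfu j)); apply: eq_integral => t _; rewrite fu.
rewrite -ge0_integral_sum//; last 2 first.
- by move=> j; exact/measurable_EFinP/measurable_nsq.
- by move=> j y _; rewrite lee_fin nsq_ge0.
apply: (@le_trans _ _ (\int[mu]_y (m%:R%:E * (\1_(xsection E' x) y)%:E))%E).
  apply: ae_ge0_le_integral => //.
  - by move=> y _; apply: sume_ge0 => j _; rewrite lee_fin nsq_ge0.
  - by apply: emeasurable_sum => j; exact/measurable_EFinP/measurable_nsq.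
  - exact: measurable_funeM.
  - by apply: (ae_imp ub) => y hy _.
by rewrite ge0_integralZl_EFin//= integral_indic// setIT.
Qed.

(* On the slice over [x], Bessel's inequality bounds the total squared modulus of the [N] twists
   by [m] pointwise on [E'] and it vanishes off [E']; the left-hand side is the energy
   of the [N] orthonormal functions [p j * rw]. *)
Lemma dimension_bound : (N%:R%:E <= m%:R%:E * mu2 E')%E.
Proof.
have -> : (N%:R%:E = \sum_(j < N) \int[mu]_s (nsq (p j s * rw s))%:E)%E.
  rewrite (eq_bigr (fun=> 1%E)); first by rewrite sumEFin sumr_const card_ord.
  move=> j _; have := op j j; rewrite eqxx ip_nsq => -[] h1.
  rewrite -[LHS]fineK; last exact: integrable_fin_num (sqint_integrable (sp j)).
  by congr _%:E.
under eq_bigr do rewrite -energy//.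
have mpk j : measurable_fun setT (fun z : RR * RR => (nsq (p j (z.2 + z.1) * kern f z.2 z.1))%:E).
  apply/measurable_EFinP/measurable_nsq; apply: cmeasurableM.
    apply: (cmeasurable_comp (mp j) (u := fun z : RR * RR => z.2 + z.1)).
    by apply: measurable_funD; [exact: measurable_snd|exact: measurable_fst].
  apply: (cmeasurable_comp (cmeasurable_kern cf) (u := fun z : RR * RR => (z.2, z.1))).
  by apply: measurable_fun_pair; [exact: measurable_snd|exact: measurable_fst].
have mI j : measurable_fun setT (fun x : RR => \int[mu]_t (nsq (p j (t + x) * kern f t x))%:E)%E.
  apply: (measurable_fun_fubini_tonelli_F (fun z : RR * RR => (nsq (p j (z.2 + z.1) * kern f z.2 z.1))%:E)) => //.
  by move=> z; rewrite lee_fin nsq_ge0.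
rewrite -ge0_integral_sum//; last first.
  by move=> j x _; apply: integral_ge0 => t _; rewrite lee_fin nsq_ge0.
have mX : measurable_fun setT (fun x : RR => mu (xsection E' x)) by exact: (measurable_fun_xsection mu mE').
rewrite -[X in (_ <= _ * X)%E]/(\int[mu]_x mu (xsection E' x))%E.
rewrite -ge0_integralZl_EFin//.
apply: ae_ge0_le_integral => //.
- move=> x _; apply: sume_ge0 => j _; apply: integral_ge0 => t _; by rewrite lee_fin nsq_ge0.
- exact: emeasurable_sum.
- by move=> x _; rewrite mule_ge0// lee_fin.
- exact: measurable_funeM.
apply: (ae_imp2 (ae_imp2 slice_f fin_kern_slice (fun x a b => conj a b)) kE) => x [a b] c _.
exact: slice_bound.
Qed.

End Bound.

End MainInequality.

(** * Choice of the parameters and the contradiction *)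

Section FiniteRankWeyl.
Context (R : realType).
Local Notation mu := (@lebesgue_measure R).
Local Notation RR := (measurableTypeR R).
Local Notation mu2 := (mu \x mu)%E.

Lemma finite_rank_weyl_eq0 (f : R * R -> R[i]) : cintegrable mu2 f ->
  (mu2 [set w | f w != 0%R] < +oo)%E -> finite_rank (weyl f) -> {ae mu2, forall w, f w = 0}.
Proof.
move=> cf supp_f Wf_finite_rank.
have mf : cmeasurable (f : RR * RR -> _) by exact: cintegrable_measurable cf.
have [m [e [se oe he]]] := finite_rank_orthonormal Wf_finite_rank.
pose h k := dualfun f (e k).
have sh k : sqint mu (h k) by exact: sqint_dualfun.
have KE := Kern_factor cf se oe he.
have kE := kern_factor cf se oe he.
pose w := weight h.
have [w0|wn0] := pselect {ae mu, forall s, w s = 0}.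
  exact: (kernel_weight_eq0 cf kE w0).
exfalso.
pose E := [set z : RR * RR | f z != 0].
have mE : measurable E.
  rewrite (_ : E = ~` [set z | f z = 0]); last by apply/seteqP; split => z /= /eqP.
  by apply: measurableC; exact: cmeasurable_eq0.
have Efin : mu2 E \is a fin_num by rewrite ge0_fin_numE.
(* [N] exceeds [m * (|E| + 1)] and is fixed before the spacing [dl], which depends on it. *)
pose N := (Num.truncn (m%:R * (fine (mu2 E) + 1) : R)).+1.
have [dl dl0 hdl] := union_vshift N mE supp_f.
pose rw := sqrt_weight h.
have nsq_rw s : nsq (rw s) = w s.
  exact: nsq_sqrt_weight.
have srw : sqint mu rw by exact: (sqint_sqrt_weight sh).
pose g (j : 'I_N) s := cexpi (j%:R * (2 * pi * dl) * s) * rw s.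
have sg j : sqint mu (g j).
  apply: (sqintM_bounded (M := 1)) => //.
    apply: cmeasurable_cexpi; apply: measurable_funM => //; exact: measurable_cst.
  by move=> s; rewrite nsq_cexpi.
(* The functions [g j] are independent: a nontrivial vanishing combination would make [rw], hence
   [w], zero almost everywhere. *)
have [|M oM] := orthonormalize_free sg.
  move=> c hc i; apply/eqP/negPn/negP => ci; apply: wn0.
  have th0 : 0 < 2 * pi * dl by rewrite !mulr_gt0// pi_gt0.
  apply: (ae_imp (characters_free th0 hc (ex_intro _ i ci))) => s rws0.
  by rewrite -nsq_rw rws0 nsq0.
have pE k s : trigpoly dl (fun l => M k l) s * rw s = \sum_(l < N) M k l * g l s.
  by rewrite /trigpoly mulr_suml; apply: eq_bigr => l _; rewrite -mulrA.
have op : orthonormal_fam mu (fun j s => trigpoly dl (fun l => M j l) s * rw s).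
  by move=> k l; rewrite -oM; apply: eq_cint => s; rewrite !pE.
have := dimension_bound cf se oe sh KE kE op.
apply/negP; rewrite -ltNge.
apply: (@le_lt_trans _ _ (m%:R%:E * (mu2 E + 1))%E).
  by rewrite lee_wpmul2l ?lee_fin.
rewrite -(fineK Efin) -EFinD -EFinM lte_fin.
exact: truncnS_gt.
Qed.

End FiniteRankWeyl.

Theorem theorem1p1 (R : realType) (f : R * R -> R[i])
    (f_L1 : cLfun (leb2 R) 1%E f)
    (supp_f : (leb2 R [set w | f w != 0%R] < +oo)%E)
    (Wf_finite_rank : finite_rank (weyl f)) :
  {ae leb2 R, forall w, f w = 0}.
Proof.
by move: supp_f Wf_finite_rank; apply: finite_rank_weyl_eq0; exact: cLfun1P.
Qed.
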